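(* Let $M$ be an aspherical topological space with amenable fundamental group $\Gamma := \pi_1(M)$ and let $n \in \mathbb{N}$. Let $\alpha = \Gamma \curvearrowright (X,\mu)$ be an essentially free standard $\Gamma$-space. Then there is a constant $K \in \mathbb{R}_{>0}$ such that: for every cycle $c \in C_n(M;\mathbb{Z}) \subset C_n(M;\alpha)$ that is null-homologous in $C_*(M;\mathbb{Z})$ there exists a chain $b \in C_{n+1}(M;\alpha)$ with \[ \partial b = c \quad\text{and}\quad |b|_1 \leq K \cdot |c|_1. \]
   Context: A topological space is called aspherical if it is path-connected, locally path-connected and admits a contractible universal covering. For a countable group $\Gamma$, a standard $\Gamma$-space is a standard Borel probability space $(X,\mu)$ together with a measurable probability-measure-preserving left $\Gamma$-action (so $\Gamma$ is understood to be countable whenever a standard $\Gamma$-space is given); it is essentially free if $\mu$-almost every point has trivial stabiliser. $L^\infty(X;\mathbb{Z})$ is the group of (almost everywhere classes of) essentially bounded measurable functions $X \to \mathbb{Z}$, with norm $|f| = \int_X |f|\,d\mu$ and right $\Gamma$-action $(f\cdot\gamma)(x) = f(\gamma\cdot x)$. With $\widetilde{M}$ the universal covering of $M$, on whose integral singular chain complex $\Gamma$ acts from the left by deck transformations, set $C_*(M;\alpha) := L^\infty(X;\mathbb{Z}) \otimes_{\mathbb{Z}\Gamma} C_*(\widetilde{M};\mathbb{Z})$, with norm $\bigl|\sum_{j=1}^m f_j \otimes \sigma_j\bigr|_1 := \sum_{j=1}^m \int_X |f_j|\,d\mu$, where the sum is in reduced form, i.e., the singular simplices $\sigma_j$ of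 $\widetilde{M}$ lie in pairwise different $\Gamma$-orbits. The complex $C_*(M;\mathbb{Z}) \cong \mathbb{Z} \otimes_{\mathbb{Z}\Gamma} C_*(\widetilde{M};\mathbb{Z})$ is viewed as a subcomplex of $C_*(M;\alpha)$ via the inclusion $\mathbb{Z} \hookrightarrow L^\infty(X;\mathbb{Z})$ as constant functions; $|c|_1$ is then the usual integral $\ell^1$-norm of $c$. *)

(* Defs.v *)
From HB Require Import structures.
(* [freeg] comes first because it exports constants such as [lift]. *)
From mathcomp Require Import freeg.
From mathcomp Require Import all_boot all_order all_algebra.
From mathcomp Require Import generic_quotient ring_quotient.
From mathcomp Require Import all_classical all_reals all_analysis.
From mathcomp Require Import homotopy.
From mathcomp Require Import lra.

Set Implicit Arguments.
Unset Strict Implicit.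
Unset Printing Implicit Defensive.

Import Order.TTheory GRing.Theory Num.Theory numFieldNormedType.Exports.

Local Open Scope classical_set_scope.
Local Open Scope ring_scope.
Local Open Scope quotient_scope.

(** * Paths and the fundamental group *)

Section UnitInterval.
Variable R : realType.

Definition unitI := set_type (`[0, 1]%classic : set R).
HB.instance Definition _ := SubType.on unitI.
HB.instance Definition _ := Topological.on unitI.

Lemma clamp_subproof (r : R) :
  Num.max 0 (Num.min 1 r) \in (`[0, 1]%classic : set R).
Proof.
rewrite inE /= in_itv /= le_max lexx /= ge_max ler01 /=.
by rewrite ge_min lexx.
Qed.

(* The nearest-point retraction of the line onto the unit interval. *)
Definition clamp (r : R) : unitI := exist (fun x => x \in _) _ (clamp_subproof r).

Lemma val_clamp r : 0 <= r <= 1 -> \val (clamp r) = r.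
Proof. by move=> /andP[r0 r1]; rewrite /= min_r // max_r. Qed.

Lemma clampK : cancel (\val : unitI -> R) clamp.
Proof.
move=> x; apply: val_inj; rewrite val_clamp //.
by case: x => /= r /set_mem; rewrite /= in_itv.
Qed.

Lemma unitI_itv (x : unitI) : 0 <= \val x <= 1.
Proof. by case: x => /= r /set_mem; rewrite /= in_itv. Qed.

Lemma val_continuous : continuous (\val : unitI -> R).
Proof. exact: initial_continuous. Qed.

Lemma clamp_continuous : continuous clamp.
Proof.
apply: continuous_comp_initial => x /=.
apply: (@continuous_max R R (cst 0) (fun y => Num.min 1 y)); first exact: cvg_cst.
by apply: (@continuous_min R R (cst 1) id); [exact: cvg_cst | exact: cvg_id].
Qed.

Lemma clamp01_neq : clamp 0 != clamp 1.
Proof.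
apply/eqP => /(congr1 \val); rewrite !val_clamp ?lexx ?ler01 //.
by move/eqP; rewrite eq_sym oner_eq0.
Qed.

HB.instance Definition _ := isBiPointed.Build unitI clamp01_neq.

End UnitInterval.

Section RealContinuity.
Variables (R : realType) (T : topologicalType).
Implicit Types f g : T -> R.

Lemma ccst (a : R) : continuous (fun _ : T => a).
Proof. by move=> t; exact: cvg_cst. Qed.

Lemma cadd f g : continuous f -> continuous g -> continuous (fun t => f t + g t).
Proof. by move=> cf cg t; apply: cvgD; [exact: cf | exact: cg]. Qed.

Lemma copp f : continuous f -> continuous (fun t => - f t).
Proof. by move=> cf t; apply: cvgN; exact: cf. Qed.

Lemma cmul f g : continuous f -> continuous g -> continuous (fun t => f t * g t).
Proof. by move=> cf cg t; apply: cvgM; [exact: cf | exact: cg]. Qed.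

Lemma cmax f g :
  continuous f -> continuous g -> continuous (fun t => Num.max (f t) (g t)).
Proof. by move=> cf cg t; apply: (@continuous_max R T f g); [exact: cf | exact: cg]. Qed.

Lemma cmin f g :
  continuous f -> continuous g -> continuous (fun t => Num.min (f t) (g t)).
Proof. by move=> cf cg t; apply: (@continuous_min R T f g); [exact: cf | exact: cg]. Qed.

End RealContinuity.

Section Homotopy.
Variables (R : realType) (M : topologicalType).
Local Notation I := (unitI R).
Implicit Types x y z : M.

Definition path_homotopic x y (p q : {path I from x to y}) : Prop :=
  exists H : I * I -> M,
    [/\ continuous H, forall t, H (t, zero) = p t, forall t, H (t, one) = q t,
        forall s, H (zero, s) = x & forall s, H (one, s) = y].

Lemma glue_continuous (T U : topologicalType) (h : T -> R) (f g : T -> U) :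
  continuous h -> continuous f -> continuous g ->
  (forall t, h t = 0 -> f t = g t) ->
  continuous (fun t => if h t <= 0 then f t else g t).
Proof.
move=> ch cf cg fg.
have c1 : closed [set t | h t <= 0].
  by apply: (@preimage_closed T R h [set r | r <= 0]) => [? _|]; [exact: ch | exact: closed_le].
have c2 : closed [set t | h t >= 0].
  by apply: (@preimage_closed T R h [set r | r >= 0]) => [? _|]; [exact: ch | exact: closed_ge].
apply/continuous_subspace_setT.
have -> : [set: T] = [set t | h t <= 0] `|` [set t | h t >= 0].
  by apply/esym/seteqP; split=> // t _ /=; apply/orP; exact: le_total.
apply: withinU_continuous => //.
  apply: (@subspace_eq_continuous _ _ _ f); last exact: continuous_subspaceT.
  by move=> t; rewrite inE /from_subspace /= => ->.
apply: (@subspace_eq_continuous _ _ _ g); last exact: continuous_subspaceT.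
move=> t; rewrite inE /from_subspace /= => h0; case: ifPn => // h1.
by apply/esym/fg/le_anti; rewrite h1.
Qed.

Lemma unitI_continuous (T U : topologicalType) (f : I -> U) (h : T -> R) :
  continuous f -> continuous h -> continuous (fun t => f (clamp (h t))).
Proof.
move=> cf ch t; apply: (@continuous_comp _ _ _ (fun t => clamp (h t)) f).
  by apply: (@continuous_comp _ _ _ h (@clamp R)); [exact: ch | exact: clamp_continuous].
exact: cf.
Qed.

Lemma fst_val_continuous : continuous (fun a : I * I => \val a.1).
Proof.
move=> a; apply: (@continuous_comp (I * I)%type I R fst \val); first exact: cvg_fst.
exact: val_continuous.
Qed.

Lemma snd_val_continuous : continuous (fun a : I * I => \val a.2).
Proof.
move=> a; apply: (@continuous_comp (I * I)%type I R snd \val); first exact: cvg_snd.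
exact: val_continuous.
Qed.

Lemma square_continuous (T U : topologicalType) (f : I * I -> U) (h k : T -> R) :
  continuous f -> continuous h -> continuous k ->
  continuous (fun t => f (clamp (h t), clamp (k t))).
Proof.
move=> cf ch ck t.
apply: (@continuous_comp _ _ _ (fun t => (clamp (h t), clamp (k t))) f).
  have cid : continuous (@id I) by move=> x; exact: cvg_id.
  apply: (@cvg_pair _ _ _ (nbhs t) (nbhs (clamp (h t))) (nbhs (clamp (k t)))).
    exact: (unitI_continuous cid ch).
  exact: (unitI_continuous cid ck).
exact: cf.
Qed.

Lemma clamp_le0 (r : R) : r <= 0 -> clamp r = zero.
Proof.
move=> r0; apply: val_inj => /=.
by rewrite !max_l // ge_min ?r0 ?lexx ?orbT.
Qed.

Lemma clamp_ge1 (r : R) : 1 <= r -> clamp r = one.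
Proof. by move=> r1; apply: val_inj => /=; rewrite !min_l. Qed.

Lemma zeroE : zero = clamp 0 :> I. Proof. by []. Qed.
Lemma oneE : one = clamp 1 :> I. Proof. by []. Qed.
Lemma val0 : \val (zero : I) = 0. Proof. by rewrite zeroE val_clamp ?lexx ?ler01. Qed.
Lemma val1 : \val (one : I) = 1. Proof. by rewrite oneE val_clamp ?lexx ?ler01. Qed.

Section Concat.
Variables (x y z : M) (p : {path I from x to y}) (q : {path I from y to z}).

Definition path_concat (t : I) : M :=
  if \val t - 2^-1 <= 0 then p (clamp (2 * \val t))
  else q (clamp (2 * \val t - 1)).

Lemma path_concat_continuous : continuous path_concat.
Proof.
have cv : continuous (fun t : I => \val t) by exact: val_continuous.
have c2 : continuous (fun t : I => 2 * \val t).
  by apply: cmul; [exact: ccst | exact: cv].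
apply: glue_continuous.
- by apply: cadd; [exact: cv | exact: ccst].
- by apply: unitI_continuous; [exact: cts_fun|].
- apply: unitI_continuous; first exact: cts_fun.
  by apply: cadd; [exact: c2 | exact: ccst].
- move=> t h; have -> : \val t = 2^-1 by lra.
  by rewrite divff ?pnatr_eq0// subrr -oneE path_one -zeroE path_zero.
Qed.

Lemma path_concat0 : path_concat zero = x.
Proof.
rewrite /path_concat val0; case: ifPn => [_|]; last by move/negP => h; exfalso; apply h; lra.
by rewrite mulr0 -zeroE path_zero.
Qed.

Lemma path_concat1 : path_concat one = z.
Proof.
rewrite /path_concat val1; case: ifPn => [h|_]; first by exfalso; lra.
have -> : (2 * 1 - 1 = 1 :> R) by lra.
by rewrite -oneE path_one.
Qed.

HB.instance Definition _ :=
  isContinuous.Build I M path_concat path_concat_continuous.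
HB.instance Definition _ :=
  isPath.Build I M x z path_concat path_concat0 path_concat1.
End Concat.

Section Rev.
Variables (x y : M) (p : {path I from x to y}).

Definition path_rev (t : I) : M := p (clamp (1 - \val t)).

Lemma path_rev_continuous : continuous path_rev.
Proof.
apply: unitI_continuous; first exact: cts_fun.
by apply: cadd; [exact: ccst | apply: copp; exact: val_continuous].
Qed.

Lemma path_rev0 : path_rev zero = y.
Proof. by rewrite /path_rev val0 subr0 -oneE path_one. Qed.

Lemma path_rev1 : path_rev one = x.
Proof. by rewrite /path_rev val1 subrr -zeroE path_zero. Qed.

HB.instance Definition _ := isContinuous.Build I M path_rev path_rev_continuous.
HB.instance Definition _ := isPath.Build I M y x path_rev path_rev0 path_rev1.
End Rev.

Lemma path_homotopic_refl x y (p : {path I from x to y}) : path_homotopic p p.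
Proof.
exists (p \o fst); split=> [|//|//|s|s] /=; rewrite ?path_zero ?path_one //.
by move=> a; apply: continuous_comp; [exact: cvg_fst | exact: cts_fun].
Qed.

Lemma path_homotopic_sym x y (p q : {path I from x to y}) :
  path_homotopic p q -> path_homotopic q p.
Proof.
move=> [H [cH H0 H1 Hx Hy]].
exists (fun a => H (clamp (\val a.1), clamp (1 - \val a.2))); split=> [|t|t|s|s].
- apply: square_continuous => //; first exact: fst_val_continuous.
  by apply: cadd; [exact: ccst | apply: copp; exact: snd_val_continuous].
- by rewrite clampK val0 subr0 -oneE H1.
- by rewrite clampK val1 subrr -zeroE H0.
- by rewrite clampK Hx.
- by rewrite clampK Hy.
Qed.

Lemma path_homotopic_trans x y (p q r : {path I from x to y}) :
  path_homotopic p q -> path_homotopic q r -> path_homotopic p r.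
Proof.
move=> [H [cH H0 H1 Hx Hy]] [K [cK K0 K1 Kx Ky]].
exists (fun a => if \val a.2 - 2^-1 <= 0
  then H (clamp (\val a.1), clamp (2 * \val a.2))
  else K (clamp (\val a.1), clamp (2 * \val a.2 - 1))).
have c2 : continuous (fun a : I * I => 2 * \val a.2).
  by apply: cmul; [exact: ccst | exact: snd_val_continuous].
split=> [|t|t|s|s].
- apply: glue_continuous.
  + by apply: cadd; [exact: snd_val_continuous | exact: ccst].
  + by apply: square_continuous => //; exact: fst_val_continuous.
  + apply: square_continuous => //; first exact: fst_val_continuous.
    by apply: cadd; [exact: c2 | exact: ccst].
  + move=> t h; have -> : \val t.2 = 2^-1 by lra.
    by rewrite divff ?pnatr_eq0// subrr -oneE -zeroE H1 K0.
- rewrite val0; case: ifPn => [_|]; last by move/negP => h; exfalso; apply h; lra.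
  by rewrite mulr0 clampK -zeroE H0.
- rewrite val1; case: ifPn => [h|_]; first by exfalso; lra.
  by have -> : (2 * 1 - 1 = 1 :> R) by [lra]; rewrite clampK -oneE K1.
- by rewrite clampK; case: ifPn; rewrite ?Hx ?Kx.
- by rewrite clampK; case: ifPn; rewrite ?Hy ?Ky.
Qed.

Lemma path_homotopic_concat x y z (p p' : {path I from x to y})
    (q q' : {path I from y to z}) :
  path_homotopic p p' -> path_homotopic q q' ->
  path_homotopic (path_concat p q : {path I from x to z}) (path_concat p' q').
Proof.
move=> [H [cH H0 H1 Hx Hy]] [K [cK K0 K1 Kx Ky]].
exists (fun a => if \val a.1 - 2^-1 <= 0
  then H (clamp (2 * \val a.1), clamp (\val a.2))
  else K (clamp (2 * \val a.1 - 1), clamp (\val a.2))).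
have c2 : continuous (fun a : I * I => 2 * \val a.1).
  by apply: cmul; [exact: ccst | exact: fst_val_continuous].
split=> [|t|t|s|s].
- apply: glue_continuous.
  + by apply: cadd; [exact: fst_val_continuous | exact: ccst].
  + by apply: square_continuous => //; exact: snd_val_continuous.
  + apply: square_continuous => //; last exact: snd_val_continuous.
    by apply: cadd; [exact: c2 | exact: ccst].
  + move=> t h; have -> : \val t.1 = 2^-1 by lra.
    by rewrite divff ?pnatr_eq0// subrr -oneE -zeroE Hy Kx.
- by rewrite (clampK (t, zero).2) H0 K0.
- by rewrite (clampK (t, one).2) H1 K1.
- rewrite val0; case: ifPn => [_|]; last by move/negP => h; exfalso; apply h; lra.
  by rewrite mulr0 -zeroE Hx.
- rewrite val1; case: ifPn => [h|_]; first by exfalso; lra.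
  by have -> : (2 * 1 - 1 = 1 :> R) by [lra]; rewrite -oneE Ky.
Qed.

Lemma path_homotopic_rev x y (p p' : {path I from x to y}) :
  path_homotopic p p' ->
  path_homotopic (path_rev p : {path I from y to x}) (path_rev p').
Proof.
move=> [H [cH H0 H1 Hx Hy]].
exists (fun a => H (clamp (1 - \val a.1), clamp (\val a.2))); split=> [|t|t|s|s].
- apply: square_continuous => //; last exact: snd_val_continuous.
  by apply: cadd; [exact: ccst | apply: copp; exact: fst_val_continuous].
- by rewrite clampK H0.
- by rewrite clampK H1.
- by rewrite val0 subr0 -oneE Hy.
- by rewrite val1 subrr -zeroE Hx.
Qed.

Lemma reparam_homotopic x y (u : I -> M) (f g : I -> R)
    (p q : {path I from x to y}) :
  continuous u -> continuous f -> continuous g ->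
  (forall t, p t = u (clamp (f t))) -> (forall t, q t = u (clamp (g t))) ->
  f zero = g zero -> f one = g one -> path_homotopic p q.
Proof.
move=> cu cf cg pE qE fg0 fg1.
exists (fun a => u (clamp (f a.1 + \val a.2 * (g a.1 - f a.1)))).
split=> [|t|t|s|s].
- have c1 (h : I -> R) : continuous h -> continuous (fun a : I * I => h a.1).
    by move=> ch a; apply: (@continuous_comp _ _ _ fst h); [exact: cvg_fst | exact: ch].
  apply: unitI_continuous => //; apply: cadd; first exact: c1.
  apply: cmul; first exact: snd_val_continuous.
  by apply: cadd; [exact: c1 | apply: copp; exact: c1].
- by rewrite val0 mul0r addr0 pE.
- by rewrite val1 mul1r addrC subrK qE.
- by rewrite [g _](esym fg0) subrr mulr0 addr0 -pE path_zero.
- by rewrite [g _](esym fg1) subrr mulr0 addr0 -pE path_one.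
Qed.

Section ConcatE.
Variables (x y z : M) (p : {path I from x to y}) (q : {path I from y to z}).

Lemma path_concat_le (r : R) : 0 <= r <= 2^-1 ->
  path_concat p q (clamp r) = p (clamp (2 * r)).
Proof.
move=> /andP[r0 r1]; rewrite /path_concat val_clamp; last by apply/andP; split; lra.
by case: ifPn => // /negP[]; lra.
Qed.

Lemma path_concat_ge (r : R) : 2^-1 <= r <= 1 ->
  path_concat p q (clamp r) = q (clamp (2 * r - 1)).
Proof.
move=> /andP[r0 r1]; rewrite /path_concat val_clamp; last by apply/andP; split; lra.
case: ifPn => // h; rewrite clamp_ge1 ?path_one; last lra.
by rewrite clamp_le0 ?path_zero //; lra.
Qed.

End ConcatE.

Lemma path_concatA x y z w (p : {path I from x to y}) (q : {path I from y to z})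
    (r : {path I from z to w}) :
  path_homotopic
    (path_concat p (path_concat q r) : {path I from x to w})
    (path_concat (path_concat p q) r).
Proof.
have cv : continuous (fun t : I => \val t) by exact: val_continuous.
apply: (@reparam_homotopic _ _ (path_concat p (path_concat q r)) \val
  (fun t => Num.min (Num.min (2 * \val t) (\val t + 4^-1)) (2^-1 * \val t + 2^-1))).
- exact: cts_fun.
- exact: cv.
- apply: cmin; last by apply: cadd; [apply: cmul; [exact: ccst|] | exact: ccst].
  by apply: cmin; [apply: cmul; [exact: ccst|] | apply: cadd; [|exact: ccst]].
- by move=> t; rewrite -[in LHS](clampK t).
- move=> t; have := unitI_itv t; rewrite -[in LHS](clampK t).
  move: (\val t) => {t} t /andP[t0 t1].
  have [t4|t4] := lerP t 4^-1.
    rewrite [LHS]path_concat_le; last by apply/andP; split; lra.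
    rewrite [LHS]path_concat_le; last by apply/andP; split; lra.
    rewrite min_l; last by rewrite ge_min; apply/orP; left; lra.
    rewrite min_l; last lra.
    rewrite [RHS]path_concat_le; last by apply/andP; split; lra.
    by [].
  have [t2|t2] := lerP t 2^-1.
    rewrite [LHS]path_concat_le; last by apply/andP; split; lra.
    rewrite [LHS]path_concat_ge; last by apply/andP; split; lra.
    rewrite min_l; last by rewrite ge_min; apply/orP; right; lra.
    rewrite min_r; last lra.
    rewrite [RHS]path_concat_ge; last by apply/andP; split; lra.
    rewrite [RHS]path_concat_le; last by apply/andP; split; lra.
    by congr (q (clamp _)); lra.
  rewrite [LHS]path_concat_ge; last by apply/andP; split; lra.
  rewrite min_r; last by rewrite le_min; apply/andP; split; lra.
  rewrite [RHS]path_concat_ge; last by apply/andP; split; lra.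
  rewrite [RHS]path_concat_ge; last by apply/andP; split; lra.
  by congr (r (clamp _)); lra.
- rewrite val0 min_l; first by rewrite min_l; lra.
  by rewrite ge_min; apply/orP; left; lra.
- by rewrite val1 min_r; [|rewrite le_min; apply/andP; split]; lra.
Qed.

Lemma path_concat1p x y (p : {path I from x to y}) :
  path_homotopic (path_concat (cst x : {path I from x to x}) p
    : {path I from x to y}) p.
Proof.
have cv : continuous (fun t : I => \val t) by exact: val_continuous.
apply: (@reparam_homotopic _ _ p (fun t => Num.max 0 (2 * \val t - 1)) \val).
- exact: cts_fun.
- apply: cmax; first exact: ccst.
  by apply: cadd; [apply: cmul; [exact: ccst|] | exact: ccst].
- exact: cv.
- move=> t; have := unitI_itv t; rewrite -[in LHS](clampK t).
  move: (\val t) => {t} t /andP[t0 t1].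
  have [t2|t2] := lerP t 2^-1.
    rewrite [LHS]path_concat_le; last by apply/andP; split; lra.
    by rewrite [in RHS]clamp_le0 ?path_zero // ge_max lexx /=; lra.
  rewrite [LHS]path_concat_ge; last by apply/andP; split; lra.
  by rewrite max_r; last lra.
- by move=> t; rewrite -[in LHS](clampK t).
- by rewrite !val0 max_l; lra.
- by rewrite !val1 max_r; lra.
Qed.

Lemma path_concatp1 x y (p : {path I from x to y}) :
  path_homotopic (path_concat p (cst y : {path I from y to y})
    : {path I from x to y}) p.
Proof.
have cv : continuous (fun t : I => \val t) by exact: val_continuous.
apply: (@reparam_homotopic _ _ p (fun t => Num.min 1 (2 * \val t)) \val).
- exact: cts_fun.
- by apply: cmin; [exact: ccst | apply: cmul; [exact: ccst|]].
- exact: cv.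
- move=> t; have := unitI_itv t; rewrite -[in LHS](clampK t).
  move: (\val t) => {t} t /andP[t0 t1].
  have [t2|t2] := lerP t 2^-1.
    rewrite [LHS]path_concat_le; last by apply/andP; split; lra.
    by rewrite min_r; last lra.
  rewrite [LHS]path_concat_ge; last by apply/andP; split; lra.
  by rewrite [in RHS]clamp_ge1 ?path_one // le_min lexx /=; lra.
- by move=> t; rewrite -[in LHS](clampK t).
- by rewrite !val0 min_r; lra.
- by rewrite !val1 min_l; lra.
Qed.

Lemma path_concatpV x y (p : {path I from x to y}) :
  path_homotopic (path_concat p (path_rev p : {path I from y to x})
    : {path I from x to x}) (cst x).
Proof.
have cv : continuous (fun t : I => \val t) by exact: val_continuous.
apply: (@reparam_homotopic _ _ p
  (fun t => Num.min (2 * \val t) (2 - 2 * \val t)) (fun=> 0)).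
- exact: cts_fun.
- apply: cmin; first by apply: cmul; [exact: ccst|].
  by apply: cadd; [exact: ccst | apply: copp; apply: cmul; [exact: ccst|]].
- exact: ccst.
- move=> t; have := unitI_itv t; rewrite -[in LHS](clampK t).
  move: (\val t) => {t} t /andP[t0 t1].
  have [t2|t2] := lerP t 2^-1.
    rewrite [LHS]path_concat_le; last by apply/andP; split; lra.
    by rewrite min_l; last lra.
  rewrite [LHS]path_concat_ge; last by apply/andP; split; lra.
  rewrite min_r; last lra.
  rewrite [LHS]/= [LHS]/path_rev val_clamp; last by apply/andP; split; lra.
  by congr (p (clamp _)); lra.
- by move=> t; rewrite -zeroE path_zero.
- by rewrite !val0 min_l; lra.
- by rewrite !val1 min_r; lra.
Qed.

Lemma path_concatVp x y (p : {path I from x to y}) :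
  path_homotopic (path_concat (path_rev p : {path I from y to x}) p
    : {path I from y to y}) (cst y).
Proof.
have cv : continuous (fun t : I => \val t) by exact: val_continuous.
apply: (@reparam_homotopic _ _ p
  (fun t => Num.max (1 - 2 * \val t) (2 * \val t - 1)) (fun=> 1)).
- exact: cts_fun.
- apply: cmax.
    by apply: cadd; [exact: ccst | apply: copp; apply: cmul; [exact: ccst|]].
  by apply: cadd; [apply: cmul; [exact: ccst|] | exact: ccst].
- exact: ccst.
- move=> t; have := unitI_itv t; rewrite -[in LHS](clampK t).
  move: (\val t) => {t} t /andP[t0 t1].
  have [t2|t2] := lerP t 2^-1.
    rewrite [LHS]path_concat_le; last by apply/andP; split; lra.
    rewrite max_l; last lra.
    by rewrite [LHS]/= [LHS]/path_rev val_clamp //; apply/andP; split; lra.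
  rewrite [LHS]path_concat_ge; last by apply/andP; split; lra.
  by rewrite max_r; last lra.
- by move=> t; rewrite -oneE path_one.
- by rewrite !val0 max_l; lra.
- by rewrite !val1 max_r; lra.
Qed.

End Homotopy.

Section FundamentalGroup.
Variables (R : realType) (M : topologicalType) (x : M).
Local Notation I := (unitI R).
Local Notation loop := {path I from x to x}.

Definition loop_homotopic (p q : loop) : bool := `[< path_homotopic p q >].

Lemma loop_homotopic_refl : reflexive loop_homotopic.
Proof. by move=> p; apply/asboolP/path_homotopic_refl. Qed.

Lemma loop_homotopic_sym : symmetric loop_homotopic.
Proof.
by move=> p q; apply/asboolP/asboolP; exact: path_homotopic_sym.
Qed.

Lemma loop_homotopic_trans : transitive loop_homotopic.
Proof.
move=> q p r /asboolP pq /asboolP qr; apply/asboolP.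
exact: path_homotopic_trans pq qr.
Qed.

Canonical loop_homotopic_equiv :=
  EquivRel loop_homotopic loop_homotopic_refl loop_homotopic_sym
    loop_homotopic_trans.

Definition pi1 := {eq_quot loop_homotopic}.
HB.instance Definition _ := Choice.on pi1.
HB.instance Definition _ := EqQuotient.on pi1.

Definition pi1_class (p : loop) : pi1 := \pi p.

Lemma pi1_classP p q : pi1_class p = pi1_class q <-> path_homotopic p q.
Proof. by split=> [/eqmodP/asboolP|h]; [|apply/eqmodP/asboolP]. Qed.

Definition pi1_mul (a b : pi1) : pi1 :=
  pi1_class (path_concat (repr a) (repr b)).
Definition pi1_inv (a : pi1) : pi1 := pi1_class (path_rev (repr a)).
Definition pi1_one : pi1 := pi1_class (cst x).

Lemma pi1_mulE p q :
  pi1_mul (pi1_class p) (pi1_class q) = pi1_class (path_concat p q).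
Proof.
apply/pi1_classP/path_homotopic_concat; apply/pi1_classP;
  by rewrite /pi1_class reprK.
Qed.

Lemma pi1_invE p : pi1_inv (pi1_class p) = pi1_class (path_rev p).
Proof.
by apply/pi1_classP/path_homotopic_rev; apply/pi1_classP; rewrite /pi1_class reprK.
Qed.

Lemma pi1_mulA : associative pi1_mul.
Proof.
elim/quotW => p; elim/quotW => q; elim/quotW => r; rewrite -!/(pi1_class _).
by rewrite !pi1_mulE; apply/pi1_classP/path_concatA.
Qed.

Lemma pi1_mul1g : left_id pi1_one pi1_mul.
Proof.
elim/quotW => p; rewrite -!/(pi1_class _) pi1_mulE.
exact/pi1_classP/path_concat1p.
Qed.

Lemma pi1_mulg1 : right_id pi1_one pi1_mul.
Proof.
elim/quotW => p; rewrite -!/(pi1_class _) pi1_mulE.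
exact/pi1_classP/path_concatp1.
Qed.

Lemma pi1_mulVg : left_inverse pi1_one pi1_inv pi1_mul.
Proof.
elim/quotW => p; rewrite -!/(pi1_class _) pi1_invE pi1_mulE.
exact/pi1_classP/path_concatVp.
Qed.

Lemma pi1_mulgV : right_inverse pi1_one pi1_inv pi1_mul.
Proof.
elim/quotW => p; rewrite -!/(pi1_class _) pi1_invE pi1_mulE.
exact/pi1_classP/path_concatpV.
Qed.

HB.instance Definition _ := isGroup.Build pi1 pi1_mulA pi1_mul1g pi1_mulg1
  pi1_mulVg pi1_mulgV.

End FundamentalGroup.

(** * Coverings and aspherical spaces *)

Section Spaces.
Variable R : realType.
Local Notation I := (unitI R).

Definition path_connected (T : topologicalType) (A : set T) : Prop :=
  A !=set0 /\ forall x y, A x -> A y ->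
    exists f : {path I from x to y}, forall t, A (f t).

Definition locally_path_connected (T : topologicalType) : Prop :=
  forall (x : T) (U : set T), nbhs x U ->
    exists V : set T, [/\ open V, V x, V `<=` U & path_connected V].

Definition simply_connected (T : topologicalType) : Prop :=
  path_connected [set: T] /\ forall (x : T) (g : pi1 R x), g = 1%g.

Definition contractible (T : topologicalType) : Prop :=
  exists (a : T) (H : T * I -> T),
    [/\ continuous H, forall x, H (x, zero) = x & forall x, H (x, one) = a].

(* [W] is mapped homeomorphically onto [U] by [p], with inverse [s]. *)
Definition sheet (E M : topologicalType) (p : E -> M) (U : set M) (W : set E) :
    Prop :=
  exists s : M -> E,
    [/\ {within U, continuous s}, forall y, U y -> W (s y) /\ p (s y) = y
      & forall e, W e -> U (p e) /\ s (p e) = e].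

Definition evenly_covered (E M : topologicalType) (p : E -> M) (U : set M) :
    Prop :=
  exists V : set (set E),
    [/\ p @^-1` U = \bigcup_(W in V) W, trivIset V id
      & forall W, V W -> open W /\ sheet p U W].

Definition covering_map (E M : topologicalType) (p : E -> M) : Prop :=
  continuous p /\
  forall x : M, exists U : set M, [/\ open U, U x & evenly_covered p U].

Definition universal_covering (E M : topologicalType) (p : E -> M) : Prop :=
  covering_map p /\ simply_connected E.

Definition aspherical (M : topologicalType) : Prop :=
  [/\ path_connected [set: M], locally_path_connected M
    & exists (E : topologicalType) (p : E -> M),
        universal_covering p /\ contractible E].

Definition deck_transformation (E M : topologicalType) (p : E -> M)
    (D : continuousType E E) : Prop :=
  (forall e, p (D e) = p e) /\
  exists D' : continuousType E E, cancel D D' /\ cancel D' D.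

(* The deck transformation given by a class in the fundamental group maps the
   base point [e0] to the end point of the lift at [e0] of a representing loop.
   As [pi1] multiplies by concatenation from left to right, this is a left
   action. *)
Definition is_deck_of (E M : topologicalType) (p : E -> M) (e0 : E)
    (g : pi1 R (p e0)) (D : continuousType E E) : Prop :=
  deck_transformation p D /\
  exists (w : {path I from e0 to D e0}) (l : {path I from p e0 to p e0}),
    (forall t, p (w t) = l t) /\ pi1_class l = g.

(* For a universal covering of a locally path-connected space there is exactly
   one [D] with [is_deck_of g D]. *)
Definition deck (E M : topologicalType) (p : E -> M) (e0 : E)
    (g : pi1 R (p e0)) : continuousType E E :=
  xget (idfun : continuousType E E) [set D | is_deck_of g D].

End Spaces.

(** * Singular chains *)

Section SingularChains.
Variable R : realType.

Definition std_simplex (n : nat) : set 'rV[R]_n.+1 :=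
  [set t | (forall i, 0 <= t ord0 i) /\ \sum_i t ord0 i = 1].

Arguments std_simplex n : clear implicits.

Definition simplex (n : nat) := set_type (std_simplex n).
HB.instance Definition _ n := SubType.on (simplex n).
HB.instance Definition _ n := Topological.on (simplex n).

(* The [i]-th face inserts a zero as [i]-th barycentric coordinate. *)
Definition insert0 (n : nat) (i : 'I_n.+2) (t : 'rV[R]_n.+1) : 'rV[R]_n.+2 :=
  \row_j (if unlift i j is Some k then t ord0 k else 0).

Lemma face_subproof n (i : 'I_n.+2) (t : simplex n) :
  insert0 i (\val t) \in std_simplex n.+1.
Proof.
case: t => t /= /set_mem [t0 t1]; apply/mem_set; split=> [j|].
  by rewrite mxE; case: unlift.
rewrite (bigD1_ord i) //= mxE unlift_none add0r -[RHS]t1.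
by apply: eq_bigr => k _; rewrite mxE liftK.
Qed.

Definition face n (i : 'I_n.+2) (t : simplex n) : simplex n.+1 :=
  exist (fun x => x \in _) _ (face_subproof i t).

Lemma face_continuous n (i : 'I_n.+2) : continuous (face i).
Proof.
apply: continuous_comp_initial => t.
apply: (@continuous_comp (simplex n) 'rV[R]_n.+1 'rV[R]_n.+2 \val (insert0 i)).
  exact: initial_continuous.
move: (\val t) => {}t A [P tP PA].
exists (fun j k => P j (lift i k)) => [j k|u uP].
  by have := tP j (lift i k); rewrite mxE liftK (ord1 j).
apply: PA => j k; have := tP j k; rewrite !mxE.
case: unliftP => [l ->|-> /nbhs_singleton //] _.
by have := uP j l; rewrite (ord1 j).
Qed.

HB.instance Definition _ n (i : 'I_n.+2) :=
  isContinuous.Build _ _ (@face n i) (@face_continuous n i).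

Section Chains.
Variable T : topologicalType.

Definition sing (n : nat) := continuousType (simplex n) T.

Definition chain (n : nat) := {freeg (sing n) / int}.

Definition sing_chain n (s : sing n) : chain n := << s >>.

Definition sing_face n (i : 'I_n.+2) (s : sing n.+1) : sing n := s \o face i.

Definition sing_boundary n (c : chain n.+1) : chain n :=
  fglift (fun s : sing n.+1 =>
    \sum_(i < n.+2) (-1) ^+ i *: sing_chain (sing_face i s)) c.

Definition is_cycle n : chain n -> Prop :=
  match n with
  | 0 => fun=> True
  | m.+1 => fun c => sing_boundary c = 0
  end.

Definition null_homologous n (c : chain n) : Prop :=
  exists d : chain n.+1, sing_boundary d = c.

Definition chain_norm n (c : chain n) : R :=
  \sum_(s <- dom c) `|coeff s c|%:~R.

End Chains.

End SingularChains.

(** * Amenable groups and standard spaces *)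

Definition bounded_fun_on (R : realType) (T : Type) (f : T -> R) : Prop :=
  exists B : R, forall t, `|f t| <= B.

Definition amenable (R : realType) (G : groupType) : Prop :=
  exists m : (G -> R) -> R,
    [/\ forall (a : R) f g, bounded_fun_on f -> bounded_fun_on g ->
          m (fun x => a * f x + g x) = a * m f + m g,
        forall f, bounded_fun_on f -> (forall x, 0 <= f x) -> 0 <= m f,
        m (fun=> 1) = 1
      & forall (g : G) f, bounded_fun_on f -> m (fun x => f (g^-1 * x)%g) = m f].

Definition standard_borel (R : realType) d (X : measurableType d) : Prop :=
  exists (P : completePseudoMetricType R) (f : X -> P),
    [/\ hausdorff_space P, @second_countable P, bijective f
      & forall A : set X, measurable A <-> <<s @open P >> (f @` A)].

Record pmp_action (G : groupType) (R : realType) d (X : measurableType d)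
    (mu : probability X R) := PmpAction {
  pmp_act :> G -> X -> X;
  pmp_act1 : forall x, pmp_act 1%g x = x;
  pmp_actM : forall g h x, pmp_act (g * h)%g x = pmp_act g (pmp_act h x);
  pmp_act_measurable : forall g, measurable_fun [set: X] (pmp_act g);
  pmp_act_preserving : forall g A, measurable A ->
    mu (pmp_act g @^-1` A) = mu A
}.

Definition essentially_free (G : groupType) (R : realType) d
    (X : measurableType d) (mu : probability X R) (a : pmp_action G mu) : Prop :=
  {ae mu, forall x, forall g : G, a g x = x -> g = 1%g}.

(** * Integer-valued essentially bounded functions *)

Section Linf.
Variables (R : realType) (d : measure_display) (X : measurableType d).
Variable mu : probability X R.

Definition ess_bounded_int (f : X -> int) : Prop :=
  (forall A : set int, measurable (f @^-1` A)) /\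
  exists B : nat, {ae mu, forall x, (`|f x| <= B)%N}.

Definition ess_bounded_int_pred : {pred X -> int} :=
  fun f => `[< ess_bounded_int f >].

Lemma ess_bounded_int_zmod : zmod_closed ess_bounded_int_pred.
Proof.
split=> [|f g /asboolP[mf [B fB]] /asboolP[mg [C gC]]]; apply/asboolP; split.
- move=> A; have [A0|A0] := pselect (A 0).
    suff -> : (0 : X -> int) @^-1` A = setT by exact: measurableT.
    by apply/seteqP; split.
  suff -> : (0 : X -> int) @^-1` A = set0 by exact: measurable0.
  by apply/seteqP; split.
- by exists 0%N; exact: aeW.
- move=> A.
  have -> : (f - g) @^-1` A = \bigcup_(k in [set k : int * int | A (k.1 - k.2)])
      (f @^-1` [set k.1] `&` g @^-1` [set k.2]).
    apply/seteqP; split=> [x Ax|x [[k l] /= Akl [fx gx]]]; last first.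
      by move: Akl; rewrite -fx -gx.
    by exists (f x, g x).
  rewrite bigcup_mkcond; apply: countable_bigcupT_measurable => // k.
  by case: ifPn => _; [apply: measurableI | exact: measurable0].
- exists (B + C)%N; apply: filterS2 fB gC => x fB gC.
  apply: leq_trans (leq_add fB gC).
  by rewrite -lez_nat PoszD !abszE; exact: ler_normB.
Qed.

HB.instance Definition _ :=
  GRing.isZmodClosed.Build (X -> int) ess_bounded_int_pred ess_bounded_int_zmod.

Record ebfun := EbFun {
  ebfun_val :> X -> int;
  ebfunP : ebfun_val \in ess_bounded_int_pred
}.
HB.instance Definition _ := [isSub for ebfun_val].
HB.instance Definition _ := [Choice of ebfun by <:].
HB.instance Definition _ := [SubChoice_isSubZmodule of ebfun by <:].

Lemma ebfunB (f g : ebfun) x : (f - g) x = f x - g x.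
Proof. by rewrite -[LHS]/((\val (f - g)) x) raddfB. Qed.

Definition ae_zero : {pred ebfun} := fun f => `[< {ae mu, forall x, f x = 0} >].

Lemma ae_zero_zmod : zmod_closed ae_zero.
Proof.
split=> [|f g /asboolP f0 /asboolP g0]; apply/asboolP; first exact: aeW.
by apply: filterS2 f0 g0 => x fx gx; rewrite ebfunB fx gx subr0.
Qed.

HB.instance Definition _ := GRing.isZmodClosed.Build ebfun ae_zero ae_zero_zmod.

Definition LinfZ := Quotient.quot ae_zero.
HB.instance Definition _ := Choice.on LinfZ.
HB.instance Definition _ := EqQuotient.on LinfZ.
HB.instance Definition _ := GRing.Zmodule.on LinfZ.

Definition LinfZ_class (f : ebfun) : LinfZ := \pi f.

Definition LinfZ_norm (f : LinfZ) : R :=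
  \int[mu]_(x in [set: X]) `|(repr f : ebfun) x|%:~R.

Lemma cst_ess_bounded (k : int) :
  (cst k : X -> int) \in ess_bounded_int_pred.
Proof.
apply/asboolP; split=> [A|]; last by exists `|k|%N; exact: aeW.
by rewrite preimage_cst; case: ifPn => _; [exact: measurableT|exact: measurable0].
Qed.

Definition LinfZ_cst (k : int) : LinfZ := LinfZ_class (EbFun (cst_ess_bounded k)).

Section Action.
Variables (G : groupType) (a : pmp_action G mu).

Lemma act_ess_bounded (g : G) (f : ebfun) :
  (f \o a g) \in ess_bounded_int_pred.
Proof.
have /asboolP[mf [B fB]] := ebfunP f.
apply/asboolP; split=> [A|].
  rewrite comp_preimage -[X in measurable X]setTI.
  by apply: (pmp_act_measurable a g) => //; exact: measurableT.
exists B; case: fB => N [mN N0 sN]; exists (a g @^-1` N); split.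
- rewrite -[X in measurable X]setTI.
  by apply: (pmp_act_measurable a g) => //; exact: measurableT.
- by rewrite pmp_act_preserving.
- by move=> x /= xB; apply: sN.
Qed.

(* The right action [(f . g)(x) = f (g . x)]. *)
Definition LinfZ_act (f : LinfZ) (g : G) : LinfZ :=
  LinfZ_class (EbFun (act_ess_bounded g (repr f))).

Lemma LinfZ_classP (f f' : ebfun) :
  LinfZ_class f = LinfZ_class f' <-> {ae mu, forall x, f x = f' x}.
Proof.
have -> : {ae mu, forall x, f x = f' x} <-> f - f' \in ae_zero.
  split=> [h|/asboolP h]; [apply/asboolP|]; apply: filterS h => x.
    by rewrite ebfunB => ->; rewrite subrr.
  by rewrite ebfunB => /eqP; rewrite subr_eq0 => /eqP.
by split=> [/eqP|h]; [|apply/eqP]; rewrite -Quotient.idealrBE.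
Qed.

Lemma LinfZ_actE (f : ebfun) (g : G) :
  LinfZ_act (LinfZ_class f) g = LinfZ_class (EbFun (act_ess_bounded g f)).
Proof.
apply/LinfZ_classP.
have /LinfZ_classP[N [mN N0 sN]] : LinfZ_class (repr (LinfZ_class f)) = LinfZ_class f.
  by rewrite /LinfZ_class reprK.
exists (a g @^-1` N); split.
- rewrite -[X in measurable X]setTI.
  by apply: (pmp_act_measurable a g) => //; exact: measurableT.
- by rewrite pmp_act_preserving.
- by move=> x /= h; apply: sN.
Qed.

End Action.
End Linf.

(** * Tensor products over the integral group ring *)

(* [A] is a right and [B] a left module over the group ring of [G]; it suffices
   to balance over the elements of [G], which generate the group ring
   additively. *)
Section Tensor.
Variables (G : Type) (A B : zmodType) (ra : A -> G -> A) (la : G -> B -> B).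
Local Notation F := ({freeg (A * B)%type / int}).

Inductive tensor_null : F -> Prop :=
| TensorNull0 : tensor_null 0
| TensorNullB u v : tensor_null u -> tensor_null v -> tensor_null (u - v)
| TensorNullDl a a' b : tensor_null (<< (a + a', b) >> - << (a, b) >> - << (a', b) >>)
| TensorNullDr a b b' : tensor_null (<< (a, b + b') >> - << (a, b) >> - << (a, b') >>)
| TensorNullG a g b : tensor_null (<< (ra a g, b) >> - << (a, la g b) >>).

Definition tensor_null_pred : {pred F} := fun u => `[< tensor_null u >].

Lemma tensor_null_zmod : zmod_closed tensor_null_pred.
Proof.
split=> [|u v /asboolP nu /asboolP nv]; apply/asboolP; first exact: TensorNull0.
exact: TensorNullB.
Qed.

HB.instance Definition _ :=
  GRing.isZmodClosed.Build F tensor_null_pred tensor_null_zmod.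

Definition tensor := Quotient.quot tensor_null_pred.
HB.instance Definition _ := Choice.on tensor.
HB.instance Definition _ := EqQuotient.on tensor.
HB.instance Definition _ := GRing.Zmodule.on tensor.

Definition tens (a : A) (b : B) : tensor := \pi_tensor << (a, b) >>.

Lemma tensor_eqP (u v : F) :
  \pi_tensor u = \pi_tensor v <-> tensor_null (u - v).
Proof.
split=> [/eqP|uv]; first by rewrite -Quotient.idealrBE => /asboolP.
by apply/eqP; rewrite -Quotient.idealrBE; apply/asboolP.
Qed.

Lemma tensor_piB (u v : F) :
  \pi_tensor u - \pi_tensor v = \pi_tensor (u - v).
Proof. by rewrite !piE. Qed.

End Tensor.

Section TensorMap.
Variables (G : Type) (A B B' : zmodType) (ra : A -> G -> A).
Variables (la : G -> B -> B) (la' : G -> B' -> B') (f : B -> B').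

Definition tensor_lift (u : {freeg (A * B)%type / int}) :
    {freeg (A * B')%type / int} :=
  fglift (fun ab => << (ab.1, f ab.2) >>) u.

Lemma tensor_liftB u v : tensor_lift (u - v) = tensor_lift u - tensor_lift v.
Proof. exact: lift_is_additive. Qed.

Lemma tensor_liftU a b : tensor_lift << (a, b) >> = << (a, f b) >>.
Proof. by rewrite /tensor_lift liftU scale1r. Qed.

(* The map [id (x) f]. *)
Definition tensor_map (z : tensor ra la) : tensor ra la' :=
  \pi_(tensor ra la') (tensor_lift (repr z)).

Hypotheses (fD : {morph f : x y / x + y})
  (fG : forall g b, f (la g b) = la' g (f b)).

Lemma tensor_map_pi u :
  tensor_map (\pi_(tensor ra la) u) = \pi_(tensor ra la') (tensor_lift u).
Proof.
apply/tensor_eqP.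
have : tensor_null ra la (repr (\pi_(tensor ra la) u) - u).
  by apply/tensor_eqP; rewrite reprK.
rewrite -tensor_liftB; move: (_ - u) => {}u; elim => {u}.
- by rewrite -[0]subr0 tensor_liftB subrr; exact: TensorNull0.
- by move=> u v _ nu _ nv; rewrite tensor_liftB; exact: TensorNullB.
- by move=> x y b; rewrite !tensor_liftB !tensor_liftU; exact: TensorNullDl.
- by move=> x b c; rewrite !tensor_liftB !tensor_liftU fD; exact: TensorNullDr.
- by move=> x g b; rewrite !tensor_liftB !tensor_liftU fG; exact: TensorNullG.
Qed.

Lemma tensor_map_tens a b : tensor_map (tens ra la a b) = tens ra la' a (f b).
Proof. by rewrite /tens tensor_map_pi tensor_liftU. Qed.

Lemma tensor_mapB u v : tensor_map (u - v) = tensor_map u - tensor_map v.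
Proof.
elim/quotW: u => u; elim/quotW: v => v.
by rewrite tensor_piB !tensor_map_pi tensor_liftB tensor_piB.
Qed.

End TensorMap.

(** * The chain complexes with twisted coefficients *)

Section TwistedChains.
Variables (R : realType) (M E : topologicalType) (p : E -> M) (e0 : E).
Variables (d : measure_display) (X : measurableType d) (mu : probability X R).
Local Notation Gamma := (pi1 R (p e0)).
Variable a : pmp_action Gamma mu.

Definition deck_sing n (g : Gamma) (s : sing R E n) : sing R E n := deck g \o s.

Definition deck_chain n (g : Gamma) (c : chain R E n) : chain R E n :=
  fglift (fun s => sing_chain (deck_sing g s)) c.

Definition chain_alpha n := tensor (@LinfZ_act _ _ _ _ _ a) (@deck_chain n).

Definition tens_alpha n (f : LinfZ mu) (c : chain R E n) : chain_alpha n :=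
  tens _ _ f c.

Definition boundary_alpha n (z : chain_alpha n.+1) : chain_alpha n :=
  tensor_map _ (@sing_boundary R E n) z.

Lemma deck_chainB n g :
  zmod_morphism (@deck_chain n g : chain R E n -> chain R E n).
Proof. exact: lift_is_additive. Qed.

Lemma sing_boundary_deck n g (c : chain R E n.+1) :
  sing_boundary (deck_chain g c) = deck_chain g (sing_boundary c).
Proof.
have bB m : zmod_morphism (@sing_boundary R E m) by exact: lift_is_additive.
pose D m : {additive chain R E m -> chain R E m} := HB.pack (@deck_chain m g)
  (GRing.isZmodMorphism.Build _ _ _ (@deck_chainB m g)).
pose B : {additive chain R E n.+1 -> chain R E n} := HB.pack (@sing_boundary R E n)
  (GRing.isZmodMorphism.Build _ _ _ (bB n)).
have DU m k s : D m (k *: sing_chain s) = k *: sing_chain (deck_sing g s).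
  rewrite -[k]intz !scaler_int raddfMz; congr (_ *~ _).
  by rewrite /= /deck_chain /sing_chain liftU scale1r.
rewrite -[LHS]/(B (D _ c)) -[RHS]/(D _ (B c)) -[c]freeg_sumE !raddf_sum.
apply: eq_bigr => s _; rewrite -[coeff s c]intz -freegU_mulz !raddfMz.
congr (_ *~ _); rewrite -[<< s >>]scale1r DU scale1r.
rewrite scale1r /= /sing_boundary /sing_chain !liftU !scale1r.
rewrite -[RHS]/(D n _) raddf_sum; apply: eq_bigr => i _; rewrite DU.
by congr (_ *: sing_chain _); apply/continuousEP.
Qed.

Lemma boundary_alpha_tens n f (c : chain R E n.+1) :
  boundary_alpha (tens_alpha f c) = tens_alpha f (sing_boundary c).
Proof.
apply: tensor_map_tens => [u v|g b]; last exact: sing_boundary_deck.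
have bB m : zmod_morphism (@sing_boundary R E m) by exact: lift_is_additive.
pose B : {additive chain R E n.+1 -> chain R E n} := HB.pack (@sing_boundary R E n)
  (GRing.isZmodMorphism.Build _ _ _ (bB n)).
exact: (raddfD B).
Qed.

Definition same_orbit n (s t : sing R E n) : bool :=
  `[< exists g : Gamma, t = deck_sing g s >].

(* [s] lists the summands of a reduced form of [z]. *)
Definition reduced_form n (s : seq (LinfZ mu * sing R E n)) (z : chain_alpha n)
    : Prop :=
  z = \sum_(t <- s) tens_alpha t.1 (sing_chain t.2) /\
  pairwise (fun t u => ~~ same_orbit t.2 u.2) s.

(* All reduced forms of [z] give the same value. *)
Definition norm_alpha n (z : chain_alpha n) : R :=
  xget 0 [set r | exists2 s, reduced_form s z & r = \sum_(t <- s) LinfZ_norm t.1].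

Definition lift_sing n (s : sing R M n) : sing R E n :=
  xget (cst e0 : sing R E n) [set t | forall x, p (t x) = s x].

(* The inclusion of the integral chains of [M] as constant functions: a simplex
   of [M] corresponds to the orbit of its lifts. *)
Definition chain_incl n (c : chain R M n) : chain_alpha n :=
  tens_alpha (LinfZ_cst mu 1) (fglift (fun s => sing_chain (lift_sing s)) c).

End TwistedChains.

(* Main.v *)
From mathcomp Require Import freeg.
From HB Require Import structures.
From mathcomp Require Import all_boot all_order all_algebra.
From mathcomp Require Import generic_quotient.
From mathcomp Require Import all_classical all_reals all_analysis.
From mathcomp Require Import measurable_realfun homotopy.
From mathcomp Require Import ring lra zify.
Require Import Defs.

Set Implicit Arguments.
Unset Strict Implicit.
Unset Printing Implicit Defensive.

Import Order.TTheory GRing.Theory Num.Theory numFieldNormedType.Exports.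

Local Open Scope classical_set_scope.
Local Open Scope ring_scope.
Local Open Scope quotient_scope.

(** The proof fills a boundary by coning it after it has been cut up along an
    almost equivariant map from [X] to the group.

    Write [c = bd d] with an integral chain [d] of [M], lift [d] to a chain [D] of
    [E] and put [z = bd D].  Then [1 (x) z] is the image of [c] in the twisted
    complex, because lifts of a simplex are translates of each other
    ([chain_incl_proj]).  The space [E] is contractible, since universal coverings
    of [M] are unique up to homeomorphism ([contractible_universal_covering]), so
    it has a cone operator [h] on singular chains, which maps simplices to
    simplices and satisfies [bd h bd = bd] ([boundary_cone_boundary]).  It is far
    from equivariant, hence the norm of the filling [1 (x) h z] is only bounded by
    that of [z], in which the simplices of one orbit do not cancel.

    Let [phi : X -> G] be a measurable map with finitely many values [g].  On the
    set [phi = g] one cones [g^-1 z] instead of [z]: the chain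
    [b = sum_g (1_{phi = g} . g) (x) h (g^-1 z)] satisfies [bd b = 1 (x) z]
    whatever [phi] is ([boundary_filling]).  For its norm, collect the simplices
    [h_i s] of [z] in the orbit of [s], with coefficients [a_i].  Over a point [x]
    the simplex [h_i s] is moved to [phi(h_i x)^-1 h_i s].  If
    [phi(h_i x) = h_i phi(x)] for all [i], these positions agree and the
    coefficients are added before coning, so the contribution of [x] is at most
    [|sum_i a_i|], the coefficient of [c].  At the other points it is at most the
    norm of [z].  Hence [|b| <= |c| + |z| mu(Bad)] ([norm_filling]), where [Bad]
    is the set of points at which [phi] is not equivariant along the finitely many
    [h_i].  If [mu(Bad)] can be made small, [K = 2] works, as a nonzero integral
    chain has norm at least one.

    Such maps exist for essentially free actions of amenable groups
    ([approx_equivariant]).  Amenability gives Folner sets [F]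
    ([amenable_folner]): without them, a Hahn-Banach argument produces bounded
    functions whose coboundaries add up to at least a positive constant, which an
    invariant mean excludes.  By freeness almost all of [X] is covered by finitely
    many sets [B] whose translates by [F] are disjoint.  Passing through them one
    by one, and using the tile [F x] for each [x] in [B] that has a definite
    proportion of unused elements, one defines [phi (g x) = g] on the unused part
    of the tile.  Double counting shows that little is left over in the end, and
    the edges along which [phi] is not equivariant either leave a tile, which is
    rare as [F] is almost invariant, or meet the rest.

    The norm of a twisted chain is defined by a reduced form; that it is bounded by
    the norm of any other representation ([norm_alpha_le]) follows from the
    coefficient maps at the orbits, which exist because the deck group acts freely
    and by a genuine action. *)

(** * Additive minorants of subadditive functions *)

Section AdditiveMinorant.
Variables (R : realType) (V : zmodType).
Implicit Types (p q : V -> R) (x y v w : V).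

Definition subadditive p := forall x y, p (x + y) <= p x + p y.

Lemma subadditive_ge0 p : subadditive p -> 0 <= p 0.
Proof. by move=> /(_ 0 0); rewrite addr0; lra. Qed.

Lemma subadditive_mulrn p x k : subadditive p -> p (x *+ k.+1) <= p x *+ k.+1.
Proof.
move=> sp; elim: k => [|k IH]; first by rewrite !mulr1n.
by rewrite mulrS (mulrS (p x)); apply: le_trans (sp _ _) _; rewrite lerD2l.
Qed.

Lemma subadditive_minimal q : subadditive q ->
  exists p, [/\ subadditive p, forall x, p x <= q x &
    forall p', subadditive p' -> (forall x, p' x <= p x) -> p' = p].
Proof.
move=> sq.
pose T := {p : V -> R | subadditive p /\ forall x, p x <= q x}.
pose r (s t : T) := `[< forall x, sval t x <= sval s x >].
have lowq (t : T) x : - q (- x) <= sval t x.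
  case: t => p [sp pq] /=.
  have := sp x (- x); rewrite subrr => h.
  have := pq (- x); have := subadditive_ge0 sp; lra.
have [|||A totA|[p [sp pq]] pmin] := @Zorn T r.
- by move=> t; apply/asboolP.
- move=> s t u /asboolP st /asboolP tu; apply/asboolP => x.
  exact: le_trans (tu x) (st x).
- move=> [s ps] [t pt] /asboolP /= st /asboolP /= ts; apply: eq_exist => /=.
  by apply/funext => x; apply: le_anti; rewrite st ts.
- have [[t0 At0]|A0] := pselect (A !=set0); last first.
    exists (exist _ q (conj sq (fun x => lexx _))) => s As.
    by exfalso; apply: A0; exists s.
  pose B x : set R := [set sval t x | t in A].
  have Binf x : has_inf (B x).
    split; first by exists (sval t0 x), t0.
    by exists (- q (- x)) => _ [t At <-].
  have infle x t : A t -> inf (B x) <= sval t x.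
    by move=> At; apply: ge_inf; [exact: (Binf x).2 | exists t].
  (* As the family is a chain, two of its members have a common minorant in it. *)
  have sinf : subadditive (fun x => inf (B x)).
    move=> x y; rewrite leNgt; apply/negP => h.
    have e0 : 0 < (inf (B (x + y)) - (inf (B x) + inf (B y))) / 2 by lra.
    have [_ [s As <-] hs] := inf_adherent e0 (Binf x).
    have [_ [t At <-] ht] := inf_adherent e0 (Binf y).
    have [u [Au us ut]] : exists u, [/\ A u, forall z, sval u z <= sval s z
        & forall z, sval u z <= sval t z].
      have [/asboolP st|/asboolP ts] := totA s t As At.
        by exists t; split.
      by exists s; split.
    have := infle (x + y) u Au.
    have := (svalP u).1 x y; have := us x; have := ut y; lra.
  have infq x : inf (B x) <= q x.
    by apply: le_trans (infle x t0 At0) _; exact: (svalP t0).2.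
  exists (exist _ (fun x => inf (B x)) (conj sinf infq)) => s As.
  by apply/asboolP => x /=; exact: infle.
exists p; split=> // p' sp' p'p.
have p'q x : p' x <= q x by exact: le_trans (p'p x) (pq x).
have := pmin (exist _ p' (conj sp' p'q)).
by move=> /(_ (asboolT p'p)) /(congr1 sval).
Qed.

(** A Hahn-Banach theorem for abelian groups.  A minimal subadditive [p] is
    homogeneous because [p (k x) / k] is a subadditive minorant of it, and then
    additive because [inf_n (p (x + n v) - n p v)] is another one. *)
Lemma additive_minorant q : subadditive q ->
  exists L : V -> R, (forall x y, L (x - y) = L x - L y) /\ forall x, L x <= q x.
Proof.
move=> /subadditive_minimal[p [sp pq pmin]].
have hom x k : p (x *+ k.+1) = p x *+ k.+1.
  pose p' y := p (y *+ k.+1) / k.+1%:R.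
  have k0 : 0 < k.+1%:R :> R by rewrite ltr0n.
  suff E : p' = p.
    have e : p (x *+ k.+1) / k.+1%:R = p x by rewrite -[RHS](congr1 (@^~ x) E).
    by rewrite -e -[RHS]mulr_natr divfK // gt_eqF.
  apply: pmin => [y z|y]; rewrite /p' ?mulrnDl.
    by rewrite -mulrDl ler_pM2r ?invr_gt0.
  by rewrite ler_pdivrMr // mulr_natr; exact: subadditive_mulrn.
have p0 : p 0 = 0 by have := hom 0 1%N; rewrite mul0rn mulr2n; lra.
have homn x k : p (x *+ k) = p x *+ k by case: k => [|k]; rewrite ?mulr0n.
have addp x v : p (x + v) = p x + p v.
  pose B y : set R := [set p (y + v *+ k) - p v *+ k | k in [set: nat]].
  have Binf y : has_inf (B y).
    split; first by exists (p (y + v *+ 0) - p v *+ 0), 0%N.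
    exists (- p (- y)) => _ [k _ <-]; rewrite -homn.
    have := sp (y + v *+ k) (- y); rewrite addrAC subrr add0r; lra.
  have infle y k : inf (B y) <= p (y + v *+ k) - p v *+ k.
    by apply: ge_inf; [exact: (Binf y).2 | exists k].
  have E : (fun y => inf (B y)) = p.
    apply: pmin => [y z|y]; last first.
      by have := infle y 0%N; rewrite !mulr0n addr0 subr0.
    rewrite leNgt; apply/negP => h.
    have e0 : 0 < (inf (B (y + z)) - (inf (B y) + inf (B z))) / 2 by lra.
    have [_ [k _ <-] hk] := inf_adherent e0 (Binf y).
    have [_ [l _ <-] hl] := inf_adherent e0 (Binf z).
    have := infle (y + z) (k + l)%N; rewrite !mulrnDr addrACA.
    have := sp (y + v *+ k) (z + v *+ l); lra.
  have := infle x 1%N; rewrite -[inf (B x)]/((fun y => inf (B y)) x) E !mulr1n.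
  have := sp x v; lra.
exists p; split=> // x y.
by have := addp (x - y) y; rewrite subrK => ->; rewrite addrK.
Qed.

End AdditiveMinorant.
(** * Folner sets in amenable groups *)

Section Folner.
Variables (R : realType) (G : groupType).
Implicit Types (S T F : seq G) (s x : G).

Definition outer S F : nat := \sum_(s <- S) count (fun x => (s * x)%g \notin F) F.

(** The layer-cake argument of Namioka: an integral function is the sum of the
    indicators of its superlevel sets, and the positive parts of its
    differences add up over these layers. *)
Lemma folner_layers S (e : R) (f : G -> nat) T :
  (forall F, uniq F -> F != [::] -> e * (size F)%:R <= (outer S F)%:R) ->
  uniq T -> (forall x, (x \in T) = (0 < f x)%N) ->
  e * (\sum_(x <- T) f x)%:R
    <= (\sum_(s <- S) \sum_(x <- T) (f x - f (s * x)%g))%:R.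
Proof.
move=> nF; have [k le_k] := ubnP (\sum_(x <- T) f x)%N.
elim: k => // k IH in f T le_k *; move=> uT Tf.
case: (altP (T =P [::])) => [->|T0]; first by rewrite !big_nil mulr0 ler0n.
pose f' x := (f x).-1; pose T' := [seq x <- T | 1 < f x]%N.
have fE x : x \in T -> f x = (f' x).+1 by rewrite Tf /f' => /prednK.
have sumE : (\sum_(x <- T) f x = \sum_(x <- T') f' x + size T)%N.
  rewrite big_filter -sum1_size [X in (X + _)%N]big_mkcond /= -big_split /=.
  rewrite big_seq [RHS]big_seq; apply: eq_bigr => x xT; rewrite fE //.
  by case: (f' x) => [|m] /=; lia.
have T0s : (0 < size T)%N by rewrite lt0n size_eq0.
have -> : (\sum_(s <- S) \sum_(x <- T) (f x - f (s * x)%g)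
    = \sum_(s <- S) \sum_(x <- T') (f' x - f' (s * x)%g) + outer S T)%N.
  rewrite /outer -big_split /=; apply: eq_bigr => s _.
  rewrite big_filter -sum1_count [X in (X + _)%N]big_mkcond.
  rewrite [X in (_ + X)%N]big_mkcond -big_split /=.
  rewrite big_seq [RHS]big_seq; apply: eq_bigr => x; rewrite !Tf /f'.
  by case: (f (s * x)%g) => [|m] /=; case: (f x) => [|[|l]] //= _; lia.
rewrite sumE !natrD mulrDr; apply: lerD; last exact: nF.
apply: IH; rewrite ?filter_uniq //; first by move: le_k; rewrite sumE; lia.
by move=> x; rewrite mem_filter Tf /f'; case: (f x) => [|[]].
Qed.

Variable m : (G -> R) -> R.
Hypothesis mlin : forall (a : R) f g, bounded_fun_on f -> bounded_fun_on g ->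
  m (fun x => a * f x + g x) = a * m f + m g.
Hypothesis mpos : forall f, bounded_fun_on f -> (forall x, 0 <= f x) -> 0 <= m f.
Hypothesis m1 : m (fun=> 1) = 1.
Hypothesis minv : forall (g : G) f, bounded_fun_on f ->
  m (fun x => f (g^-1 * x)%g) = m f.

Lemma bounded_fun_cst (c : R) : bounded_fun_on (fun _ : G => c).
Proof. by exists `|c|. Qed.

Lemma bounded_funD (f g : G -> R) :
  bounded_fun_on f -> bounded_fun_on g -> bounded_fun_on (fun x => f x + g x).
Proof.
move=> [B fB] [C gC]; exists (B + C) => x.
by apply: le_trans (ler_normD _ _) _; exact: lerD.
Qed.

Lemma bounded_funN (f : G -> R) :
  bounded_fun_on f -> bounded_fun_on (fun x => - f x).
Proof. by move=> [B fB]; exists B => x; rewrite normrN. Qed.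

Lemma meanD f g : bounded_fun_on f -> bounded_fun_on g ->
  m (fun x => f x + g x) = m f + m g.
Proof.
move=> bf bg; rewrite -[m f in RHS]mul1r -mlin //.
by congr m; apply/funext => x; rewrite mul1r.
Qed.

Lemma mean0 : m (fun=> 0) = 0.
Proof.
have := meanD (bounded_fun_cst 0) (bounded_fun_cst 0).
have -> : (fun _ : G => 0 + 0) = (fun=> 0 : R) by apply/funext => x; rewrite addr0.
lra.
Qed.

Lemma meanN f : bounded_fun_on f -> m (fun x => - f x) = - m f.
Proof.
move=> bf; have := meanD bf (bounded_funN bf).
have -> : (fun x => f x - f x) = (fun=> 0 : R) by apply/funext => x; rewrite subrr.
by rewrite mean0; lra.
Qed.

(** An invariant mean vanishes on each difference [u_s - u_s (s^-1 .)] and is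
    monotone. *)
Lemma mean_coboundary S (u : G -> G -> R) (e : R) :
  (forall s, bounded_fun_on (u s)) ->
  (forall x, e <= \sum_(s <- S) (u s x - u s (s^-1 * x)%g)) -> e <= 0.
Proof.
move=> bu le_e.
pose D s x := u s x - u s (s^-1 * x)%g.
have bD s : bounded_fun_on (D s).
  apply: bounded_funD => //; apply: bounded_funN.
  by have [B uB] := bu s; exists B => x; exact: uB.
have D0 s : m (D s) = 0.
  rewrite /D (@meanD (u s)) //; last first.
    by apply: bounded_funN; have [B uB] := bu s; exists B => x; exact: uB.
  rewrite (@meanN (fun x => u s (s^-1 * x)%g)) ?minv ?subrr //.
  by have [B uB] := bu s; exists B => x; exact: uB.
have [bs ms] : bounded_fun_on (fun x => \sum_(s <- S) D s x) /\
    m (fun x => \sum_(s <- S) D s x) = 0.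
  elim: {le_e} S => [|s S [bS mS]].
    under [in X in _ /\ X = _]eq_fun do rewrite big_nil.
    by split; [exists 0 => x; rewrite big_nil normr0 | exact: mean0].
  have -> : (fun x => \sum_(t <- s :: S) D t x)
      = (fun x => D s x + \sum_(t <- S) D t x).
    by apply/funext => x; rewrite big_cons.
  by split; [exact: bounded_funD | rewrite meanD // D0 mS addr0].
have b1 := bounded_fun_cst 1; have bs' := bs.
have b2 : bounded_fun_on (fun x : G => (- e) * 1 + \sum_(s <- S) D s x).
  by apply: bounded_funD => //; exact: bounded_fun_cst.
have := mpos b2; rewrite mlin // ms m1 mulr1 addr0 => h.
have : 0 <= - e by apply: h => x; have := le_e x; rewrite /D; lra.
lra.
Qed.

End Folner.

Section FolnerSets.
Variables (R : realType) (G : groupType).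
Local Notation V := {freeg (G * G)%type / int}.

Lemma absz_max0D (a b : int) :
  (`|Num.max 0%R (a + b)%R| <= `|Num.max 0%R a| + `|Num.max 0%R b|)%N.
Proof. by rewrite /Num.max; do 3!case: ifP; lia. Qed.

Lemma subn_absz_max0 (a b : nat) :
  (a - b <= `|Num.max 0%R (a%:Z - b%:Z)%R|)%N.
Proof. by rewrite /Num.max; case: ifP; lia. Qed.

Definition possum (v : V) : nat := \sum_(k <- dom v) `|Num.max 0%R (coeff k v)|%N.

Lemma possumE (v : V) (L : seq (G * G)) : uniq L -> {subset dom v <= L} ->
  possum v = (\sum_(k <- L) `|Num.max 0%R (coeff k v)|)%N.
Proof.
move=> uL sL; rewrite /possum (perm_big [seq k <- L | k \in dom v]); last first.
  apply: uniq_perm; rewrite ?uniq_dom ?filter_uniq // => k.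
  rewrite mem_filter /=; have := sL k.
  by case: (k \in dom v) => // /(_ isT) ->.
rewrite big_filter big_mkcond /=; apply: eq_bigr => k _.
by case: ifPn => // /coeff_outdom ->; rewrite maxxx.
Qed.

Lemma possum_ge (v : V) (L : seq (G * G)) : uniq L ->
  (\sum_(k <- L) `|Num.max 0%R (coeff k v)| <= possum v)%N.
Proof.
move=> uL; pose L' := undup (L ++ dom v).
rewrite (@possumE v L') ?undup_uniq //; last first.
  by move=> k kv; rewrite mem_undup mem_cat kv orbT.
rewrite [leqRHS](bigID (mem L)) /= -[X in (_ <= X + _)%N]big_filter.
apply: leq_trans (leq_addr _ _); rewrite eq_leq //; apply: perm_big.
apply: uniq_perm; rewrite ?filter_uniq ?undup_uniq // => k.
by rewrite mem_filter mem_undup mem_cat; case: (k \in L).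
Qed.

Lemma possumD (v w : V) : (possum (v + w)%R <= possum v + possum w)%N.
Proof.
pose L := undup (dom v ++ dom w).
have uL : uniq L by exact: undup_uniq.
rewrite (possumE uL) 1?(possumE (v := v) uL) ?(possumE (v := w) uL).
- rewrite -big_split; apply: leq_sum => k _; rewrite coeffD.
  exact: absz_max0D.
- by move=> k kw; rewrite mem_undup mem_cat kw orbT.
- by move=> k kv; rewrite mem_undup mem_cat kv.
- by move=> k /domD_subset; rewrite mem_undup.
Qed.

(** Were there no Folner set, the subadditive function
    [v |-> inf_f (N (v + D f) - e |f|)] would be bounded below, [f] ranging over
    finite multisets, [D f (s, x) = f x - f (s x)] and [N] being the sum of the
    positive parts.  An additive minorant evaluated at the unit vectors is then
    a bounded family [u] with [sum_s (u_s - u_s (s^-1 .)) >= e], which no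
    invariant mean allows. *)
Theorem amenable_folner (S : seq G) (e : R) : amenable R G -> 0 < e ->
  exists F : seq G, [/\ uniq F, F != [::] & forall s, s \in S ->
    (count (fun x => (s * x)%g \notin F) F)%:R <= e * (size F)%:R].
Proof.
move=> [m [mlin mpos m1 minv]] e0; apply: contrapT => noF.
pose S' := undup S.
have nF F : uniq F -> F != [::] -> e * (size F)%:R <= (outer S' F)%:R.
  move=> uF F0; rewrite leNgt; apply/negP => lt_out; apply: noF.
  exists F; split=> // s sS; apply: le_trans (ltW lt_out).
  rewrite ler_nat /outer (bigD1_seq s) ?undup_uniq ?mem_undup //=.
  exact: leq_addr.
pose D (x : G) : V := \sum_(s <- S') (<< (s, x) >> - << (s, s^-1 * x)%g >>).
pose DD (f : seq G) := \sum_(x <- f) D x.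
have coeffDD f s x : s \in S' ->
    coeff (s, x) (DD f) = (count_mem x f)%:Z - (count_mem (s * x)%g f)%:Z.
  move=> sS; rewrite /DD; elim: f => [|y f IH]; first by rewrite big_nil coeff0.
  rewrite big_cons coeffD IH /= !PoszD.
  suff -> : coeff (s, x) (D y) = (y == x)%:Z - (y == s * x)%g%:Z by rewrite opprD addrACA.
  rewrite /D raddf_sum /= (bigD1_seq s) ?undup_uniq //= big1 ?addr0 => [|t ts].
    rewrite coeffB !coeffU !mul1r !xpair_eqE eqxx /=.
    have -> : ((s^-1 * y)%g == x) = (y == (s * x)%g).
      by apply/eqP/eqP => [<-|->]; rewrite ?mulVKg ?mulKg.
    by case: (y == x); case: (y == _).
  by rewrite coeffB !coeffU !xpair_eqE (negPf ts) /= !mulr0 subrr.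
have DDge f : e * (size f)%:R <= (possum (DD f))%:R.
  have uf := undup_uniq f.
  have := @folner_layers R G S' e (fun x => count_mem x f) (undup f) nF uf.
  rewrite -[X in _ * X%:R]/(\sum_(x <- undup f) count_mem x f)%N.
  have -> : (\sum_(x <- undup f) count_mem x f)%N = size f.
    under eq_bigr do rewrite -sum1_count.
    rewrite (exchange_big_dep predT) //= -sum1_size big_seq [RHS]big_seq.
    apply: eq_bigr => x xf; rewrite sum1_count.
    rewrite (eq_count (a2 := pred1 x)) => [|y]; last by rewrite /= eq_sym.
    by rewrite count_uniq_mem ?undup_uniq // mem_undup xf.
  move=> /(_ _)/le_trans; apply => [x|].
    by rewrite mem_undup -has_pred1 has_count.
  rewrite ler_nat.
  apply: leq_trans (@possum_ge (DD f) [seq (s, x) | s <- S', x <- undup f] _).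
    rewrite big_allpairs_dep /= big_seq [leqRHS]big_seq.
    apply: leq_sum => s sS; apply: leq_sum => x _; rewrite coeffDD //.
    exact: subn_absz_max0.
  by apply: allpairs_uniq; rewrite ?undup_uniq // => -[? ?] [? ?].
pose B v : set R := [set (possum (v + DD f))%:R - e * (size f)%:R | f in [set: seq G]].
have Binf v : has_inf (B v).
  split; first by exists ((possum (v + DD [::]))%:R - e * (size (nil : seq G))%:R), [::].
  exists (- (possum (- v))%:R) => _ [f _ <-].
  have := possumD (v + DD f) (- v); rewrite addrAC subrr add0r -(ler_nat R) natrD.
  have := DDge f; lra.
have [J infle adhJ] : exists2 J : V -> R,
    forall v f, J v <= (possum (v + DD f))%:R - e * (size f)%:R &
    forall v h, 0 < h -> exists f, (possum (v + DD f))%:R - e * (size f)%:R < J v + h.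
  exists (fun v => inf (B v)) => [v f|v h h0].
    by apply: ge_inf; [exact: (Binf v).2 | exists f].
  by have [_ [f _ <-] hf] := inf_adherent h0 (Binf v); exists f.
have subB : subadditive J.
  move=> v w; rewrite leNgt; apply/negP => h.
  have h0 : 0 < (J (v + w) - (J v + J w)) / 2 by rewrite divr_gt0 ?subr_gt0.
  have [f hf] := adhJ v _ h0; have [g hg] := adhJ w _ h0.
  have := possumD (v + DD f) (w + DD g); rewrite -(ler_nat R) natrD.
  have := infle (v + w) (f ++ g).
  have -> : DD (f ++ g) = DD f + DD g by rewrite /DD big_cat.
  rewrite addrACA size_cat natrD; move: hf hg {h}h0.
  move: (J _) (J _) (J _) (possum _)%:R (possum _)%:R (possum _)%:R.
  move: (size f)%:R (size g)%:R => x y a b c k l o.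
  by rewrite mulrDr; move: (e * x) (e * y) => ex ey; lra.
have [L [LB Lq]] := additive_minorant subB.
have L0 : L 0 = 0 by have := LB 0 0; rewrite subrr; lra.
have LN v : L (- v) = - L v by have := LB 0 v; rewrite sub0r L0 sub0r.
have LD v w : L (v + w) = L v + L w by rewrite -{1}[w]opprK LB LN opprK.
have Lsum (I : Type) (r : seq I) (f : I -> V) :
    L (\sum_(i <- r) f i) = \sum_(i <- r) L (f i).
  by elim: r => [|i r IH]; rewrite ?big_nil // !big_cons LD IH.
have LN' v : L v <= (possum v)%:R.
  by have := infle v [::]; have := Lq v; rewrite /DD big_nil addr0 mulr0; lra.
pose u s x := L << (s, x) >>.
have u1 s x : u s x <= 1.
  apply: le_trans (LN' _) _; rewrite /possum domU1 big_seq1 coeffU eqxx.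
  by rewrite mulr1 max_r.
have u0 s x : 0 <= u s x.
  have := LN' (- << (s, x) >>); rewrite LN.
  rewrite /possum (perm_big (dom (<< (s, x) >> : V))) ?domN_perm_eq //=.
  rewrite domU1 big_seq1 coeffN coeffU eqxx.
  by rewrite mulr1 max_l //= /u; lra.
have : e <= 0.
  apply: (@mean_coboundary R G m mlin mpos m1 minv S' u) => [s|x].
    by exists 1 => x; rewrite ger0_norm.
  have LDx : \sum_(s <- S') (u s x - u s (s^-1 * x)%g) = L (D x).
    by rewrite /D Lsum; apply: eq_bigr => s _; rewrite LB.
  have P0 : possum (- D x + DD [:: x]) = 0%N.
    by rewrite /DD big_seq1 addNr /possum dom0 big_nil.
  rewrite LDx; have := Lq (- D x); have := infle (- D x) [:: x].
  rewrite P0 LN mulr1; move: (J _) (L _) => a b; lra.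
lra.
Qed.

End FolnerSets.
(** * Expectation of bounded functions *)

Section BoundedMeasurable.
Variables (R : realType) (d : measure_display) (X : measurableType d).
Variable mu : probability X R.

Definition bounded_measurable (f : X -> R) : Prop :=
  measurable_fun [set: X] f /\ exists B : R, forall x, `|f x| <= B.

Definition expect (f : X -> R) : R := \int[mu]_(x in [set: X]) f x.

Definition mass (A : set X) : R := fine (mu A).

Lemma mass_setT : mass setT = 1.
Proof. by rewrite /mass (probability_setT mu). Qed.

Lemma bounded_measurable_integrable f :
  bounded_measurable f -> mu.-integrable [set: X] (EFin \o f).
Proof.
move=> [mf [B fB]]; apply: measurable_bounded_integrable => //.
  exact: fin_num_fun_lty.
exists B; split; first exact: num_real.
by move=> x Bx y _; apply: le_trans (fB y) (ltW Bx).
Qed.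

Lemma bounded_measurable_cst (c : R) : bounded_measurable (fun=> c).
Proof. by split; [exact: measurable_cst | exists `|c|]. Qed.

Lemma bounded_measurableD f g : bounded_measurable f -> bounded_measurable g ->
  bounded_measurable (fun x => f x + g x).
Proof.
move=> [mf [B fB]] [mg [C gC]]; split; first exact: measurable_funD.
by exists (B + C) => x; apply: le_trans (ler_normD _ _) _; exact: lerD.
Qed.

Lemma bounded_measurableZ (c : R) f : bounded_measurable f ->
  bounded_measurable (fun x => c * f x).
Proof.
move=> [mf [B fB]]; split.
  by apply: measurable_funM => //; exact: measurable_cst.
by exists (`|c| * B) => x; rewrite normrM ler_wpM2l.
Qed.

Lemma bounded_measurable_sum (I : Type) (r : seq I) (f : I -> X -> R) :
  (forall i, bounded_measurable (f i)) ->
  bounded_measurable (fun x => \sum_(i <- r) f i x).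
Proof.
move=> bf; elim: r => [|i r IH].
  under [X in bounded_measurable X]eq_fun do rewrite big_nil.
  exact: bounded_measurable_cst.
under [X in bounded_measurable X]eq_fun do rewrite big_cons.
exact: bounded_measurableD.
Qed.

Lemma bounded_measurable_indic A : measurable A ->
  bounded_measurable (\1_A : X -> R).
Proof.
move=> mA; split; first exact: measurable_indic.
by exists 1 => x; rewrite indicE; case: (x \in A); rewrite ?normr1 ?normr0 ?ler01.
Qed.

Lemma expectD f g : bounded_measurable f -> bounded_measurable g ->
  expect (fun x => f x + g x) = expect f + expect g.
Proof.
by move=> bf bg; rewrite /expect RintegralD //; exact: bounded_measurable_integrable.
Qed.

Lemma expectZ c f : bounded_measurable f ->
  expect (fun x => c * f x) = c * expect f.
Proof.
by move=> bf; rewrite /expect RintegralZl //; exact: bounded_measurable_integrable.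
Qed.

Lemma expect_cst c : expect (fun=> c) = c.
Proof. by rewrite /expect Rintegral_cst // -[fine _]/(mass setT) mass_setT mulr1. Qed.

Lemma expect_sum (I : Type) (r : seq I) (f : I -> X -> R) :
  (forall i, bounded_measurable (f i)) ->
  expect (fun x => \sum_(i <- r) f i x) = \sum_(i <- r) expect (f i).
Proof.
move=> bf; elim: r => [|i r IH].
  rewrite big_nil -[RHS](expect_cst 0); congr expect.
  by apply/funext => x; rewrite big_nil.
rewrite big_cons -IH -expectD //; last exact: bounded_measurable_sum.
by congr expect; apply/funext => x; rewrite big_cons.
Qed.

Lemma le_expect f g : bounded_measurable f -> bounded_measurable g ->
  (forall x, f x <= g x) -> expect f <= expect g.
Proof.
move=> bf bg fg; apply: le_Rintegral => // ; exact: bounded_measurable_integrable.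
Qed.

Lemma expect_indic A : measurable A -> expect \1_A = mass A.
Proof. by move=> mA; rewrite /expect /Rintegral integral_indic // setIT. Qed.

Lemma massE A : measurable A -> mu A = (mass A)%:E.
Proof. by move=> mA; rewrite /mass fineK // fin_num_measure. Qed.

Lemma mass_ge0 A : 0 <= mass A. Proof. by rewrite /mass fine_ge0. Qed.

Lemma le_mass A B : measurable A -> measurable B -> A `<=` B -> mass A <= mass B.
Proof.
by move=> mA mB AB; rewrite -lee_fin -!massE //; apply: le_measure; rewrite ?inE.
Qed.

Lemma massU A B : measurable A -> measurable B ->
  mass (A `|` B) <= mass A + mass B.
Proof.
move=> mA mB; rewrite -lee_fin EFinD -!massE //; last exact: measurableU.
exact: measureU2.
Qed.

Lemma massD A B : measurable A -> measurable B -> B `<=` A ->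
  mass (A `\` B) = mass A - mass B.
Proof.
move=> mA mB BA; apply: EFin_inj; rewrite EFinB -!massE //; last exact: measurableD.
rewrite measureD //; first by rewrite setIidr.
by rewrite -ge0_fin_numE // fin_num_measure.
Qed.

Lemma mass_set0 : mass set0 = 0.
Proof. by rewrite /mass measure0. Qed.

Lemma measurable_bigcup_seq (I : eqType) (r : seq I) (E : I -> set X) :
  (forall i, measurable (E i)) -> measurable [set x | exists2 i, i \in r & E i x].
Proof.
move=> mE; elim: r => [|i r IH].
  suff -> : [set x | exists2 i, i \in [::] & E i x] = set0 by exact: measurable0.
  by apply/seteqP; split=> // x [].
suff -> : [set x | exists2 j, j \in i :: r & E j x]
    = E i `|` [set x | exists2 j, j \in r & E j x] by exact: measurableU.
apply/seteqP; split=> [x [j]|x [Ex|[j jr Ex]]].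
- by rewrite inE => /predU1P[->|jr] Ex; [left | right; exists j].
- by exists i; rewrite ?mem_head.
- by exists j; rewrite ?inE ?jr ?orbT.
Qed.

Lemma mass_bigcup_seq (I : eqType) (r : seq I) (E : I -> set X) :
  (forall i, measurable (E i)) ->
  mass [set x | exists2 i, i \in r & E i x] <= \sum_(i <- r) mass (E i).
Proof.
move=> mE; rewrite -expect_indic; last exact: measurable_bigcup_seq.
have bE i : bounded_measurable (\1_(E i) : X -> R) by exact: bounded_measurable_indic.
under eq_bigr do rewrite -expect_indic //.
rewrite -expect_sum //; apply: le_expect; first last.
- move=> x; rewrite indicE; case: (boolP (x \in _)) => [|_]; last first.
    by apply: sumr_ge0 => i _; rewrite indicE.
  rewrite inE => -[i ir Ex]; rewrite (big_rem i) //= indicE mem_set //.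
  by rewrite lerDl; apply: sumr_ge0 => j _; rewrite indicE.
- exact: bounded_measurable_sum.
- by apply: bounded_measurable_indic; exact: measurable_bigcup_seq.
Qed.

End BoundedMeasurable.
(** * Partial tilings of an action *)

Section Tiling.
Variables (R : realType) (d : measure_display) (X : measurableType d).
Variables (mu : probability X R) (G : groupType) (a : pmp_action G mu).
Local Notation m := (mass mu).
Implicit Types (A Y : set X) (F S : seq G) (phi : X -> G).

Lemma pmp_actK g x : a g^-1%g (a g x) = x.
Proof. by rewrite -pmp_actM mulVg pmp_act1. Qed.

Lemma pmp_actVK g x : a g (a g^-1%g x) = x.
Proof. by rewrite -pmp_actM mulgV pmp_act1. Qed.

Lemma measurable_pre g A : measurable A -> measurable (a g @^-1` A).
Proof.
move=> mA; rewrite -[X in measurable X]setTI.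
exact: (pmp_act_measurable a g).
Qed.

Lemma mass_pre g A : measurable A -> m (a g @^-1` A) = m A.
Proof. by move=> mA; rewrite /mass pmp_act_preserving. Qed.

Definition translates F A : set X := [set x | exists2 g, g \in F & A (a g^-1%g x)].

Lemma measurable_translates F A : measurable A -> measurable (translates F A).
Proof.
move=> mA; apply: (@measurable_bigcup_seq _ X G F (fun g => a g^-1%g @^-1` A)) => g.
exact: measurable_pre.
Qed.

Lemma mass_translates F A : measurable A ->
  m (translates F A) <= (size F)%:R * m A.
Proof.
move=> mA.
apply: le_trans (@mass_bigcup_seq _ _ X mu G F (fun g => a g^-1%g @^-1` A) _) _.
  by move=> g; exact: measurable_pre.
under eq_bigr do rewrite mass_pre //.
by rewrite big_const_seq count_predT iter_addr addr0 mulr_natl.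
Qed.

Definition disjoint_translates F A := forall g h, g \in F -> h \in F ->
  forall x y, A x -> A y -> a g x = a h y -> g = h.

Definition finite_valued phi :=
  (exists V : seq G, forall x, phi x \in V) /\
  forall g, measurable (phi @^-1` [set g]).

Definition noneq phi s := [set x | phi (a s x) <> (s * phi x)%g].

Lemma measurable_noneq phi s : finite_valued phi -> measurable (noneq phi s).
Proof.
move=> [[V phiV] mphi].
have -> : noneq phi s = ~` [set x | exists2 g, g \in V &
    (phi @^-1` [set g] `&` a s @^-1` (phi @^-1` [set (s * g)%g])) x].
  apply/seteqP; split=> [x /= ne [g _ [/= <- /ne]] //|x /= ne e].
  by apply: ne; exists (phi x).
apply: measurableC; apply: measurable_bigcup_seq => g; apply: measurableI => //.
exact: measurable_pre.
Qed.

(** The edges [x -- s x] cut by a partial tiling of the complement of [Y] with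
    position function [phi]: an edge that meets this complement is cut unless
    both its ends lie there and [phi] is equivariant along it. *)
Definition cut s Y phi : set X :=
  [set x | ~ (Y x /\ Y (a s x)) /\ [\/ Y x, Y (a s x) | noneq phi s x]].

Lemma measurable_cut s Y phi : measurable Y -> finite_valued phi ->
  measurable (cut s Y phi).
Proof.
move=> mY fphi; have mYs := measurable_pre s mY.
have -> : cut s Y phi
    = ~` (Y `&` a s @^-1` Y) `&` (Y `|` a s @^-1` Y `|` noneq phi s).
  apply/seteqP; split=> x [ny].
    by case=> h; split=> //; [left; left|left; right|right].
  by move=> [[h|h]|h]; split=> //; [constructor 1|constructor 2|constructor 3].
apply: measurableI; first by apply: measurableC; exact: measurableI.
by apply: measurableU; [exact: measurableU | exact: measurable_noneq].
Qed.

Definition hits F Y x : R := \sum_(g <- F) \1_(a g @^-1` Y) x.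

Lemma le_hits F Y Y' x : Y' `<=` Y -> hits F Y' x <= hits F Y x.
Proof.
move=> Y'Y; apply: ler_sum => g _; rewrite !indicE ler_nat.
by case: (boolP (x \in a g @^-1` Y')) => //; rewrite inE => /Y'Y h; rewrite mem_set.
Qed.

Lemma bounded_measurable_hits F Y : measurable Y ->
  bounded_measurable (hits F Y).
Proof.
move=> mY; apply: bounded_measurable_sum => g.
by apply: bounded_measurable_indic; exact: measurable_pre.
Qed.

Lemma measurable_hits_ge F Y (c : R) : measurable Y ->
  measurable [set x | c <= hits F Y x].
Proof.
move=> mY; have [mh _] := bounded_measurable_hits F mY.
have := mh measurableT (`[c, +oo[%classic) (measurable_itv _).
by rewrite setTI; congr measurable; apply/seteqP; split=> x /=; rewrite in_itv /= andbT.
Qed.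

(** Double counting: the tiles over the points of [A], each with at least [c]
    elements in [Y], are disjoint. *)
Lemma mass_tiles F A Y (c : R) : uniq F -> measurable A -> measurable Y ->
  disjoint_translates F A -> (forall x, A x -> c <= hits F Y x) ->
  c * m A <= m (Y `&` translates F A).
Proof.
move=> uF mA mY sepA cA.
pose E g := a g @^-1` Y `&` A; pose E' g := a g^-1%g @^-1` A `&` Y.
have mE g : measurable (E g) by apply: measurableI => //; exact: measurable_pre.
have mE' g : measurable (E' g) by apply: measurableI => //; exact: measurable_pre.
have EE' g : m (E g) = m (E' g).
  rewrite -(mass_pre g (mE' g)); congr m.
  by apply/seteqP; split=> x; rewrite /E /E' /= pmp_actK => -[].
have mD : measurable (Y `&` translates F A).
  by apply: measurableI => //; exact: measurable_translates.
have bE g : bounded_measurable (\1_(E g) : X -> R) by exact: bounded_measurable_indic.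
have bE' g : bounded_measurable (\1_(E' g) : X -> R) by exact: bounded_measurable_indic.
have bA : bounded_measurable (\1_A : X -> R) by exact: bounded_measurable_indic.
apply: (@le_trans _ _ (\sum_(g <- F) m (E g))).
  under eq_bigr do rewrite -expect_indic //.
  rewrite -(expect_indic mu mA) -expectZ // -expect_sum //.
  apply: le_expect; [exact: bounded_measurableZ|exact: bounded_measurable_sum|].
  move=> x; rewrite indicE; case: (boolP (x \in A)) => [|xA]; last first.
    by rewrite mulr0; apply: sumr_ge0 => g _; rewrite indicE.
  rewrite inE mulr1 => Ax; apply: le_trans (cA x Ax) _.
  apply: ler_sum => g _; rewrite !indicE ler_nat.
  by case: (boolP (x \in a g @^-1` Y)) => //; rewrite inE => h; rewrite mem_set.
under eq_bigr do rewrite EE' -expect_indic //.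
rewrite -expect_sum // -(expect_indic mu mD).
apply: le_expect; [exact: bounded_measurable_sum|exact: bounded_measurable_indic|].
move=> x; have [[g gF E'x]|noE] := pselect (exists2 g, g \in F & E' g x); last first.
  rewrite big_seq big1 => [|g gF]; first by rewrite indicE.
  by rewrite indicE memNset // => h; apply: noE; exists g.
rewrite (bigD1_seq g) //= [X in _ + X]big_seq_cond big1 => [|h /andP[hF hg]].
  rewrite addr0 !indicE mem_set // mem_set //.
  by case: E'x => /= Ax Yx; split=> //; exists g.
rewrite indicE memNset // => -[/= Ah _]; case: E'x => /= Ag _.
by case/eqP: hg; apply: (sepA h g hF gF _ _ Ah Ag); rewrite !pmp_actVK.
Qed.

Section Step.
Variables (F S : seq G) (e c : R).
Hypotheses (uF : uniq F) (c0 : 0 < c).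
Hypothesis folF : forall s, s \in S ->
  (count (fun g => (s * g)%g \notin F) F)%:R <= e * (size F)%:R /\
  (count (fun g => (s^-1 * g)%g \notin F) F)%:R <= e * (size F)%:R.

Let kappa := 2 * e * (size F)%:R / c.

Definition partial_tiling Y phi := [/\ measurable Y, finite_valued phi &
  forall s, s \in S -> m (cut s Y phi) <= kappa * (1 - m Y)].

(** The tiles over the points of [A] that still have at least [c] elements in [Y]
    are removed from [Y], and [phi] records the position in the tile.  A newly cut
    edge has an end in one of these tiles, at one of the few elements of [F] that
    [s] or [s^-1] moves out of [F], so the mass of these edges is small relative
    to that of the tiles. *)
Lemma tiling_step A Y phi : partial_tiling Y phi -> measurable A ->
  disjoint_translates F A -> exists Y' phi', [/\ partial_tiling Y' phi', Y' `<=` Y &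
    forall x, A x -> hits F Y' x <= c].
Proof.
move=> [mY fphi cutY] mA sepA.
pose A' := A `&` [set x | c <= hits F Y x].
have mA' : measurable A' by apply: measurableI => //; exact: measurable_hits_ge.
have sepA' : disjoint_translates F A'.
  by move=> g h gF hF x y [Ax _] [Ay _]; exact: sepA.
pose D := Y `&` translates F A'; pose Y' := Y `\` translates F A'.
have mD : measurable D by apply: measurableI => //; exact: measurable_translates.
have mY' : measurable Y' by apply: measurableD => //; exact: measurable_translates.
have Y'E : Y' = Y `\` D.
  by apply/seteqP; split=> x /= [Yx nx]; split=> // h; apply: nx; [case: h|].
have massY' : m Y' = m Y - m D by rewrite Y'E massD // => x [].
have massD : c * m A' <= m D by apply: mass_tiles => // x [].
have [psi psiP] : {psi : X -> G & forall x, D x ->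
    psi x \in F /\ A' (a (psi x)^-1%g x)}.
  apply: (@choice _ _ (fun x g => D x -> g \in F /\ A' (a g^-1%g x))) => x.
  by have [[_ [g gF Ag]]|nD] := pselect (D x); [exists g | exists 1%g].
have psiE x g : D x -> g \in F -> A' (a g^-1%g x) -> psi x = g.
  move=> Dx gF Ag; have [pF Ap] := psiP x Dx.
  by apply: (sepA' _ _ pF gF _ _ Ap Ag); rewrite !pmp_actVK.
pose phi' x := if pselect (D x) then psi x else phi x.
have phi'D x g : D x -> g \in F -> A' (a g^-1%g x) -> phi' x = g.
  by move=> Dx gF Ag; rewrite /phi'; case: pselect => [Dx'|//]; exact: psiE.
have phi'N x : ~ D x -> phi' x = phi x by rewrite /phi'; case: pselect.
have fphi' : finite_valued phi'.
  case: fphi => -[V phiV] mphi; split.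
    exists (F ++ V) => x; rewrite mem_cat /phi'; case: pselect => Dx.
      by have [-> _] := psiP x Dx.
    by rewrite phiV orbT.
  move=> g; have mN : measurable (phi @^-1` [set g] `\` D) by exact: measurableD.
  have [gF|gF] := boolP (g \in F).
    suff -> : phi' @^-1` [set g] = (D `&` a g^-1%g @^-1` A') `|` (phi @^-1` [set g] `\` D).
      by apply: measurableU => //; apply: measurableI => //; exact: measurable_pre.
    apply/seteqP; split=> [x /= phix|x [[Dx Ag]|[/= phix nD]]]; last 2 first.
    - exact: phi'D.
    - by rewrite /= phi'N.
    have [Dx|nD] := pselect (D x); last by right; split=> //=; rewrite -phix phi'N.
    left; split=> //=; have [pF Ap] := psiP x Dx.
    by move: phix; rewrite (phi'D x _ Dx pF Ap) => <-.
  suff -> : phi' @^-1` [set g] = phi @^-1` [set g] `\` D by [].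
  apply/seteqP; split=> [x /= phix|x [/= phix nD]]; last by rewrite phi'N.
  have [Dx|nD] := pselect (D x); last by split=> //=; rewrite -phix phi'N.
  have [pF Ap] := psiP x Dx; move: phix; rewrite (phi'D x _ Dx pF Ap) => pg.
  by move: gF; rewrite -pg pF.
exists Y', phi'; split; first split=> // s sS; last first.
- move=> x Ax; have [A'x|nA'] := pselect (A' x); last first.
    have lt_c : hits F Y x < c by rewrite ltNge; apply/negP => h; apply: nA'.
    by apply: le_trans (ltW lt_c); apply: le_hits => y [].
  rewrite /hits big_seq big1 ?ltW // => g gF.
  by rewrite indicE memNset // => -[_]; apply; exists g; rewrite ?pmp_actK.
- by move=> x [].
pose F1 := [seq g <- F | (s * g)%g \notin F].
pose F2 := [seq g <- F | (s^-1 * g)%g \notin F].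
have sub : cut s Y' phi' `<=`
    cut s Y phi `|` (translates F1 A' `|` a s @^-1` translates F2 A').
  move=> x [nY' cx].
  have Y'D y : Y y -> ~ Y' y -> D y.
    by move=> Yy nYy; split=> //; apply: contrapT => h; apply: nYy.
  have [[Yx Yy]|nY] := pselect (Y x /\ Y (a s x)); last first.
    left; split=> //; have [Yx|nYx] := pselect (Y x); first by constructor 1.
    have [Yy|nYy] := pselect (Y (a s x)); first by constructor 2.
    constructor 3; case: cx => [[]|[]|] //; rewrite /noneq /= !phi'N //.
      by case.
    by case.
  have ncut : D x -> D (a s x) -> phi' (a s x) = (s * phi' x)%g -> False.
    by move=> [_ tx] [_ ty] e1; case: cx => [[]|[]|] //; apply.
  right; have [Dx|nDx] := pselect (D x).
    left; case: (Dx) => _ [g gF Ag]; exists g => //; rewrite mem_filter gF andbT.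
    apply/negP => sgF.
    have Asg : A' (a (s * g)^-1%g (a s x)).
      by rewrite -pmp_actM invgM mulgVK.
    have Dy : D (a s x) by split=> //; exists (s * g)%g.
    by apply: ncut => //; rewrite (phi'D _ _ Dx gF Ag) (phi'D _ _ Dy sgF Asg).
  have Dy : D (a s x).
    apply: (Y'D _ Yy) => Y'y; apply: nY'; split=> //; apply: contrapT => nY'x.
    by apply: nDx; exact: Y'D.
  right; case: (Dy) => _ [g gF Ag]; exists g => //; rewrite mem_filter gF andbT.
  apply/negP => sgF; apply: nDx; split=> //; exists (s^-1 * g)%g => //.
  by rewrite invgM invgK pmp_actM.
have mt1 := measurable_translates F1 mA'.
have mt2 := measurable_pre s (measurable_translates F2 mA').
have mc := measurable_cut s mY fphi.
have mU := measurableU _ _ mt1 mt2.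
have := le_mass mu (measurable_cut s mY' fphi') (measurableU _ _ mc mU) sub.
have := massU mu mc mU; have := massU mu mt1 mt2.
have := mass_translates F1 mA'; have := mass_translates F2 mA'.
rewrite (mass_pre s (measurable_translates F2 mA')) !size_filter.
have [f1 f2] := folF sS.
have := ler_wpM2r (mass_ge0 mu A') f1; have := ler_wpM2r (mass_ge0 mu A') f2.
have := cutY s sS.
have e0 : 0 <= e * (size F)%:R by apply: le_trans f1.
have : 2 * (e * (size F)%:R * m A') <= kappa * m D.
  rewrite /kappa -[leLHS](mulfK (lt0r_neq0 c0)).
  have -> : 2 * (e * (size F)%:R * m A') * c / c
    = 2 * e * (size F)%:R / c * (c * m A').
    by field; exact: lt0r_neq0.
  apply: ler_wpM2l massD; apply: divr_ge0 (ltW c0).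
  by rewrite -mulrA; apply: mulr_ge0.
rewrite massY'.
have -> : kappa * (1 - (m Y - m D)) = kappa * (1 - m Y) + kappa * m D by ring.
move: (kappa * (1 - m Y)) (kappa * m D) => k1 k2.
move: (_%:R * m A') (_%:R * m A') (_ * m A') => q1 q2 q3.
move: (m _) (m _) (m _) (m _) (m _) (m _) => *; lra.
Qed.

End Step.
End Tiling.
(** * Approximately equivariant maps *)

Lemma standard_borel_points (R : realType) (d : measure_display)
    (X : measurableType d) : standard_borel R X ->
  exists C : nat -> set X, (forall k, measurable (C k)) /\
    forall x y, x <> y -> exists k, C k x /\ ~ C k y.
Proof.
move=> [P [f [haus [B cB [Bo Bb]] fbij mf]]].
have /countable_injP[i /= iinj] := cB.
exists (fun k => [set x | exists U, [/\ B U, i U = k & U (f x)]]); split=> [k|x y xy].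
  have [[U [BU iU]]|nU] := pselect (exists U, B U /\ i U = k); last first.
    suff -> : [set x | exists U, [/\ B U, i U = k & U (f x)]] = set0 by [].
    by apply/seteqP; split=> // x [U [BU iU _]]; apply: nU; exists U.
  have -> : [set x | exists U, [/\ B U, i U = k & U (f x)]] = f @^-1` U.
    apply/seteqP; split=> [x [V [BV iV Vx]]|x Ux]; last by exists U.
    by rewrite /= -(iinj V U) ?inE // iU.
  apply/mf; have [g fK gK] := fbij.
  have -> : f @` (f @^-1` U) = U.
    apply/seteqP; split=> [_ [x Ux <-] //|z Uz].
    by exists (g z); rewrite /= gK.
  by apply: sub_sigma_algebra; exact: Bo.
have fxy : f x != f y by apply/eqP => /(bij_inj fbij).
have [A [oA /set_mem Ax Ay]] := hausdorff_accessible haus fxy.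
have [U [BU Ux] UA] := Bb (f x) A (open_nbhs_nbhs (conj oA Ax)).
exists (i U); split; first by exists U.
move=> [V [BV iV Vy]]; move: Ay; rewrite inE; apply; apply: UA.
by rewrite /= -(iinj V U) ?inE.
Qed.

Section Rokhlin.
Variables (R : realType) (d : measure_display) (X : measurableType d).
Variables (mu : probability X R) (G : groupType) (a : pmp_action G mu).
Local Notation m := (mass mu).

(** If [B] lies in [C] and [h B] in its complement, then [B] and [h B] are
    disjoint; countably many choices of [C] cover the free part. *)
Lemma free_cover (F : seq G) : standard_borel R X -> essentially_free a ->
  exists B : nat -> set X, [/\ forall k, measurable (B k),
    forall k, disjoint_translates a F (B k) & {ae mu, forall x, exists k, B k x}].
Proof.
move=> /standard_borel_points[C [mC Csep]] free.
pose Q := [seq h <- [seq (g^-1 * h)%g | g <- F, h <- F] | h != 1%g].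
pose fam := fix fam (q : seq G) (ks : seq nat) : set X :=
  if q is h :: q' then
    C (head 0%N ks) `&` a h @^-1` (~` C (head 0%N ks)) `&` fam q' (behead ks)
  else setT.
have mfam q ks : measurable (fam q ks).
  elim: q ks => [|h q IH] ks /=; first exact: measurableT.
  apply: measurableI => //; apply: measurableI => //.
  by apply: measurable_pre; exact: measurableC.
have famP q ks h x y : h \in q -> fam q ks x -> fam q ks y -> a h x <> y.
  elim: q ks => // g q IH ks; rewrite inE => /predU1P[->|hq].
    by move=> [[_ nC] _] [[Cy _] _] e; apply: nC; rewrite e.
  by move=> [_ fx] [_ fy]; exact: IH fx fy.
have famcov q x : (forall h, h \in q -> a h x <> x) -> exists ks, fam q ks x.
  elim: q => [|h q IH] hx; first by exists [::].
  have [|ks fx] := IH; first by move=> g gq; apply: hx; rewrite inE gq orbT.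
  have [|k [Ck nCk]] := Csep x (a h x).
    by move=> e; apply: (hx h); rewrite ?mem_head.
  by exists (k :: ks).
exists (fun k => if unpickle k is Some ks then fam Q ks else set0); split.
- by move=> k; case: (unpickle k).
- move=> k g h gF hF x y; case: (unpickle k) => // ks fx fy e.
  apply/eqP; apply/negPn/negP => gh; apply: (famP Q ks (h^-1 * g)%g x y) => //.
    rewrite mem_filter; apply/andP; split.
      by apply: contra gh => /eqP /(congr1 (fun z => h * z)%g); rewrite mulVKg mulg1 => ->.
    by apply/allpairsP; exists (h, g).
  by rewrite pmp_actM e pmp_actK.
- apply: filterS free => x fx; have [|ks fks] := famcov Q x.
    by move=> h; rewrite mem_filter => /andP[/eqP h1 _] /fx.
  by exists (pickle ks); rewrite pickleK.
Qed.

Lemma finite_free_cover (F : seq G) (e : R) :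
  standard_borel R X -> essentially_free a -> 0 < e ->
  exists (B : nat -> set X) (N : nat), [/\ forall k, measurable (B k),
    forall k, disjoint_translates a F (B k) &
    m (~` [set x | exists2 k, k \in iota 0 N & B k x]) <= e].
Proof.
move=> sX free e0; have [B [mB sB [Z [mZ Z0 BZ]]]] := free_cover F sX free.
pose U N := [set x | exists2 k, k \in iota 0 N & B k x].
have mU N : measurable (U N) by exact: measurable_bigcup_seq.
have mUU : measurable (\bigcup_N U N) by exact: bigcup_measurable.
have ndU : nondecreasing_seq U.
  move=> i j ij; apply/subsetPset => x [k ki Bk]; exists k => //.
  move: ki; rewrite !mem_iota /= !add0n => ki; apply: leq_trans ki _.
  exact: ij.
have m1 : m (\bigcup_N U N) = 1.
  apply/eqP; rewrite eq_le -{1}(mass_setT mu) le_mass //=.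
  have := @massU _ _ _ mu _ _ mUU mZ; rewrite /mass Z0 /= addr0 -!/(m _).
  apply: le_trans; rewrite -(mass_setT mu); apply: le_mass => //.
    exact: measurableU.
  move=> x _; have [[k Bk]|nB] := pselect (exists k, B k x); last by right; exact: BZ.
  by left; exists k.+1 => //; exists k => //; rewrite mem_iota add0n /=.
have cU := nondecreasing_cvg_mu mU mUU ndU (mu := mu).
have : \forall N \near \oo, 1 - e < m (U N).
  have /fine_cvgP[_ +] : mu (U N) @[N --> \oo] --> (1 : R)%:E.
    by rewrite -m1 -massE.
  move/cvgrPdist_lt => /(_ _ e0); apply: filterS => N /=.
  by rewrite ltr_norml -/(m (U N)) => /andP[_]; move: (m (U N)) => r; lra.
move=> [N _ /(_ N (leqnn N)) hN]; exists B, N; split=> //.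
rewrite -/(U N) -setTD massD //; rewrite mass_setT; lra.
Qed.

(** A mod null sets approximate version of an equivariant map [X -> G]; this is
    a form of the Ornstein-Weiss Rokhlin lemma.  Choose a Folner set [F] and
    pass once through a finite family of sets with disjoint [F]-translates that
    almost covers [X], adding at each step the tiles [F x] that still have a
    definite proportion of free elements.  The tiles have small boundary, and by double
    counting what remains free at the end is small. *)
Theorem approx_equivariant (S : seq G) (e : R) : amenable R G ->
  standard_borel R X -> essentially_free a -> 0 < e ->
  exists2 phi : X -> G, finite_valued phi &
    forall s, s \in S -> m (noneq a phi s) <= e.
Proof.
move=> amG sX free e0.
have d0 : 0 < e ^+ 2 / 16 by rewrite divr_gt0 // exprn_gt0.
have [F [uF F0 folF]] :=
  amenable_folner (S ++ [seq s^-1%g | s <- S]) amG d0.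
have szF : 0 < (size F)%:R :> R by rewrite ltr0n lt0n size_eq0.
pose c : R := e / 2 * (size F)%:R.
have c0 : 0 < c by rewrite mulr_gt0 // divr_gt0.
have e4 : 0 < e / 4 by rewrite divr_gt0.
have [B [N [mB sB leZ]]] := finite_free_cover F sX free e4.
have {}folF s : s \in S ->
    (count (fun g => (s * g)%g \notin F) F)%:R <= e ^+ 2 / 16 * (size F)%:R /\
    (count (fun g => (s^-1 * g)%g \notin F) F)%:R <= e ^+ 2 / 16 * (size F)%:R.
  move=> sS; split; apply: folF; rewrite mem_cat ?sS //.
  by rewrite map_f ?orbT.
have [Y [phi [[mY fphi cutY] hitY]]] : exists Y phi,
    partial_tiling a F S (e ^+ 2 / 16) c Y phi /\
    forall k, k \in iota 0 N -> forall x, B k x -> hits a F Y x <= c.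
  elim: (iota 0 N) => [|k ks [Y [phi [tY hitY]]]].
    exists setT, (fun=> 1%g); split=> //; split=> //.
      split; first by exists [:: 1%g] => x; rewrite mem_head.
      by move=> g; rewrite preimage_cst; case: ifP.
    move=> s sS; have -> : cut a s setT (fun=> 1%g) = set0.
      by apply/seteqP; split=> // x [+ _]; case.
    by rewrite mass_set0 mass_setT subrr mulr0.
  have [Y' [phi' [tY' Y'Y hitY']]] := tiling_step uF c0 folF tY (mB k) (sB k).
  exists Y', phi'; split=> // j; rewrite inE => /predU1P[-> //|jks] x Bx.
  by apply: le_trans (hitY j jks x Bx); exact: le_hits.
exists phi => // s sS.
pose Z := ~` [set x | exists2 k, k \in iota 0 N & B k x].
have mZ : measurable Z by apply: measurableC; exact: measurable_bigcup_seq.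
have leY : (size F)%:R * m Y <= c + (size F)%:R * m Z.
  have -> : (size F)%:R * m Y = expect mu (hits a F Y).
    rewrite /hits expect_sum => [|g]; last first.
      by apply: bounded_measurable_indic; exact: measurable_pre.
    under eq_bigr => g _ do rewrite (expect_indic mu (measurable_pre a g mY)) mass_pre //.
    by rewrite big_const_seq count_predT iter_addr addr0 mulr_natl.
  have bZ : bounded_measurable (\1_Z : X -> R) by exact: bounded_measurable_indic.
  rewrite -(expect_cst mu c) -(expect_indic mu mZ) -expectZ // -expectD //; last 2 first.
  - exact: bounded_measurable_cst.
  - exact: bounded_measurableZ.
  apply: le_expect; first exact: bounded_measurable_hits.
    apply: bounded_measurableD; [exact: bounded_measurable_cst|exact: bounded_measurableZ].
  move=> x; have [Zx|] := pselect (Z x); last first.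
    move=> /contrapT[k kN Bx]; apply: le_trans (hitY k kN x Bx) _.
    by rewrite lerDl mulr_ge0 // indicE.
  rewrite [\1_Z _]indicE mem_set // mulr1.
  apply: (@le_trans _ _ (size F)%:R); last by rewrite lerDr ltW.
  rewrite /hits -sum1_size natr_sum; apply: ler_sum => g _.
  by rewrite indicE; case: (_ \in _).
have mYe : m Y <= e / 2 + e / 4.
  rewrite -(ler_pM2l szF); apply: le_trans leY _.
  rewrite mulrDr {1}/c [_ * (size F)%:R]mulrC lerD2l ler_pM2l //.
have sub : noneq a phi s `<=` cut a s Y phi `|` Y.
  move=> x nx; have [Yx|nYx] := pselect (Y x); [by right|left].
  by split=> [[]//|]; constructor 3.
have := le_mass mu (measurable_noneq a s fphi)
  (measurableU _ _ (measurable_cut a s mY fphi) mY) sub.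
have := massU mu (measurable_cut a s mY fphi) mY.
have := cutY s sS.
have -> : 2 * (e ^+ 2 / 16) * (size F)%:R / c = e / 4.
  by rewrite /c; field; rewrite !gt_eqF.
have : 0 <= e / 4 * m Y by rewrite mulr_ge0 ?mass_ge0 // ltW.
rewrite mulrBr mulr1; lra.
Qed.

End Rokhlin.
(** * Lifting along covering maps *)

Section Topology.
Variable R : realType.

Lemma near_eq_continuous (T U : topologicalType) (f g : T -> U) (x : T) :
  (\forall y \near x, f y = g y) -> {for x, continuous g} -> {for x, continuous f}.
Proof.
move=> fg cg A nA; have := cg A; rewrite /= -(nbhs_singleton fg) => /(_ nA) h.
change (nbhs x (f @^-1` A)).
by apply: filterS2 fg h => y /= ->.
Qed.

Lemma continuous_for_comp (T U W : topologicalType) (f : T -> U) (g : U -> W) (x : T) :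
  {for x, continuous f} -> {for f x, continuous g} -> {for x, continuous (fun y => g (f y))}.
Proof. by move=> cf cg; apply: (@continuous_comp _ _ _ f g). Qed.

Lemma continuous_comp_fun (T U W : topologicalType) (f : T -> U) (g : U -> W) :
  continuous f -> continuous g -> continuous (fun y => g (f y)).
Proof. by move=> cf cg x; apply: (@continuous_for_comp _ _ _ f g); [exact: cf|exact: cg]. Qed.

Lemma continuous_const (T U : topologicalType) (u : U) : continuous (fun _ : T => u).
Proof. by move=> x; exact: cvg_cst. Qed.

Lemma continuous_pairf (T U W : topologicalType) (f : T -> U) (g : T -> W) (x : T) :
  {for x, continuous f} -> {for x, continuous g} ->
  {for x, continuous (fun y => (f y, g y))}.
Proof. by move=> cf cg; apply: cvg_pair. Qed.

Lemma clopen_real (P : R -> Prop) (t0 : R) : P t0 ->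
  (forall t, exists2 d : R, 0 < d &
    forall a b, `|a - t| < d -> `|b - t| < d -> P a -> P b) ->
  forall t, P t.
Proof.
move=> Pt0 locP.
have nbP t : \forall b \near t, P b <-> P t.
  have [d d0 h] := locP t; apply/nbhs_ballP; exists d => // b.
  rewrite /ball /= distrC => bt.
  by split; apply: h; rewrite ?subrr ?normr0.
have : connected [set: R] by apply/connected_intervalP.
move=> /(_ [set t | P t]) E.
suff -> : P = [set: R] by [].
apply: E; first by exists t0.
- exists [set t | P t]; last by rewrite setTI.
  by rewrite openE => t Pt; apply: filterS (nbP t) => b [_]; exact.
- exists [set t | P t]; last by rewrite setTI.
  rewrite -[X in closed X]setCK; apply: open_closedC.
  rewrite openE => t nPt; apply: filterS (nbP t) => b [bt _] Pb.
  by apply: nPt; exact: bt.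
Qed.

Lemma convex_lt (c u v d : R) : 0 <= c <= 1 -> u < d -> v < d ->
  (1 - c) * u + c * v < d.
Proof.
move=> /andP[c0 c1] ud vd; have [->|c1'] := eqVneq c 1; first by lra.
have : (1 - c) * u < (1 - c) * d by rewrite ltr_pM2l // subr_gt0 lt_neqAle c1'.
have : c * v <= c * d by rewrite ler_wpM2l // ltW.
lra.
Qed.

Definition clampR (r : R) : R := Num.max 0 (Num.min 1 r).

Lemma clampR_continuous : continuous clampR.
Proof.
by apply: cmax; [exact: ccst | apply: cmin; [exact: ccst | move=> x; exact: cvg_id]].
Qed.

Lemma clampR_id r : 0 <= r <= 1 -> clampR r = r.
Proof. by move=> /andP[r0 r1]; rewrite /clampR min_r // max_r. Qed.

Lemma clampR0 : clampR 0 = 0. Proof. by rewrite clampR_id // lexx ler01. Qed.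
Lemma clampR1 : clampR 1 = 1. Proof. by rewrite clampR_id // lexx ler01. Qed.

Lemma clampR_itv r : 0 <= clampR r <= 1.
Proof.
rewrite /clampR le_max lexx /= ge_max ler01 /=.
by rewrite ge_min lexx.
Qed.

Lemma clampRK r : clamp (clampR r) = clamp r :> unitI R.
Proof. by apply: val_inj; rewrite val_clamp // clampR_itv. Qed.

(** Paths are handled as maps on the whole line, which compose freely. *)
Definition joined (T : topologicalType) (A : set T) (x y : T) : Prop :=
  exists g : R -> T, [/\ continuous g, g 0 = x, g 1 = y & forall t, A (g t)].

Lemma path_connected_joined (T : topologicalType) (A : set T) x y :
  path_connected R A -> A x -> A y -> joined A x y.
Proof.
move=> [_ /(_ x y) +] Ax Ay => /(_ Ax Ay)[f fA].
exists (fun t => f (clamp t)); split=> //.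
- by apply: continuous_comp_fun; [exact: clamp_continuous | exact: cts_fun].
- by rewrite -zeroE path_zero.
- by rewrite -oneE path_one.
Qed.

Section MakePath.
Variables (T : topologicalType) (x y : T) (u : R -> T).
Hypotheses (cu : continuous u) (u0 : u 0 = x) (u1 : u 1 = y).

Definition restrict01 (t : unitI R) : T := u (\val t).

Lemma restrict01_continuous : continuous restrict01.
Proof. by apply: continuous_comp_fun => //; exact: val_continuous. Qed.

Lemma restrict01_zero : restrict01 zero = x.
Proof. by rewrite /restrict01 val0. Qed.

Lemma restrict01_one : restrict01 one = y.
Proof. by rewrite /restrict01 val1. Qed.

HB.instance Definition _ :=
  isContinuous.Build (unitI R) T restrict01 restrict01_continuous.
HB.instance Definition _ :=
  isPath.Build (unitI R) T x y restrict01 restrict01_zero restrict01_one.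

Lemma make_path : exists q : {path (unitI R) from x to y}, forall t, q t = u (\val t).
Proof. by exists restrict01. Qed.

End MakePath.

Lemma path_image (T U : topologicalType) (f : T -> U) (x y : T) (x' y' : U)
    (w : {path (unitI R) from x to y}) :
  continuous f -> f x = x' -> f y = y' ->
  exists l : {path (unitI R) from x' to y'}, forall t, l t = f (w t).
Proof.
move=> cf fx fy.
have [|||l lE] := @make_path U x' y' (fun t => f (w (clamp t))).
- apply: continuous_comp_fun => //; apply: continuous_comp_fun.
    exact: clamp_continuous.
  exact: cts_fun.
- by rewrite -zeroE path_zero.
- by rewrite -oneE path_one.
by exists l => t; rewrite lE clampK.
Qed.

(** Points near [x] are joined to [x] by small paths.  This suffices for lifting
    maps, and it passes to covering spaces at once. *)
Definition locally_joined (T : topologicalType) : Prop :=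
  forall (x : T) (N : set T), nbhs x N ->
    \forall y \near x, joined N x y.

Lemma locally_path_connected_joined (T : topologicalType) :
  locally_path_connected R T -> locally_joined T.
Proof.
move=> lT x N /lT[V [oV Vx VN pV]].
apply: (filterS _ (open_nbhs_nbhs (conj oV Vx))) => y Vy.
have [g [cg g0 g1 gV]] := path_connected_joined pV Vx Vy.
by exists g; split=> // t; exact: VN.
Qed.

End Topology.

Section Lifting.
Variables (R : realType) (E M : topologicalType) (p : E -> M).
Hypothesis covp : covering_map p.
Local Notation clampR := (@clampR R).

Lemma covering_continuous : continuous p. Proof. exact: covp.1. Qed.

(** Sheets and sections over an evenly covered set [U], indexed by the points of
    the covering space above [U]; points of one sheet share their section. *)
Lemma covering_local (x : M) : exists (U : set M) (W : E -> set E) (s : E -> M -> E),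
  [/\ open U, U x & forall e, U (p e) ->
    [/\ nbhs e (W e), W e e,
      forall y, U y -> [/\ W e (s e y), p (s e y) = y & {for y, continuous (s e)}],
      forall e', W e e' -> U (p e') /\ s e (p e') = e' &
      forall e', W e e' -> s e' = s e]].
Proof.
have [_ /(_ x)[U [oU Ux [V [UV trivV shV]]]]] := covp.
have [[e0 _]|noE] := pselect (exists e : E, True); last first.
  exists U, (fun=> setT), (fun e _ => e); split=> // e.
  by exfalso; apply: noE; exists e.
have [sec secP] : {sec : set E -> M -> E & forall W, V W ->
    [/\ {within U, continuous (sec W)}, forall y, U y -> W (sec W y) /\ p (sec W y) = y
      & forall e, W e -> U (p e) /\ sec W (p e) = e]}.
  apply: (@choice _ _ (fun W s => V W -> [/\ {within U, continuous s},
    forall y, U y -> W (s y) /\ p (s y) = y & forall e, W e -> U (p e) /\ s (p e) = e])).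
  move=> W; have [VW|nVW] := pselect (V W); last by exists (fun=> e0).
  by have [_ [s sP]] := shV W VW; exists s.
have [sheet_of sheetP] : {w : E -> set E & forall e, U (p e) -> V (w e) /\ w e e}.
  apply: (@choice _ _ (fun e W => U (p e) -> V W /\ W e)) => e.
  have [Ue|nUe] := pselect (U (p e)); last by exists setT.
  by have : (p @^-1` U) e := Ue; rewrite UV => -[W VW We]; exists W.
exists U, sheet_of, (fun e => sec (sheet_of e)); split=> // e Ue.
have [Vw we] := sheetP e Ue; have [cs sU sW] := secP _ Vw; split=> //.
- by apply: open_nbhs_nbhs; split=> //; exact: (shV _ Vw).1.
- move=> y Uy; have [sy py] := sU y Uy; split=> //.
  by move: cs; rewrite continuous_open_subspace // => /(_ y); apply; rewrite inE.
- move=> e' we'; have [Ue' _] := sW e' we'; have [Vw' w'e'] := sheetP e' Ue'.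
  by congr sec; apply: (trivV _ _ Vw' Vw); exists e'.
Qed.

(** Two lifts agree on an open and closed set. *)
Lemma lift_uniq_real (g1 g2 : R -> E) (t0 : R) : continuous g1 -> continuous g2 ->
  (forall t, p (g1 t) = p (g2 t)) -> g1 t0 = g2 t0 -> forall t, g1 t = g2 t.
Proof.
move=> c1 c2 pg g0; apply: (@clopen_real R (fun t => g1 t = g2 t) t0 g0) => t.
have [U [W [s [oU Ut loc]]]] := covering_local (p (g1 t)).
have [n1 w1 s1 W1 E1] := loc (g1 t) Ut.
have Ut2 : U (p (g2 t)) by rewrite -pg.
have [n2 w2 s2 W2 E2] := loc (g2 t) Ut2.
have : \forall r \near t, W (g1 t) (g1 r) /\ W (g2 t) (g2 r).
  have h1 : \forall r \near t, W (g1 t) (g1 r) := c1 t _ n1.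
  have h2 : \forall r \near t, W (g2 t) (g2 r) := c2 t _ n2.
  by apply: filterS2 h1 h2 => r.
move=> /nbhs_ballP[d /= d0 dW]; exists d => // a b.
rewrite ![`|_ - t|]distrC => /dW[Wa1 Wa2] /dW[Wb1 Wb2] e.
have ss : s (g1 t) = s (g2 t) by rewrite -(E1 _ Wa1) -(E2 _ Wa2) e.
by rewrite -(W1 _ Wb1).2 -(W2 _ Wb2).2 ss pg.
Qed.

Lemma lift_uniq (Y : topologicalType) (f1 f2 : Y -> E) (y0 : Y) :
  (forall y, joined R setT y0 y) -> continuous f1 -> continuous f2 ->
  (forall y, p (f1 y) = p (f2 y)) -> f1 y0 = f2 y0 -> forall y, f1 y = f2 y.
Proof.
move=> jY c1 c2 pf f0 y; have [g [cg g0 g1 _]] := jY y.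
have := @lift_uniq_real (f1 \o g) (f2 \o g) 0.
rewrite -g1; apply; rewrite /= ?g0 //; first exact: continuous_comp_fun.
exact: continuous_comp_fun.
Qed.

(** The times up to which the path, stopped there, can be lifted form an open and
    closed set. *)
Lemma path_lift (f : R -> M) (e : E) : continuous f -> p e = f 0 ->
  exists g : R -> E, [/\ continuous g, g 0 = e & forall r, p (g r) = f (clampR r)].
Proof.
move=> cf pe.
pose P t := exists g : R -> E, [/\ continuous g, g 0 = e &
  forall r, p (g r) = f (Num.max 0 (Num.min t r))].
suff : P 1 by [].
have P_le0 t : t <= 0 -> P t.
  move=> t0; exists (fun=> e); split=> [|//|r]; first exact: continuous_const.
  by rewrite max_l // ge_min t0.
apply: (@clopen_real R P 0); first exact: P_le0.
move=> t; have [U [W [s [oU Ut loc]]]] := covering_local (f t).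
have : \forall r \near t, U (f r) by apply: (cf t U); exact: open_nbhs_nbhs.
move=> /nbhs_ballP[d /= d0 dU]; exists d => // a b.
rewrite ![`|_ - t|]distrC => at_ bt [g [cg g0 pg]].
have [b0|b0] := lerP b 0; first exact: P_le0.
have [ba|ab] := lerP b a.
  exists (fun r => g (Num.min b r)); split.
  - apply: (continuous_comp_fun (f := fun r : R => Num.min b r)) => //.
    by apply: cmin; [exact: continuous_const | move=> ?; exact: cvg_id].
  - by rewrite min_r // ltW.
  - by move=> r; rewrite pg minA (min_r ba).
(* Beyond [a] the lift continues in the sheet of [g a']. *)
pose a' := Num.max 0 a; have a'b : a' < b by rewrite /a' gt_max b0.
have a't : ball t d a'.
  rewrite /a'; case: lerP => // a0; move: at_ bt; rewrite /ball /= !ltr_norml.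
  by move=> /andP[? ?] /andP[? ?]; apply/andP; split; lra.
have pga' : p (g a') = f a'.
  rewrite pg; congr f; rewrite /a'; case: (lerP 0 a) => a0.
    by rewrite minxx max_r.
  by rewrite min_l ?ltW // max_l // ltW.
have [n1 w1 s1 W1 E1] := loc (g a') (eq_ind_r U (dU _ a't) pga').
pose h r := Num.max a' (Num.min b r).
have hU r : U (f (h r)).
  apply: dU; rewrite /ball /= ltr_norml.
  move: a't bt; rewrite /ball /= !ltr_norml => /andP[? ?] /andP[? ?].
  have : a' <= h r by rewrite /h le_max lexx.
  have : h r <= b by rewrite /h ge_max (ltW a'b) ge_min lexx.
  by move=> ? ?; apply/andP; split; lra.
exists (fun r => if r - a' <= 0 then g r else s (g a') (f (h r))); split.
- apply: glue_continuous => //.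
  + by apply: cadd; [move=> ?; exact: cvg_id | exact: continuous_const].
  + move=> r; apply: (@continuous_for_comp _ _ _ (fun r => f (h r))).
      apply: continuous_comp_fun => //; apply: cmax; first exact: continuous_const.
      by apply: cmin; [exact: continuous_const | move=> ?; exact: cvg_id].
    by have [] := s1 _ (hU r).
  + move=> r /eqP; rewrite subr_eq0 => /eqP ->.
    have -> : h a' = a' by rewrite /h min_r ?maxxx // ltW.
    by rewrite -pga' (W1 _ w1).2.
- by rewrite sub0r oppr_le0 /a' le_max lexx.
- move=> r; case: (lerP (r - a') 0) => ra.
    rewrite pg; congr f; move: ra a'b; rewrite /a'; case: (lerP 0 a) => a0 ra a'b.
      by rewrite !min_r //; lra.
    by rewrite !max_l // ge_min; apply/orP; right; lra.
  have [_ -> _] := s1 _ (hU r); congr f.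
  have a'0 : 0 <= a' by rewrite /a' le_max lexx.
  by rewrite /h !max_r // le_min; apply/andP; split; lra.
Qed.

(** For fixed [y], the times at which the lifted paths depend continuously on the
    parameter at [y] form an open and closed set, as near [(y, t)] all lifts stay
    in one sheet. *)
Lemma homotopy_lift_continuous (Y : topologicalType) (F : Y * R -> M)
    (G : Y -> R -> E) : continuous F -> (forall y, continuous (G y)) ->
  (forall y r, p (G y r) = F (y, r)) -> continuous (fun y => G y 0) ->
  continuous (fun z : Y * R => G z.1 z.2).
Proof.
move=> cF cG pG cG0 [y0 t0].
have step t : exists2 d : R, 0 < d & forall a b, `|a - t| < d -> `|b - t| < d ->
    {for y0, continuous (fun y => G y a)} ->
    {for (y0, b), continuous (fun z : Y * R => G z.1 z.2)}.
  have [U [W [s [oU Ut loc]]]] := covering_local (F (y0, t)).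
  have [[N1 N2] /= [nN1 /nbhs_ballP[d /= d0 dN2]] NU] : nbhs (y0, t) (F @^-1` U).
    by apply: cF; exact: open_nbhs_nbhs.
  exists d => // a b; rewrite ![`|_ - t|]distrC => at_ bt ca.
  have Ua : U (p (G y0 a)).
    by rewrite pG; apply: NU; split; [exact: nbhs_singleton nN1 | exact: dN2].
  have [nW w1 s1 W1 E1] := loc _ Ua.
  apply: (@near_eq_continuous _ _ _ (fun z => s (G y0 a) (F z))); last first.
    apply: continuous_for_comp; first exact: cF.
    have [] // := s1 (F (y0, b)).
    by apply: NU; split; [exact: nbhs_singleton nN1 | exact: dN2].
  exists (N1 `&` [set y | W (G y0 a) (G y a)], ball t d) => /=.
    split; first by apply: filterI => //; exact: ca.
    by apply: open_nbhs_nbhs; split=> //; exact: ball_open.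
  move=> [y r] /= [[N1y Wy] tr].
  pose h u := a + clampR u * (r - a).
  have hU u : U (F (y, h u)).
    apply: NU; split=> //=; apply: dN2; rewrite /ball /= ltr_norml /h.
    move: at_ tr; rewrite /ball /= !ltr_norml => /andP[? ?] /andP[? ?].
    have ca' v w : v < d -> w < d -> (1 - clampR u) * v + clampR u * w < d.
      by apply: convex_lt; exact: clampR_itv.
    apply/andP; split; last first.
      have -> : t - (a + clampR u * (r - a))
        = (1 - clampR u) * (t - a) + clampR u * (t - r) by ring.
      by apply: ca'; lra.
    have : (1 - clampR u) * (a - t) + clampR u * (r - t) < d by apply: ca'; lra.
    lra.
  have ch : continuous h.
    apply: cadd; first exact: continuous_const.
    by apply: cmul; [exact: clampR_continuous | exact: continuous_const].
  have := @lift_uniq_real (fun u => G y (h u)) (fun u => s (G y0 a) (F (y, h u))) 0.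
  have h1 : h 1 = r by rewrite /h clampR1 mul1r addrC subrK.
  rewrite -h1; apply.
  - exact: continuous_comp_fun.
  - move=> u; apply: (@continuous_for_comp _ _ _ (fun u => F (y, h u))).
      apply: (@continuous_for_comp _ _ _ (fun u => (y, h u))); last exact: cF.
      by apply: continuous_pairf; [exact: continuous_const | exact: ch].
    by have [] := s1 _ (hU u).
  - by move=> u; have [_ -> _] := s1 _ (hU u); rewrite pG.
  - by rewrite /h clampR0 mul0r addr0 -pG (W1 _ Wy).2.
have sec t : {for (y0, t), continuous (fun z : Y * R => G z.1 z.2)} ->
    {for y0, continuous (fun y => G y t)}.
  move=> ct; apply: (@continuous_for_comp _ _ _ (fun y => (y, t))
    (fun z : Y * R => G z.1 z.2)) => //.
  by apply: continuous_pairf; [exact: cvg_id | exact: continuous_const].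
have all t : {for y0, continuous (fun y => G y t)}.
  apply: (@clopen_real R (fun t => {for y0, continuous (fun y => G y t)})
    0 (cG0 y0)) => {}t; have [d d0 h] := step t.
  by exists d => // a b at_ bt ca; apply: sec; exact: h at_ bt ca.
have [d d0 h] := step t0.
by apply: (h t0 t0) => //; rewrite subrr normr0.
Qed.

Lemma homotopy_lift (Y : topologicalType) (F : Y * R -> M) (f0 : Y -> E) :
  continuous F -> continuous f0 -> (forall y, p (f0 y) = F (y, 0)) ->
  exists G : Y * R -> E, [/\ continuous G, forall y, G (y, 0) = f0 y &
    forall y r, p (G (y, r)) = F (y, clampR r)].
Proof.
move=> cF c0 pF.
have cy y : continuous (fun r => F (y, r)).
  move=> r; apply: (@continuous_for_comp _ _ _ (fun r => (y, r))); last exact: cF.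
  by apply: continuous_pairf; [exact: continuous_const | exact: cvg_id].
have [G GP] : {G : Y -> R -> E & forall y, [/\ continuous (G y), G y 0 = f0 y &
    forall r, p (G y r) = F (y, clampR r)]}.
  apply: (@choice _ _ (fun y (g : R -> E) => [/\ continuous g, g 0 = f0 y &
    forall r, p (g r) = F (y, clampR r)])) => y.
  exact: (@path_lift (fun r => F (y, r))).
exists (fun z => G z.1 z.2); split.
- apply: (@homotopy_lift_continuous _ (fun z => F (z.1, clampR z.2))).
  + move=> z; apply: (@continuous_for_comp _ _ _ (fun z => (z.1, clampR z.2))); last exact: cF.
    apply: continuous_pairf; first exact: cvg_fst.
    apply: (@continuous_for_comp _ _ _ snd); first exact: cvg_snd.
    exact: clampR_continuous.
  + by move=> y; have [] := GP y.
  + by move=> y r; have [_ _ ->] := GP y.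
  + suff -> : (fun y => G y 0) = f0 by [].
    by apply/funext => y; have [] := GP y.
- by move=> y; have [] := GP y.
- by move=> y r; have [] := GP y.
Qed.

(** The end points of the lifts of the intermediate paths form a lift of a
    constant path. *)
Lemma lift_homotopic (F : R * R -> M) (g0 g1 : R -> E) (x y : M) : continuous F ->
  (forall s, F (s, 0) = x) -> (forall s, F (s, 1) = y) ->
  continuous g0 -> continuous g1 -> g0 0 = g1 0 ->
  (forall r, p (g0 r) = F (0, clampR r)) -> (forall r, p (g1 r) = F (1, clampR r)) ->
  g0 1 = g1 1.
Proof.
move=> cF F0 F1 c0 c1 g01 pg0 pg1.
have [s|G [cG G0 pG]] := @homotopy_lift R F (fun=> g0 0) cF (@continuous_const _ _ _).
  by rewrite F0 pg0 clampR0.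
have cG' s : continuous (fun r => G (s, r)).
  apply: (@continuous_comp_fun _ _ _ (fun r => (s, r))) => // r.
  by apply: continuous_pairf; [exact: continuous_const | exact: cvg_id].
have -> : g0 1 = G (0, 1).
  by apply: (@lift_uniq_real _ (fun r => G (0, r)) 0) => // r; rewrite pg0 pG.
have -> : g1 1 = G (1, 1).
  apply: (@lift_uniq_real _ (fun r => G (1, r)) 0) => // [r|].
    by rewrite pg1 pG.
  by rewrite G0.
apply: (@lift_uniq_real (fun=> G (0, 1)) (fun s => G (s, 1)) 0) => //.
- exact: continuous_const.
- apply: (@continuous_comp_fun _ _ _ (fun s => (s, 1 : R)) G) => // s.
  by apply: continuous_pairf; [exact: cvg_id | exact: continuous_const].
- by move=> s; rewrite !pG clampR1 !F1.
Qed.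

Lemma lift_path_homotopic (x y : M) (l l' : {path (unitI R) from x to y})
    (g g' : R -> E) : path_homotopic l l' -> continuous g -> continuous g' ->
  g 0 = g' 0 -> (forall r, p (g r) = l (clamp r)) ->
  (forall r, p (g' r) = l' (clamp r)) -> g 1 = g' 1.
Proof.
move=> [H [cH H0 H1 Hx Hy]] cg cg' gg' pg pg'.
apply: (@lift_homotopic (fun z => H (clamp z.2, clamp z.1)) _ _ x y) => //.
- move=> z; apply: (@continuous_for_comp _ _ _
    (fun z : R * R => (clamp z.2, clamp z.1)) H); last exact: cH.
  apply: continuous_pairf.
    apply: (@continuous_for_comp _ _ _ snd (@clamp R)); first exact: cvg_snd.
    exact: clamp_continuous.
  by apply: (@continuous_for_comp _ _ _ fst (@clamp R)); [exact: cvg_fst | exact: clamp_continuous].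
- by move=> r; have := H0 (clamp r); rewrite zeroE /= clampRK pg.
- by move=> r; have := H1 (clamp r); rewrite oneE /= clampRK pg'.
Qed.

Lemma covering_locally_joined : locally_joined R M -> locally_joined R E.
Proof.
move=> lM e N nN.
have [U [W [s [oU Ue loc]]]] := covering_local (p e).
have [nW We sU sW _] := loc e Ue; have [_ spe] := sW _ We.
have nN' : nbhs (p e) (U `&` [set y | N (s e y)]).
  apply: filterI; first exact: open_nbhs_nbhs.
  have [_ _ cs] := sU (p e) Ue.
  by apply: cs; rewrite spe.
have nE := covering_continuous (lM _ _ nN').
apply: filterS2 nW nE => e' We' [g [cg g0 g1 gN]].
exists (fun t => s e (g t)); split.
- move=> t; apply: (@continuous_for_comp _ _ _ g (s e)); first exact: cg.
  by have [] := sU (g t) (gN t).1.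
- by rewrite g0.
- by rewrite g1 (sW _ We').2.
- by move=> t; have [] := gN t.
Qed.

Section LiftingCriterion.
Variables (Y : topologicalType) (f : Y -> M) (y0 : Y) (e0 : E).
Hypotheses (scY : simply_connected R Y) (lY : locally_joined R Y).
Hypotheses (cf : continuous f) (pe0 : p e0 = f y0).

(** The graph of the lift, which is found by transport along paths. *)
Definition lift_rel (y : Y) (e : E) : Prop := exists (g : R -> Y) (h : R -> E),
  [/\ [/\ continuous g, g 0 = y0 & g 1 = y], continuous h,
      h 0 = e0, h 1 = e & forall r, p (h r) = f (g r)].

Lemma lift_rel_total y : exists e, lift_rel y e.
Proof.
have [g [cg g0 g1 _]] := @path_connected_joined R Y setT y0 y scY.1 I I.
have [||h [ch h0 ph]] := @path_lift (fun r => f (g r)) e0.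
- exact: continuous_comp_fun.
- by rewrite g0.
exists (h 1), (fun r => g (clampR r)), h; split=> //; split.
- by apply: continuous_comp_fun => //; exact: clampR_continuous.
- by rewrite clampR0.
- by rewrite clampR1.
Qed.

(** The concatenation of one path with the reverse of the other is
    null-homotopic, so its lift is closed and gives a common end point. *)
Lemma lift_rel_functional y e e' : lift_rel y e -> lift_rel y e' -> e = e'.
Proof.
move=> [g1 [h1 [[cg1 g10 g11] ch1 h10 <- ph1]]].
move=> [g2 [h2 [[cg2 g20 g21] ch2 h20 <- ph2]]].
pose l r := if r - 2^-1 <= 0 then g1 (2 * r) else g2 (2 - 2 * r).
have c2 : continuous (fun r : R => 2 * r).
  by apply: cmul; [exact: continuous_const | move=> ?; exact: cvg_id].
have cl : continuous l.
  apply: glue_continuous.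
  - by apply: cadd; [move=> ?; exact: cvg_id | exact: continuous_const].
  - exact: (continuous_comp_fun c2).
  - apply: (@continuous_comp_fun _ _ _ (fun r : R => 2 - 2 * r) g2) => //.
    by apply: cadd; [exact: continuous_const | exact: copp].
  - move=> r r2; have -> : r = 2^-1 by lra.
    by rewrite divff ?pnatr_eq0 // g11 -[2 - 1]/(1 + 1 - 1) addrK g21.
have l0 : l 0 = y0.
  by rewrite /l ifT ?mulr0 //; lra.
have l1 : l 1 = y0.
  by rewrite /l ifF ?mulr1 ?subrr //; apply/negbTE; rewrite -ltNge; lra.
have [q qE] := make_path cl l0 l1.
have qh : path_homotopic q (cst y0 : {path (unitI R) from y0 to y0}).
  by apply/pi1_classP; rewrite (scY.2 y0 (pi1_class q)); apply/esym/scY.2.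
have [q' q'E] := path_image q cf (erefl (f y0)) (erefl (f y0)).
have [c' c'E] := path_image (cst y0 : {path (unitI R) from y0 to y0}) cf
  (erefl (f y0)) (erefl (f y0)).
have qc' : path_homotopic q' c'.
  case: qh => H [cH H0 H1 Hx Hy]; exists (fun z => f (H z)); split.
  - exact: continuous_comp_fun.
  - by move=> t; rewrite H0 q'E.
  - by move=> t; rewrite H1 c'E.
  - by move=> t; rewrite Hx.
  - by move=> t; rewrite Hy.
have [||m [cm m0 pm]] := @path_lift (fun r => f (l r)) e0.
- exact: continuous_comp_fun.
- by rewrite l0.
have m1 : m 1 = e0.
  apply: (lift_path_homotopic (g := m) (g' := fun=> e0) qc') => //.
  - exact: continuous_const.
  - move=> r; rewrite pm q'E qE; congr (f (l _)).
  - by move=> r; rewrite c'E.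
have cR := @clampR_continuous R.
have ch : continuous (fun r => clampR r / 2).
  by apply: cmul; [exact: cR | exact: continuous_const].
have lc r : l (clampR (clampR r / 2)) = g1 (clampR r).
  have /andP[r0 r1] := clampR_itv r; rewrite clampR_id; last by apply/andP; split; lra.
  rewrite /l ifT; last lra.
  by congr g1; lra.
have lc' r : l (clampR (1 - clampR r / 2)) = g2 (clampR r).
  have /andP[r0 r1] := clampR_itv r; rewrite clampR_id; last by apply/andP; split; lra.
  rewrite /l; case: ifPn => [h|_]; last by congr g2; lra.
  have -> : clampR r = 1 by lra.
  by rewrite g21 -g11; congr g1; lra.
have := @lift_uniq_real (fun r => h1 (clampR r)) (fun r => m (clampR r / 2)) 0.
move=> /(_ _ _ _ _ 1); rewrite clampR0 clampR1 mul0r h10 m0 => -> //; last 3 first.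
- by apply: continuous_comp_fun.
- by apply: (continuous_comp_fun ch).
- by move=> r; rewrite ph1 pm lc.
have := @lift_uniq_real (fun r => h2 (clampR r)) (fun r => m (1 - clampR r / 2)) 0.
move=> /(_ _ _ _ _ 1); rewrite clampR0 clampR1 mul0r subr0 h20 m1 => -> //; last 3 first.
- by apply: continuous_comp_fun.
- apply: (@continuous_comp_fun _ _ _ (fun r => 1 - clampR r / 2) m) => //.
  by apply: cadd; [exact: continuous_const | exact: copp].
- by move=> r; rewrite ph2 pm lc'.
by congr m; lra.
Qed.

Theorem lifting_criterion : exists F : Y -> E,
  [/\ continuous F, F y0 = e0 & forall y, p (F y) = f y].
Proof.
have [F FP] := choice lift_rel_total.
have pF y : p (F y) = f y by have [g [h [[_ _ <-] _ _ <- ->]]] := FP y.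
exists F; split=> //; last first.
  apply: (lift_rel_functional (FP y0)).
  exists (fun=> y0), (fun=> e0).
  by split=> //; [split=> //; exact: continuous_const | exact: continuous_const].
move=> y; have [U [W [s [oU Uy loc]]]] := covering_local (f y).
have UF : U (p (F y)) by rewrite pF.
have [nW WF sU sW _] := loc (F y) UF.
apply: (@near_eq_continuous _ _ _ (fun y' => s (F y) (f y'))); last first.
  apply: (@continuous_for_comp _ _ _ f (s (F y))); first exact: cf.
  by have [] := sU (f y) Uy.
have nU : nbhs y (f @^-1` U) by apply: cf; exact: open_nbhs_nbhs.
apply: filterS (lY nU) => y' [g1 [cg1 g10 g11 gU]].
have [g [h [[cg g0 g1y] ch h0 h1 ph]]] := FP y.
apply: (lift_rel_functional (FP y')).
have c2 : continuous (fun r : R => 2 * r).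
  by apply: cmul; [exact: continuous_const | move=> ?; exact: cvg_id].
have c21 : continuous (fun r : R => 2 * r - 1).
  by apply: cadd => //; exact: continuous_const.
have ch2 : continuous (fun r : R => r - 2^-1).
  by apply: cadd; [move=> ?; exact: cvg_id | exact: continuous_const].
exists (fun r => if r - 2^-1 <= 0 then g (2 * r) else g1 (2 * r - 1)).
exists (fun r => if r - 2^-1 <= 0 then h (2 * r) else s (F y) (f (g1 (2 * r - 1)))).
have l0 : 0 - 2^-1 <= 0 :> R by lra.
have l1 : (1 - 2^-1 <= 0 :> R) = false by apply/negbTE; rewrite -ltNge; lra.
split; first split.
- apply: glue_continuous => //.
  + exact: (continuous_comp_fun c2).
  + exact: (continuous_comp_fun c21).
  + move=> r r2; have -> : r = 2^-1 by lra.
    by rewrite divff ?pnatr_eq0 // subrr g1y g10.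
- by rewrite l0 mulr0.
- by rewrite l1 -g11; congr g1; lra.
- apply: glue_continuous => //.
  + exact: (continuous_comp_fun c2).
  + move=> r.
    apply: (@continuous_for_comp _ _ _ (fun r : R => f (g1 (2 * r - 1)))
      (s (F y))).
      by apply: (@continuous_comp_fun _ _ _ (fun r : R => g1 (2 * r - 1)) f) => //;
        exact: (continuous_comp_fun c21).
    by have [] := sU _ (gU (2 * r - 1)).
  + move=> r r2; have -> : r = 2^-1 by lra.
    by rewrite divff ?pnatr_eq0 // subrr h1 g10 -pF (sW _ WF).2.
- by rewrite l0 mulr0.
- by rewrite l1 -g11; congr (s _ (f (g1 _))); lra.
- move=> r; case: ifP => _; first exact: ph.
  by have [] := sU _ (gU (2 * r - 1)).
Qed.

End LiftingCriterion.

End Lifting.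
(** * The deck group of a universal covering *)

Section DeckGroup.
Variables (R : realType) (E M : topologicalType) (p : E -> M) (e0 : E).
Hypotheses (univp : universal_covering R p) (lM : locally_joined R M).
Local Notation Gamma := (pi1 R (p e0)).
Local Notation clampR := (@clampR R).
Implicit Types (g h : Gamma) (e : E).

Let covp : covering_map p := univp.1.
Let scE : simply_connected R E := univp.2.

Lemma total_joined e e' : joined R setT e e'.
Proof. exact: path_connected_joined scE.1 I I. Qed.

Lemma deck_map_uniq (f1 f2 : E -> E) e : continuous f1 -> continuous f2 ->
  (forall z, p (f1 z) = p z) -> (forall z, p (f2 z) = p z) -> f1 e = f2 e ->
  forall z, f1 z = f2 z.
Proof.
move=> c1 c2 p1 p2; apply: (lift_uniq covp) => // [z|z].
  exact: total_joined.
by rewrite p1 p2.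
Qed.

Lemma deck_map_exists e1 e2 : p e1 = p e2 ->
  exists D : continuousType E E, deck_transformation p D /\ D e1 = e2.
Proof.
move=> pe; have lE := covering_locally_joined covp lM.
have cp : continuous p := covering_continuous covp.
have [D [cD De pD]] := lifting_criterion covp scE lE cp (esym pe).
have [D' [cD' De' pD']] := lifting_criterion covp scE lE cp pe.
pose cont (f : E -> E) (cf : continuous f) : continuousType E E :=
  HB.pack f (isContinuous.Build E E f cf).
exists (cont D cD); split=> //; split=> //; exists (cont D' cD').
have id_uniq (f : E -> E) e : continuous f -> (forall z, p (f z) = p z) ->
    f e = e -> forall z, f z = z.
  move=> cf pf fe; apply: (@deck_map_uniq f id e) => //.
  by move=> z; exact: cvg_id.
split.
  apply: (@id_uniq (D' \o D) e1); rewrite /= ?De //.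
    exact: continuous_comp_fun.
  by move=> z; rewrite /= pD' pD.
apply: (@id_uniq (D \o D') e2); rewrite /= ?De' //.
  exact: continuous_comp_fun.
by move=> z; rewrite /= pD pD'.
Qed.

(** Homotopic loops have lifts with the same end point, and a deck
    transformation is determined by one value. *)
Lemma is_deck_of_uniq g (D D' : continuousType E E) :
  is_deck_of g D -> is_deck_of g D' -> D = D'.
Proof.
move=> [[pD _] [w [l [wl lg]]]] [[pD' _] [w' [l' [wl' lg']]]].
apply/continuousEP.
apply: (@deck_map_uniq D D' e0) => //; [exact: cts_fun|exact: cts_fun|].
have ll' : path_homotopic l l' by apply/pi1_classP; rewrite lg lg'.
have cw (x y : E) (v : {path (unitI R) from x to y}) :
    continuous (fun r : R => v (clamp r)).
  by apply: continuous_comp_fun; [exact: clamp_continuous | exact: cts_fun].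
have := lift_path_homotopic covp ll' (cw _ _ w) (cw _ _ w').
rewrite -zeroE -oneE !path_zero !path_one; exact.
Qed.

Lemma is_deck_of_exists g : exists D, is_deck_of g D.
Proof.
pose l := repr g.
have [||h [ch h0 ph]] := @path_lift _ _ _ _ covp (fun r => l (clamp r)) e0.
- by apply: continuous_comp_fun; [exact: clamp_continuous | exact: cts_fun].
- by rewrite -zeroE path_zero.
have ph1 : p e0 = p (h 1) by rewrite ph clampR1 -oneE path_one.
have [D [dD De0]] := deck_map_exists ph1.
exists D; split=> //.
have [w wE] := @make_path R E e0 (D e0) h ch h0 (esym De0).
exists w, l; split=> [t|]; last by rewrite /pi1_class /l reprK.
by rewrite wE ph clampRK clampK.
Qed.

Lemma deckP g : is_deck_of g (deck g).
Proof. exact: xgetPex (is_deck_of_exists g). Qed.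

Lemma deck_eq g (D : continuousType E E) : is_deck_of g D -> deck g = D.
Proof. exact: is_deck_of_uniq (deckP g). Qed.

Lemma deck_proj g e : p (deck g e) = p e.
Proof. by have [[]] := deckP g. Qed.

Lemma deck_continuous g : continuous (deck g).
Proof. exact: cts_fun. Qed.

Lemma deckM g h e : deck (g * h)%g e = deck g (deck h e).
Proof.
suff -> : deck (g * h)%g = (deck g \o deck h : continuousType E E) by [].
apply: deck_eq; split.
  split; first by move=> z /=; rewrite !deck_proj.
  have [[_ [D [gD Dg]]] _] := deckP g; have [[_ [D' [hD Dh]]] _] := deckP h.
  exists (D' \o D : continuousType E E); split=> z /=; first by rewrite gD hD.
  by rewrite Dh Dg.
have [_ [w [l [wl lg]]]] := deckP g; have [_ [w' [l' [wl' lh]]]] := deckP h.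
have [v vE] := path_image w' (@deck_continuous g) erefl
  (erefl (deck g (deck h e0))).
exists (path_concat w v), (path_concat l l'); split; last first.
  by rewrite -lg -lh; exact/esym/pi1_mulE.
move=> t; rewrite /= /path_concat; case: ifP => _; first exact: wl.
by rewrite vE deck_proj wl'.
Qed.

(** An element fixing a point acts as the identity, so its loops lift to loops
    of the simply connected space [E]. *)
Lemma deck_free g e : deck g e = e -> g = 1%g.
Proof.
move=> ge; have gid z : deck g z = z.
  apply: (@deck_map_uniq (deck g) id e) => //; first exact: deck_continuous.
    by move=> ?; exact: cvg_id.
  exact: deck_proj.
have [_ [w [l [wl lg]]]] := deckP g.
have [w' w'E] : exists w' : {path (unitI R) from e0 to e0}, forall t, w' t = w t.
  have [w' w'E] := @path_image R _ _ id _ _ e0 e0 w (fun x => @cvg_id _ _) erefl (gid e0).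
  by exists w'.
have : path_homotopic w' (cst e0 : {path (unitI R) from e0 to e0}).
  by apply/pi1_classP; rewrite (scE.2 e0 (pi1_class w')); apply/esym/scE.2.
move=> [H [cH H0 H1 Hx Hy]]; rewrite -lg; apply/pi1_classP.
exists (fun z => p (H z)); split.
- by apply: continuous_comp_fun => //; exact: covering_continuous.
- by move=> t; rewrite H0 w'E wl.
- by move=> t; rewrite H1.
- by move=> t; rewrite Hx.
- by move=> t; rewrite Hy.
Qed.

(** The deck transformation taking [e1] to [e2] is the one of the image of a path
    from the base point [e0] to its own image. *)
Lemma deck_trans e1 e2 : p e1 = p e2 -> exists g, deck g e1 = e2.
Proof.
move=> /deck_map_exists[D [dD De1]].
have [_ /(_ e0 (D e0) I I)[w _]] := scE.1.
have [pD _] := dD.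
have [l lE] := path_image w (covering_continuous covp) (erefl (p e0)) (pD e0).
exists (pi1_class l); rewrite (@deck_eq _ D) //; split=> //.
by exists w, l; split=> // t; rewrite lE.
Qed.

End DeckGroup.

(** Each covering map lifts to the other covering space.  By uniqueness of lifts
    the composite on [E] is the identity, so [E] is a retract of [E']. *)
Lemma contractible_universal_covering (R : realType) (M E E' : topologicalType)
    (p : E -> M) (p' : E' -> M) (e0 : E) : path_connected R [set: M] ->
  locally_joined R M -> universal_covering R p -> universal_covering R p' ->
  contractible R E' -> contractible R E.
Proof.
move=> cM lM [covp scE] [covp' scE'] [c [H [cH H0 H1]]].
have cp := covering_continuous covp; have cp' := covering_continuous covp'.
have [g [cg g0 g1 _]] := path_connected_joined cM I I : joined R setT (p' c) (p e0).
have [h [ch h0 ph]] := path_lift covp' cg (esym g0).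
have pe : p' (h 1) = p e0 by rewrite ph clampR1 g1.
have [P [cP Pe pP]] := lifting_criterion covp' scE
  (covering_locally_joined covp lM) cp pe.
have [Q [cQ Qe pQ]] := lifting_criterion covp scE'
  (covering_locally_joined covp' lM) cp' (esym pe).
have QP e : Q (P e) = e.
  apply: (@deck_map_uniq R E M p (conj covp scE) (Q \o P) id e0) => //.
  - exact: continuous_comp_fun.
  - by move=> ?; exact: cvg_id.
  - by move=> z; rewrite /= pQ pP.
  - by rewrite /= Pe.
exists (Q c), (fun z => Q (H (P z.1, z.2))); split=> [|x|x]; last 2 first.
- by rewrite H0 QP.
- by rewrite H1.
apply: (@continuous_comp_fun _ _ _ (fun z => H (P z.1, z.2)) Q) => //.
apply: (@continuous_comp_fun _ _ _ (fun z => (P z.1, z.2)) H) => // z.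
apply: continuous_pairf; last exact: cvg_snd.
by apply: (@continuous_for_comp _ _ _ fst P); [exact: cvg_fst | exact: cP].
Qed.
(** * Simplices and their lifts *)

Section SimplexTopology.
Variables (R : realType) (n : nat).
Local Notation S := (simplex R n).

Lemma continuous_row (T : topologicalType) (f : T -> 'rV[R]_n.+1) (x : T) :
  (forall j, {for x, continuous (fun t => f t ord0 j)}) -> {for x, continuous f}.
Proof.
move=> cf A [P fP PA].
have : \forall t \near x, forall j, P ord0 j (f t ord0 j).
  by apply: filter_forall => j; apply: cf; exact: fP.
rewrite /=; move: (f x) fP => ? _.
change ((\forall t \near x, forall j, P ord0 j (f t ord0 j)) ->
  nbhs x (f @^-1` A)).
apply: filterS => t Pt; apply: PA => i j; rewrite (ord1 i); exact: Pt.
Qed.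

Lemma continuous_into_simplex (T : topologicalType) (f : T -> S) (x : T) :
  {for x, continuous (fun t => \val (f t))} -> {for x, continuous f}.
Proof.
move=> cf U [?/= [[W oW <-]]] /= Wsfz /filterS; apply; apply: cf.
exact: open_nbhs_nbhs.
Qed.

Lemma simplex_val_continuous : continuous (\val : S -> 'rV[R]_n.+1).
Proof. exact: initial_continuous. Qed.

Lemma simplex_coord_continuous j : continuous (fun t : S => \val t ord0 j).
Proof.
apply: (@continuous_comp_fun _ _ _ _ (fun M : 'rV[R]_n.+1 => M ord0 j)).
  exact: simplex_val_continuous.
exact: coord_continuous.
Qed.

Lemma simplex_ge0 (t : S) j : 0 <= \val t ord0 j.
Proof. by case: t => t /= /set_mem[]. Qed.

Lemma simplex_sum (t : S) : \sum_j \val t ord0 j = 1.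
Proof. by case: t => t /= /set_mem[]. Qed.

Lemma simplex_le1 (t : S) j : \val t ord0 j <= 1.
Proof.
rewrite -(simplex_sum t) (bigD1 j) //= lerDl.
by apply: sumr_ge0 => i _; exact: simplex_ge0.
Qed.

Lemma row_sum_continuous : continuous (fun t : 'rV[R]_n.+1 => \sum_j t ord0 j).
Proof.
elim: (index_enum _) => [|j r IH].
  under [X in continuous X]eq_fun do rewrite big_nil.
  exact: continuous_const.
under [X in continuous X]eq_fun do rewrite big_cons.
by apply: cadd => //; exact: coord_continuous.
Qed.

Lemma std_simplex_compact : compact (@std_simplex R n).
Proof.
have cube : compact [set v : 'rV[R]_n.+1 | forall i, `[0, 1]%classic (v ord0 i)].
  by apply: (@rV_compact R n.+1 (fun=> `[0, 1]%classic)) => _; exact: segment_compact.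
apply: subclosed_compact cube _; last first.
  move=> t st i; rewrite /= in_itv /=.
  have st' := mem_set st.
  by rewrite (simplex_ge0 (exist _ t st' : S)) (simplex_le1 (exist _ t st' : S)).
have -> : @std_simplex R n =
    \bigcap_(i in [set: 'I_n.+1]) ((fun t : 'rV[R]_n.+1 => t ord0 i) @^-1` [set r | 0 <= r])
    `&` (fun t : 'rV[R]_n.+1 => \sum_j t ord0 j) @^-1` [set 1].
  by apply/seteqP; split=> [t [t0 t1]|t [t0 t1]]; split=> // i; [move=> _|]; exact: t0.
apply: closedI.
  apply: closed_bigI => i _; apply: preimage_closed; last exact: closed_ge.
  by move=> x _; exact: coord_continuous.
by apply: preimage_closed; [move=> x _; exact: row_sum_continuous | exact: closed_eq].
Qed.

Lemma simplex_line_subproof (x y : S) (r : R) :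
  (1 - clampR r) *: \val x + clampR r *: \val y \in @std_simplex R n.
Proof.
have /andP[c0 c1] := clampR_itv r.
apply/mem_set; split=> [i|].
  by rewrite !mxE addr_ge0 // mulr_ge0 ?simplex_ge0 // subr_ge0.
under eq_bigr do rewrite !mxE.
by rewrite big_split /= -!mulr_sumr !simplex_sum !mulr1 subrK.
Qed.

Definition simplex_line (x y : S) (r : R) : S :=
  exist (fun v => v \in @std_simplex R n) _ (simplex_line_subproof x y r).

Lemma simplex_line0 x y : simplex_line x y 0 = x.
Proof. by apply: val_inj; rewrite /= clampR0 subr0 scale1r scale0r addr0. Qed.

Lemma simplex_line1 x y : simplex_line x y 1 = y.
Proof. by apply: val_inj; rewrite /= clampR1 subrr scale1r scale0r add0r. Qed.

Lemma simplex_line_clampR x y r : simplex_line x y (clampR r) = simplex_line x y r.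
Proof.
by apply: val_inj; rewrite /= (clampR_id (clampR_itv r)).
Qed.

Lemma simplex_line_continuous x :
  continuous (fun z : S * R => simplex_line x z.1 z.2).
Proof.
move=> z; apply: continuous_into_simplex; apply: continuous_row => j /=.
move: z; under [X in continuous X]eq_fun do rewrite !mxE.
have c2 : continuous (fun z : S * R => clampR z.2).
  apply: (@continuous_comp_fun _ _ _ snd); first by move=> z; exact: cvg_snd.
  exact: clampR_continuous.
apply: cadd; apply: cmul => //.
- by apply: cadd; [exact: continuous_const | exact: copp].
- exact: continuous_const.
- apply: (@continuous_comp_fun _ _ _ fst (fun t : S => \val t ord0 j)).
    by move=> z; exact: cvg_fst.
  exact: simplex_coord_continuous.
Qed.

Lemma simplex_vertex_subproof : delta_mx ord0 ord0 \in @std_simplex R n.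
Proof.
apply/mem_set; split=> [i|]; first by rewrite mxE ler0n.
by rewrite (bigD1 ord0) //= big1 ?mxE ?eqxx ?addr0 // => i i0; rewrite mxE (negPf i0).
Qed.

Definition simplex_vertex : S :=
  exist (fun v => v \in @std_simplex R n) _ simplex_vertex_subproof.

Lemma simplex_joined (x y : S) : joined R setT x y.
Proof.
exists (simplex_line x y); split=> //; rewrite ?simplex_line0 ?simplex_line1 //.
apply: (@continuous_comp_fun _ _ _ (fun r => (y, r)) (fun z => simplex_line x z.1 z.2)).
  by move=> r; apply: continuous_pairf; [exact: continuous_const | exact: cvg_id].
exact: simplex_line_continuous.
Qed.

End SimplexTopology.

Section LiftSimplices.
Variables (R : realType) (E M : topologicalType) (p : E -> M) (e0 : E).
Hypotheses (univp : universal_covering R p) (lM : locally_joined R M).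
Hypothesis cM : path_connected R [set: M].
Local Notation Gamma := (pi1 R (p e0)).
Variable n : nat.
Implicit Types (g h : Gamma) (t : sing R E n).

Let covp : covering_map p := univp.1.

(** A simplex is filled by the segments from a vertex, so it lifts by homotopy
    lifting. *)
Lemma lift_sing_exists (s : sing R M n) :
  exists t : sing R E n, forall x, p (t x) = s x.
Proof.
have [g [cg g0 g1 _]] :=
  path_connected_joined cM I I : joined R setT (p e0) (s (simplex_vertex R n)).
have [h [ch h0 ph]] := path_lift covp cg (esym g0).
have ph1 : p (h 1) = s (simplex_vertex R n) by rewrite ph clampR1.
pose F (z : simplex R n * R) := s (simplex_line (simplex_vertex R n) z.1 z.2).
have [|||G [cG G0 pG]] := @homotopy_lift R E M p covp _ F (fun=> h 1).
- apply: (@continuous_comp_fun _ _ _ _ s); last exact: cts_fun.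
  exact: simplex_line_continuous.
- exact: continuous_const.
- by move=> y; rewrite /F simplex_line0.
have cG1 : continuous (fun x => G (x, 1)).
  apply: (@continuous_comp_fun _ _ _ (fun x => (x, 1 : R)) G) => // x.
  by apply: continuous_pairf; [exact: cvg_id | exact: continuous_const].
pose t : sing R E n := HB.pack (fun x : simplex R n => G (x, 1))
  (isContinuous.Build _ _ (fun x : simplex R n => G (x, 1)) cG1).
exists t => x /=.
by rewrite pG /F simplex_line_clampR simplex_line1.
Qed.

Lemma lift_singP (s : sing R M n) x : p (lift_sing p e0 s x) = s x.
Proof. exact: (xgetPex _ (lift_sing_exists s)). Qed.

Lemma deck_sing_proj g t x : p (deck_sing g t x) = p (t x).
Proof. exact: deck_proj. Qed.

Lemma deck_singM g h t : deck_sing (g * h)%g t = deck_sing g (deck_sing h t).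
Proof. by apply/continuousEP => x; exact: deckM. Qed.

Lemma deck_sing_free g t : deck_sing g t = t -> g = 1%g.
Proof.
move=> /continuousEP/(_ (simplex_vertex R n)) gt.
exact: (deck_free univp lM gt).
Qed.

Lemma deck_sing1 t : deck_sing (1%g : Gamma) t = t.
Proof.
have [g gE] := deck_trans e0 univp lM (erefl (p (t (simplex_vertex R n)))) : 
  exists g : Gamma, deck g (t (simplex_vertex R n)) = t (simplex_vertex R n).
have g1 := deck_free univp lM gE; subst g.
apply/continuousEP => x.
apply: (lift_uniq covp (simplex_joined (simplex_vertex R n))) gE x.
- exact: cts_fun.
- exact: cts_fun.
- by move=> x; exact: deck_sing_proj.
Qed.

Lemma deck_sing_trans t t' : (forall x, p (t x) = p (t' x)) ->
  exists g : Gamma, t' = deck_sing g t.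
Proof.
move=> tt'; have [g gE] := deck_trans e0 univp lM (tt' (simplex_vertex R n)) :
  exists g : Gamma, _.
exists g; apply/continuousEP => x; apply/esym.
apply: (lift_uniq covp (simplex_joined (simplex_vertex R n))) gE x.
- exact: cts_fun.
- exact: cts_fun.
- by move=> x; rewrite -tt'; exact: deck_sing_proj.
Qed.

End LiftSimplices.
(** * The cone operator of a contraction *)

Section Cone.
Variables (R : realType) (E : topologicalType) (c : E) (H : E * unitI R -> E).
Hypotheses (cH : continuous H) (H0 : forall x, H (x, zero) = x).
Hypothesis H1 : forall x, H (x, one) = c.
Variable n : nat.
Implicit Types s : sing R E n.

(** The point of the face opposite to the first vertex that lies on the ray from
    this vertex through [t]; any value will do at the vertex itself. *)
Definition opposite (t : simplex R n.+1) : simplex R n :=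
  insubd (simplex_vertex R n)
    ((1 - \val t ord0 ord0)^-1 *: \row_j \val t ord0 (lift ord0 j)).

Lemma val_opposite (t : simplex R n.+1) : \val t ord0 ord0 != 1 ->
  \val (opposite t) = (1 - \val t ord0 ord0)^-1 *: \row_j \val t ord0 (lift ord0 j).
Proof.
move=> t1; rewrite val_insubd ifT //; apply/mem_set; split=> [j|].
  by rewrite !mxE mulr_ge0 ?simplex_ge0 // invr_ge0 subr_ge0 simplex_le1.
under eq_bigr do rewrite !mxE.
have := simplex_sum t; rewrite big_ord_recl => st.
have -> : \sum_(i < n.+1) (1 - \val t ord0 ord0)^-1 * \val t ord0 (lift ord0 i)
    = (1 - \val t ord0 ord0)^-1 * (1 - \val t ord0 ord0).
  by rewrite -mulr_sumr -st addrAC subrr add0r.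
by rewrite mulVf // subr_eq0 eq_sym.
Qed.

Definition cone_fun s (t : simplex R n.+1) : E :=
  H (s (opposite t), clamp (\val t ord0 ord0)).

Lemma opposite_continuous (t : simplex R n.+1) : \val t ord0 ord0 != 1 ->
  {for t, continuous opposite}.
Proof.
move=> t1; apply: continuous_into_simplex; apply: continuous_row => j.
have c0 := @simplex_coord_continuous R n.+1 ord0.
have near1 : nbhs t [set t' : simplex R n.+1 | \val t' ord0 ord0 != 1].
  have h : nbhs (\val t ord0 ord0) (~` [set (1 : R)]).
    apply: open_nbhs_nbhs; split; first by apply: closed_openC; exact: closed_eq.
    by move=> /= e; move: t1; rewrite e eqxx.
  have h' : nbhs t [set t' : simplex R n.+1 | \val t' ord0 ord0 <> 1] := c0 t _ h.
  by apply: filterS h' => t' /= /eqP.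
apply: (@near_eq_continuous _ _ _
  (fun t' : simplex R n.+1 => (1 - \val t' ord0 ord0)^-1 * \val t' ord0 (lift ord0 j))).
  by apply: filterS near1 => t' t'1; rewrite val_opposite // !mxE.
apply: (@continuousM _ _ (fun t' : simplex R n.+1 => (1 - \val t' ord0 ord0)^-1)
  (fun t' : simplex R n.+1 => \val t' ord0 (lift ord0 j))); last exact: simplex_coord_continuous.
apply: (@continuousV _ _ (fun t' : simplex R n.+1 => 1 - \val t' ord0 ord0)).
  by rewrite subr_eq0 eq_sym.
by apply: (@cadd R _ (fun=> 1)); [exact: continuous_const | exact: copp].
Qed.

(** At the vertex itself the contraction converges uniformly, as the simplex is
    compact. *)
Lemma cone_continuous s : continuous (cone_fun s).
Proof.
have cK : continuous (fun z : simplex R n * unitI R => H (s z.1, z.2)).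
  apply: (@continuous_comp_fun _ _ _ (fun z : simplex R n * unitI R => (s z.1, z.2)) H) => // z.
  apply: (@continuous_pairf _ _ _ (fun z : simplex R n * unitI R => s z.1) snd);
    last exact: cvg_snd.
  apply: (@continuous_for_comp _ _ _ fst s); first exact: cvg_fst.
  exact: cts_fun.
have cc : continuous (fun t : simplex R n.+1 => clamp (\val t ord0 ord0)).
  apply: (@continuous_comp_fun _ _ _ (fun t : simplex R n.+1 => \val t ord0 ord0)).
    exact: simplex_coord_continuous.
  exact: clamp_continuous.
move=> t; have [t1|t1] := eqVneq (\val t ord0 ord0) 1; last first.
  apply: (@continuous_for_comp _ _ _
    (fun t : simplex R n.+1 => (opposite t, clamp (\val t ord0 ord0)))
    (fun z => H (s z.1, z.2))); last exact: cK.
  by apply: continuous_pairf; [exact: opposite_continuous | exact: cc].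
move=> A; rewrite /cone_fun t1 -oneE H1 => nA.
have near_one : \forall i \near (one : unitI R), forall y, A (H (s y, i)).
  have /compact_near_coveringP cov := @std_simplex_compact R n.
  pose P (i : unitI R) x := forall y : simplex R n, \val y = x -> A (H (s y, i)).
  have : nbhs (one : unitI R) [set i | @std_simplex R n `<=` P i].
    apply: (cov (unitI R) (nbhs (one : unitI R)) P).
    move=> x /mem_set xS; pose y0 : simplex R n := exist _ x xS.
    have : nbhs (y0, one : unitI R) ((fun z => H (s z.1, z.2)) @^-1` A).
      by apply: cK; rewrite /= H1.
    move=> [[B1 B2] /= [nB1 nB2] BA].
    have [_ [[W oW <-] /= Wx WB]] := nB1.
    exists (W, B2); first by split=> //; exact: open_nbhs_nbhs.
    move=> [x' i] [/= Wx' B2i] y yx'; apply: (BA (y, i)); split=> //=.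
    by apply: WB; move: Wx'; rewrite -yx'.
  by apply: filterS => i h y; apply: (h _ (set_mem (valP y))).
have : nbhs t [set t' : simplex R n.+1 | forall y, A (H (s y, clamp (\val t' ord0 ord0)))].
  by apply: (cc t [set i | forall y, A (H (s y, i))]); rewrite /= t1 -oneE.
by apply: filterS => t' h; exact: h.
Qed.

Definition cone s : sing R E n.+1 :=
  HB.pack (cone_fun s) (isContinuous.Build _ _ (cone_fun s) (@cone_continuous s)).

Lemma cone_face0 s : sing_face ord0 (cone s) = s.
Proof.
apply/continuousEP => t.
change (cone_fun s (face ord0 t) = s t).
have t0 : \val (face ord0 t) ord0 ord0 = 0 by rewrite /= mxE unlift_none.
rewrite /cone_fun t0 -zeroE H0; congr (s _); apply: val_inj.
rewrite val_opposite t0; last by rewrite eq_sym oner_eq0.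
by apply/rowP => j; rewrite !mxE liftK subr0 invr1 mul1r.
Qed.

End Cone.

Section ConeBoundary.
Variables (R : realType) (E : topologicalType) (c : E) (H : E * unitI R -> E).
Hypotheses (cH : continuous H) (H0 : forall x, H (x, zero) = x).
Hypothesis H1 : forall x, H (x, one) = c.
Local Notation cone := (cone cH H1).

Lemma cone_faceS n (s : sing R E n.+1) (i : 'I_n.+2) :
  sing_face (lift ord0 i) (cone s) = cone (sing_face i s).
Proof.
apply/continuousEP => t.
change (cone_fun H s (face (lift ord0 i) t) = cone_fun H (sing_face i s) t).
have l0 : unlift (lift ord0 i) (ord0 : 'I_n.+3) = Some ord0.
  rewrite -[ord0 in X in unlift _ X](_ : lift (lift ord0 i) ord0 = ord0) ?liftK //.
  exact: val_inj.
have lS (j : 'I_n.+2) : unlift (lift ord0 i) (lift ord0 j : 'I_n.+3)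
    = omap (lift ord0) (unlift i j).
  case: (unliftP i j) => [k ->|->] /=; last first.
    by rewrite unlift_none.
  have -> : lift ord0 (lift i k) = lift (lift ord0 i) (lift ord0 k) :> 'I_n.+3.
    by apply: val_inj; rewrite /= /bump !leq0n !add1n ltnS addnS.
  by rewrite liftK.
have t0 : \val (face (lift ord0 i) t) ord0 ord0 = \val t ord0 ord0.
  by rewrite /= mxE l0.
rewrite /cone_fun t0; have [t1|t1] := eqVneq (\val t ord0 ord0) 1.
  by rewrite t1 -oneE !H1.
congr (H (_, _)); change (s (opposite (face (lift ord0 i) t)) = s (face i (opposite t))).
congr (s _); apply: val_inj; rewrite val_opposite t0 //.
apply/rowP => j; rewrite [RHS]mxE (val_opposite t1) !mxE lS.
by case: (unlift i j) => [k|] /=; rewrite ?mulr0 // !mxE.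
Qed.

Lemma cone_face1 (s : sing R E 0) :
  sing_face (lift ord0 ord0) (cone s) = cst c :> sing R E 0.
Proof.
apply/continuousEP => t.
change (cone_fun H s (face (lift ord0 ord0) t) = c).
have t1 : \val t ord0 ord0 = 1 by have := simplex_sum t; rewrite big_ord1.
have -> : face (lift ord0 ord0) t = simplex_vertex R 1.
  apply: val_inj; apply/rowP => j; rewrite !mxE.
  case: unliftP => [k ->|->]; rewrite ?eqxx /=.
    by rewrite (ord1 k) t1.
  by [].
by rewrite /cone_fun mxE eqxx -oneE H1.
Qed.

End ConeBoundary.

Section FreeChains.
Variables (R : realType) (T : topologicalType).

Lemma sing_boundary_additive n : zmod_morphism (@sing_boundary R T n).
Proof. exact: lift_is_additive. Qed.

Lemma sing_boundaryU n (s : sing R T n.+1) :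
  sing_boundary (sing_chain s) = \sum_(i < n.+2) (-1) ^+ i *: sing_chain (sing_face i s).
Proof. by rewrite /sing_boundary /sing_chain liftU scale1r. Qed.

End FreeChains.

Lemma zmod_morphism_laws (U V : zmodType) (f : U -> V) : zmod_morphism f ->
  [/\ f 0 = 0, forall x, f (- x) = - f x, forall x y, f (x + y) = f x + f y,
    forall x k, f (x *~ k) = f x *~ k &
    forall (I : Type) (r : seq I) (F : I -> U), f (\sum_(i <- r) F i) = \sum_(i <- r) f (F i)].
Proof.
move=> fB; pose g : {additive U -> V} := HB.pack f (GRing.isZmodMorphism.Build _ _ f fB).
split.
- exact: (raddf0 g).
- exact: (raddfN g).
- exact: (raddfD g).
- by move=> x k; exact: (raddfMz g).
- by move=> I r F; exact: (raddf_sum g).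
Qed.

Lemma freeg_additive_ext (K : choiceType) (V : zmodType)
    (f g : {freeg K / int} -> V) : zmod_morphism f -> zmod_morphism g ->
  (forall k, f << k >> = g << k >>) -> f =1 g.
Proof.
move=> /zmod_morphism_laws[_ _ _ fZ fS] /zmod_morphism_laws[_ _ _ gZ gS] fg x.
rewrite -[x]freeg_sumE fS gS; apply: eq_bigr => k _.
by rewrite -[coeff k x]intz -freegU_mulz fZ gZ fg.
Qed.
Lemma unbump_bump (i j k : nat) : bump (bump j i) k = j -> unbump i j = k.
Proof.
rewrite /bump /unbump; case: (leqP j i) => ji; rewrite /= ?add0n ?add1n.
  by case: (leqP i.+1 k) => ik /=; lia.
by case: (leqP i k) => ik /=; lia.
Qed.

Section BoundaryBoundary.
Variables (R : realType) (T : topologicalType) (n : nat).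
Implicit Types (s : sing R T n.+2).

(** A face of codimension two arises from both orders of omitting its two missing
    vertices; this involution exchanges the orders, and it reverses the sign. *)
Definition swap_faces (ji : 'I_n.+3 * 'I_n.+2) : 'I_n.+3 * 'I_n.+2 :=
  (lift ji.1 ji.2, odflt ji.2 (unlift (lift ji.1 ji.2) ji.1)).

Lemma lift_swap_faces ji : lift (swap_faces ji).1 (swap_faces ji).2 = ji.1.
Proof.
case: ji => j i /=.
have : lift j i != j by rewrite eq_sym neq_lift.
by move=> /unlift_some[k jE ->]; rewrite /= -jE.
Qed.

Lemma swap_facesK : involutive swap_faces.
Proof.
move=> ji; rewrite {1}/swap_faces lift_swap_faces.
case: ji => j i /=; congr (_, _); by rewrite liftK.
Qed.

Lemma swap_faces_sign ji :
  (-1) ^+ ((swap_faces ji).1 + (swap_faces ji).2) = - (-1) ^+ (ji.1 + ji.2) :> int.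
Proof.
have := lift_swap_faces ji; have : (swap_faces ji).1 = lift ji.1 ji.2 by [].
move: (swap_faces ji) => [j' i']; case: ji => j i /= -> /(congr1 val) /= e.
rewrite -[RHS]mulN1r -exprS -signr_odd -[RHS]signr_odd; congr (_ ^+ nat_of_bool _).
move: e; rewrite /bump /=; do 2 case: leqP => //=; lia.
Qed.

Lemma face_face (j : 'I_n.+3) (i : 'I_n.+2) (t : simplex R n) :
  face (lift j i) (face (swap_faces (j, i)).2 t) = face j (face i t).
Proof.
apply: val_inj; apply/rowP => k; rewrite !mxE.
have jj : lift (lift j i) (swap_faces (j, i)).2 = j := lift_swap_faces (j, i).
move: (swap_faces (j, i)).2 jj => i' jj.
case: (unliftP j k) => [k1 ->|->]; last first.
  have -> : unlift (lift j i) j = Some i' by rewrite -[X in unlift _ X]jj liftK.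
  by rewrite /= mxE unlift_none.
rewrite mxE; case: (unliftP i k1) => [k2 ->|->]; last by rewrite unlift_none.
have -> : lift j (lift i k2) = lift (lift j i) (lift i' k2).
  apply: val_inj; rewrite /= bumpC; congr (bump _ (bump _ _)).
  exact: (unbump_bump (congr1 val jj)).
by rewrite liftK mxE liftK.
Qed.

Lemma sing_boundary_boundary (c : chain R T n.+2) :
  sing_boundary (sing_boundary c) = 0.
Proof.
have [_ _ _ bM bS] := zmod_morphism_laws (@sing_boundary_additive R T n).
apply: (freeg_additive_ext (f := fun c => sing_boundary (sing_boundary c))
  (g := fun=> 0)).
- by move=> x y; rewrite !sing_boundary_additive.
- by move=> x y; rewrite subr0.
move=> s; rewrite [X in sing_boundary X]sing_boundaryU bS.
pose f (ji : 'I_n.+3 * 'I_n.+2) : chain R T n :=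
  (-1) ^+ (ji.1 + ji.2) *: sing_chain (sing_face ji.2 (sing_face ji.1 s)).
have -> : \sum_(j < n.+3) sing_boundary ((-1) ^+ j *: sing_chain (sing_face j s))
    = \sum_ji f ji.
  rewrite -(pair_bigA _ (fun j i => f (j, i))) /=; apply: eq_bigr => j _.
  rewrite -[(-1) ^+ j]intz scaler_int bM sing_boundaryU -scaler_int intz scaler_sumr.
  by apply: eq_bigr => i _; rewrite /f /= scalerA -exprD.
set S := \sum_ji _; suff SN : S = - S.
  apply/eqP/freeg_eqP => x; have /(congr1 (coeff x)) := SN.
  rewrite coeffN coeff0; lia.
rewrite {1}/S (reindex_inj (inv_inj swap_facesK)) /= -sumrN.
apply: eq_bigr => -[j i] _; rewrite /f swap_faces_sign scaleNr.
congr (- (_ *: sing_chain _)); apply/continuousEP => t.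
exact: (congr1 s (face_face j i t)).
Qed.

End BoundaryBoundary.

Section ConeChain.
Variables (R : realType) (E : topologicalType) (c : E) (H : E * unitI R -> E).
Hypotheses (cH : continuous H) (H0 : forall x, H (x, zero) = x).
Hypothesis H1 : forall x, H (x, one) = c.
Local Notation cone := (cone cH H1).

Definition cone_chain n (z : chain R E n) : chain R E n.+1 :=
  fglift (fun s => sing_chain (cone s)) z.

Lemma cone_chain_additive n : zmod_morphism (@cone_chain n).
Proof. exact: lift_is_additive. Qed.

Lemma cone_chainU n (s : sing R E n) : cone_chain (sing_chain s) = sing_chain (cone s).
Proof. by rewrite /cone_chain /sing_chain liftU scale1r. Qed.

Lemma cone_chain_homotopy n (z : chain R E n.+1) :
  sing_boundary (cone_chain z) = z - cone_chain (sing_boundary z).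
Proof.
apply: (freeg_additive_ext (f := fun z => sing_boundary (cone_chain z))
  (g := fun z => z - cone_chain (sing_boundary z))).
- by move=> x y; rewrite cone_chain_additive sing_boundary_additive.
- move=> x y; rewrite sing_boundary_additive cone_chain_additive.
  by rewrite !opprD !opprK !addrA (addrAC x).
move=> s; have [_ _ _ cM cS] := zmod_morphism_laws (@cone_chain_additive n).
rewrite cone_chainU sing_boundaryU big_ord_recl /= expr0 scale1r cone_face0 //.
congr (_ + _); rewrite sing_boundaryU cS -sumrN; apply: eq_bigr => i _.
rewrite cone_faceS -[(-1) ^+ i]intz scaler_int cM cone_chainU.
by rewrite -scaler_int intz -scaleNr /bump leq0n add1n exprS mulN1r.
Qed.

(** In degree zero [bd h] is the identity up to a multiple of the constant simplex
    at [c], and this multiple vanishes on boundaries; in the other degrees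
    [bd h = id - h bd]. *)
Theorem boundary_cone_boundary n (z : chain R E n.+1) :
  sing_boundary (cone_chain (sing_boundary z)) = sing_boundary z.
Proof.
case: n z => [|n] z; last first.
  rewrite cone_chain_homotopy sing_boundary_boundary.
  have [-> _ _ _ _] := zmod_morphism_laws (@cone_chain_additive n).
  by rewrite subr0.
apply: (freeg_additive_ext (f := fun z => sing_boundary (cone_chain (sing_boundary z)))).
- by move=> x y; rewrite sing_boundary_additive cone_chain_additive sing_boundary_additive.
- exact: sing_boundary_additive.
have bc (s : sing R E 0) : sing_boundary (cone_chain (sing_chain s))
    = sing_chain s - sing_chain (cst c : sing R E 0).
  rewrite cone_chainU sing_boundaryU big_ord_recl big_ord1 /= expr0 scale1r.
  by rewrite cone_face0 // cone_face1 expr1 scaleN1r.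
move=> s; rewrite sing_boundaryU !big_ord_recl big_ord0 addr0 expr0 expr1 scale1r scaleN1r.
rewrite cone_chain_additive sing_boundary_additive !bc.
by rewrite opprB addrA subrK.
Qed.

End ConeChain.
(** * Bounded integral functions and their norm *)

Section BoundedIntegerFunctions.
Variables (R : realType) (d : measure_display) (X : measurableType d).
Variable mu : probability X R.
Local Notation L := (LinfZ mu).
Implicit Types (u v : X -> int).

Definition simple_int u : Prop :=
  (forall A : set int, measurable (u @^-1` A)) /\ exists B : nat, forall x, (`|u x| <= B)%N.

Lemma simple_int_ess_bounded u : simple_int u -> u \in ess_bounded_int_pred mu.
Proof.
move=> [mu' [B uB]]; apply/asboolP; split=> //; exists B.
exact: aeW.
Qed.

Lemma simple_intB u v : simple_int u -> simple_int v ->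
  simple_int (fun x => u x - v x).
Proof.
move=> su sv; have [mu' [B uB]] := su; have [mv [C vC]] := sv.
split; last first.
  exists (B + C)%N => x; apply: leq_trans (leq_add (uB x) (vC x)).
  by rewrite -lez_nat PoszD !abszE; exact: ler_normB.
have := ess_bounded_int_zmod mu => -[_ /(_ u v)].
move=> /(_ (simple_int_ess_bounded su) (simple_int_ess_bounded sv)).
by move=> /asboolP[].
Qed.

Lemma simple_int_cst k : simple_int (fun=> k).
Proof.
split; last by exists `|k|%N.
by move=> A; rewrite preimage_cst; case: ifP => _; [exact: measurableT|exact: measurable0].
Qed.

Lemma simple_intD u v : simple_int u -> simple_int v ->
  simple_int (fun x => u x + v x).
Proof.
move=> su sv; have s0 := simple_intB (simple_int_cst 0) sv.
have := simple_intB su s0; congr simple_int; apply/funext => x.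
by rewrite sub0r opprK.
Qed.

Lemma simple_int_sum (I : Type) (r : seq I) (u : I -> X -> int) :
  (forall i, simple_int (u i)) -> simple_int (fun x => \sum_(i <- r) u i x).
Proof.
move=> su; elim: r => [|i r IH].
  have -> : (fun x => \sum_(i <- [::]) u i x) = (fun=> 0).
    by apply/funext => x; rewrite big_nil.
  exact: simple_int_cst.
have -> : (fun x => \sum_(j <- i :: r) u j x)
    = (fun x => u i x + \sum_(j <- r) u j x).
  by apply/funext => x; rewrite big_cons.
exact: simple_intD.
Qed.

Lemma simple_int_comp (h : int -> int) u : simple_int u ->
  simple_int (fun x => h (u x)).
Proof.
move=> [mu' [B uB]]; split; first by move=> A; exact: (mu' (h @^-1` A)).
exists (\sum_(i < B.+1) (`|h i%:Z| + `|h (- i%:Z)|))%N => x.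
have uBx : (`|u x| < B.+1)%N by rewrite ltnS.
rewrite (bigD1 (Ordinal uBx)) //=; apply: leq_trans (leq_addr _ _).
by case: (intP (u x)) => [|m|m] /=; rewrite ?leq_addr ?leq_addl.
Qed.

Lemma simple_int_pre (G : groupType) (a : pmp_action G mu) g u :
  simple_int u -> simple_int (fun x => u (a g x)).
Proof.
move=> [mu' [B uB]]; split; last by exists B.
by move=> A; apply: (@measurable_pre _ _ _ _ _ a g (u @^-1` A)).
Qed.

Lemma simple_int_indic (T : eqType) (f : X -> T) (t : T) :
  measurable (f @^-1` [set t]) -> simple_int (fun x => (f x == t)%:R).
Proof.
move=> mf; split; last by exists 1%N => x; case: (f x == t).
move=> A; have -> : (fun x => (f x == t)%:R : int) @^-1` A =
    (f @^-1` [set t] `&` [set x | A 1]) `|` (~` (f @^-1` [set t]) `&` [set x | A 0]).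
  apply/seteqP; split=> [x /=|x [] [] /= fx]; last 2 first.
  - by rewrite fx eqxx.
  - by have /negPf -> : f x != t by apply/eqP.
  by have [->|/eqP ft] := eqVneq (f x) t; [left | right].
have mc (Q : Prop) : measurable [set x : X | Q].
  have [q|q] := pselect Q.
    by rewrite (_ : [set x | Q] = setT) //; apply/seteqP; split.
  by rewrite (_ : [set x | Q] = set0) //; apply/seteqP; split.
by apply: measurableU; apply: measurableI => //; exact: measurableC.
Qed.

Lemma int_fun_measurable (h : int -> R) u :
  (forall A : set int, measurable (u @^-1` A)) ->
  measurable_fun [set: X] (fun x => h (u x)).
Proof. by move=> mu' _ Y mY; rewrite setTI; exact: (mu' (h @^-1` Y)). Qed.

Lemma simple_int_bounded_measurable u : simple_int u ->
  bounded_measurable (fun x => (u x)%:~R : R).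
Proof.
move=> [mu' [B uB]]; split; first exact: (@int_fun_measurable (fun k => k%:~R)).
exists B%:R => x; rewrite -intr_norm -[B%:R]/(B%:Z%:~R) ler_int.
by rewrite -abszE lez_nat.
Qed.

(** The class of [u]; meaningful for simple functions, which represent every
    class. *)
Definition Linf_of u : L := LinfZ_class (insubd (0 : ebfun mu) u).

Lemma Linf_of_val u : simple_int u -> \val (insubd (0 : ebfun mu) u) = u.
Proof. by move=> /simple_int_ess_bounded su; exact: insubdK. Qed.

Lemma LinfZ_classB (f g : ebfun mu) :
  LinfZ_class (f - g) = LinfZ_class f - LinfZ_class g.
Proof. by rewrite /LinfZ_class !piE. Qed.

Lemma Linf_ofB u v : simple_int u -> simple_int v ->
  Linf_of (fun x => u x - v x) = Linf_of u - Linf_of v.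
Proof.
move=> su sv; rewrite /Linf_of -LinfZ_classB; apply/LinfZ_classP; apply: aeW => x.
rewrite ebfunB -!/(\val _ x) !Linf_of_val //; exact: simple_intB.
Qed.

Lemma Linf_of0 : Linf_of (fun=> 0) = 0.
Proof.
apply: etrans (subrr (Linf_of (fun=> 0))).
apply: etrans (Linf_ofB (simple_int_cst 0) (simple_int_cst 0)).
by congr Linf_of; apply/funext => x; rewrite subrr.
Qed.

Lemma Linf_ofD u v : simple_int u -> simple_int v ->
  Linf_of (fun x => u x + v x) = Linf_of u + Linf_of v.
Proof.
move=> su sv; have s0 := simple_intB (simple_int_cst 0) sv.
have -> : (fun x => u x + v x) = (fun x => u x - (0 - v x)).
  by apply/funext => x; rewrite sub0r opprK.
by rewrite Linf_ofB // (Linf_ofB (simple_int_cst 0) sv) Linf_of0 sub0r opprK.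
Qed.

Lemma Linf_repr (f : L) : exists2 u, simple_int u & f = Linf_of u.
Proof.
pose F := repr f; have /asboolP[mF [B FB]] := ebfunP F.
pose u x : int := if (`|F x| <= B)%N then F x else 0.
have su : simple_int u.
  split; last by exists B => x; rewrite /u; case: ifP.
  by move=> A; exact: (mF ((fun k : int => if (`|k| <= B)%N then k else 0) @^-1` A)).
exists u => //; rewrite -[f]reprK -/F; apply/LinfZ_classP.
by apply: filterS FB => x FBx; rewrite -[RHS]/(\val _ x) Linf_of_val // /u FBx.
Qed.

Lemma LinfZ_norm_of u : simple_int u ->
  LinfZ_norm (Linf_of u) = expect mu (fun x => `|u x|%:~R).
Proof.
move=> su; rewrite /LinfZ_norm /expect /Rintegral; congr fine.
have /asboolP[mF _] := ebfunP (repr (Linf_of u)).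
apply: ae_eq_integral => //.
- apply/measurable_EFinP; exact: (@int_fun_measurable (fun k => `|k|%:~R)).
- by case: su => mu' _; apply/measurable_EFinP; exact: (@int_fun_measurable (fun k => `|k|%:~R)).
have /LinfZ_classP : LinfZ_class (repr (Linf_of u)) = Linf_of u.
  by rewrite /LinfZ_class reprK.
apply: filterS => x; rewrite -[in X in X -> _]/(\val _ x) => e _ /=.
by rewrite e -[ebfun_val _ x]/(\val _ x) Linf_of_val.
Qed.

Lemma LinfZ_norm0 : LinfZ_norm (0 : L) = 0.
Proof.
rewrite -Linf_of0 LinfZ_norm_of; last exact: simple_int_cst.
by rewrite -[RHS](expect_cst mu 0); congr expect; apply/funext => x; rewrite normr0.
Qed.

Lemma bounded_measurable_absz u : simple_int u ->
  bounded_measurable (fun x => `|u x|%:~R : R).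
Proof.
by move=> su; apply: (@simple_int_bounded_measurable (fun x => `|u x|)); exact: simple_int_comp.
Qed.

Lemma LinfZ_normD (f g : L) : LinfZ_norm (f + g) <= LinfZ_norm f + LinfZ_norm g.
Proof.
have [u su ->] := Linf_repr f; have [v sv ->] := Linf_repr g.
have suv := simple_intD su sv.
rewrite -Linf_ofD // !LinfZ_norm_of // -expectD; try exact: bounded_measurable_absz.
apply: le_expect.
- exact: (bounded_measurable_absz suv).
- by apply: bounded_measurableD; exact: bounded_measurable_absz.
- by move=> x; rewrite -intrD ler_int; exact: ler_normD.
Qed.

Lemma LinfZ_norm_sum (I : Type) (r : seq I) (f : I -> L) :
  LinfZ_norm (\sum_(i <- r) f i) <= \sum_(i <- r) LinfZ_norm (f i).
Proof.
elim: r => [|i r IH]; first by rewrite !big_nil LinfZ_norm0.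
by rewrite !big_cons; apply: le_trans (LinfZ_normD _ _) _; rewrite lerD2l.
Qed.

Lemma LinfZ_norm_ge0 (f : L) : 0 <= LinfZ_norm f.
Proof. by apply: Rintegral_ge0 => x _; rewrite ler0z. Qed.

Lemma Linf_of_cst k : LinfZ_cst mu k = Linf_of (fun=> k).
Proof.
apply/LinfZ_classP; apply: aeW => x.
by rewrite -[RHS]/(\val _ x) Linf_of_val //; exact: simple_int_cst.
Qed.

Section Action.
Variables (G : groupType) (a : pmp_action G mu).

Lemma LinfZ_act_of u g : simple_int u ->
  LinfZ_act a (Linf_of u) g = Linf_of (fun x => u (a g x)).
Proof.
move=> su; rewrite /Linf_of LinfZ_actE; apply/LinfZ_classP; apply: aeW => x.
change (\val (insubd (0 : ebfun mu) u) (a g x)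
  = \val (insubd (0 : ebfun mu) (fun x => u (a g x))) x).
by rewrite !Linf_of_val //; exact: simple_int_pre.
Qed.

Lemma LinfZ_act1 f : LinfZ_act a f 1%g = f.
Proof.
have [u su ->] := Linf_repr f; rewrite LinfZ_act_of //.
by congr Linf_of; apply/funext => x; rewrite pmp_act1.
Qed.

Lemma LinfZ_actM f g h : LinfZ_act a (LinfZ_act a f g) h = LinfZ_act a f (g * h)%g.
Proof.
have [u su ->] := Linf_repr f; rewrite !LinfZ_act_of //; last exact: simple_int_pre.
by congr Linf_of; apply/funext => x; rewrite pmp_actM.
Qed.

Lemma LinfZ_actD f f' g :
  LinfZ_act a (f + f') g = LinfZ_act a f g + LinfZ_act a f' g.
Proof.
have [u su ->] := Linf_repr f; have [v sv ->] := Linf_repr f'.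
rewrite -Linf_ofD // !LinfZ_act_of //; last exact: simple_intD.
by rewrite Linf_ofD //; exact: simple_int_pre.
Qed.

Lemma expect_pre g u : simple_int u ->
  expect mu (fun x => `|u (a g x)|%:~R) = expect mu (fun x => `|u x|%:~R).
Proof.
move=> [mu' [B uB]].
(* A bounded integral function is a combination of the indicators of its fibres. *)
have fibre v : (forall x, (`|v x| <= B)%N) -> forall x,
    `|v x|%:~R = \sum_(i <- iota 0 B.+1) i%:R * \1_[set y | `|v y|%N = i] x :> R.
  move=> vB x; have jr : `|v x|%N \in iota 0 B.+1 by rewrite mem_iota add0n ltnS vB.
  rewrite (bigD1_seq _ jr (iota_uniq _ _)) /=.
  rewrite indicE mem_set // mulr1 big1 ?addr0 => [|i ix]; last first.
    by rewrite indicE memNset ?mulr0 //= => e; move: ix; rewrite e eqxx.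
  by rewrite -abszE.
have mE v : (forall A : set int, measurable (v @^-1` A)) ->
    forall i, measurable [set y | `|v y|%N = i].
  by move=> mv i; exact: (mv [set k | `|k|%N = i]).
have E v : (forall A : set int, measurable (v @^-1` A)) ->
    (forall x, (`|v x| <= B)%N) -> expect mu (fun x => `|v x|%:~R)
    = \sum_(i <- iota 0 B.+1) i%:R * mass mu [set y | `|v y|%N = i].
  move=> mv vB; have -> : (fun x => `|v x|%:~R : R)
      = (fun x => \sum_(i <- iota 0 B.+1) i%:R * \1_[set y | `|v y|%N = i] x).
    by apply/funext => x; exact: fibre.
  have bi i : bounded_measurable (\1_[set y | `|v y|%N = i] : X -> R).
    by apply: bounded_measurable_indic; exact: mE.
  rewrite expect_sum => [|i]; last exact: bounded_measurableZ.
  by apply: eq_bigr => i _; rewrite expectZ // expect_indic //; exact: mE.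
have [mv [C vC]] := simple_int_pre a g (conj mu' (ex_intro _ B uB)).
rewrite !E //; apply: eq_bigr => i _; congr (_ * _).
by rewrite -[in RHS](mass_pre a g) //; exact: mE.
Qed.

Lemma LinfZ_norm_act f g : LinfZ_norm (LinfZ_act a f g) = LinfZ_norm f.
Proof.
have [u su ->] := Linf_repr f; rewrite LinfZ_act_of // !LinfZ_norm_of //.
  exact: expect_pre.
exact: simple_int_pre.
Qed.

End Action.
End BoundedIntegerFunctions.
(** * The norm on the twisted chain complex *)

Section FreeLift.
Variables (K : choiceType) (V : zmodType) (f : K -> V).
Local Notation F := ({freeg K / int}).

(** The additive extension of [f] to the free abelian group; unlike [fglift] it
    takes values in a mere abelian group. *)
Definition zlift (D : F) : V := \sum_(k <- dom D) f k *~ coeff k D.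

Lemma zliftE (D : F) (s : seq K) : uniq s -> {subset dom D <= s} ->
  zlift D = \sum_(k <- s) f k *~ coeff k D.
Proof.
move=> us sD; rewrite /zlift (perm_big [seq k <- s | k \in dom D]); last first.
  apply: uniq_perm; rewrite ?uniq_dom ?filter_uniq // => k.
  rewrite mem_filter /=; have := sD k.
  by case: (k \in dom D) => // /(_ isT) ->.
rewrite big_filter big_mkcond /=; apply: eq_bigr => k _.
by case: ifPn => // /coeff_outdom ->; rewrite mulr0z.
Qed.

Lemma zlift_additive : zmod_morphism zlift.
Proof.
move=> x y; pose s := undup (dom x ++ dom y).
have us : uniq s by exact: undup_uniq.
rewrite (zliftE us) 1?(zliftE (D := x) us) ?(zliftE (D := y) us).
- by rewrite -sumrB; apply: eq_bigr => k _; rewrite coeffB mulrzBr.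
- by move=> k ky; rewrite mem_undup mem_cat ky orbT.
- by move=> k kx; rewrite mem_undup mem_cat kx.
- by move=> k /domB; rewrite mem_undup.
Qed.

Lemma zliftU k : zlift << k >> = f k.
Proof. by rewrite /zlift domU1 big_seq1 coeffU eqxx mulr1z. Qed.

End FreeLift.

Section TensorInduced.
Variables (G : Type) (A B V : zmodType) (ra : A -> G -> A) (la : G -> B -> B).
Variable beta : A -> B -> V.
Hypotheses (betaDl : forall a a' b, beta (a + a') b = beta a b + beta a' b)
  (betaDr : forall a b b', beta a (b + b') = beta a b + beta a b')
  (betaG : forall a g b, beta (ra a g) b = beta a (la g b)).

Definition tensor_induced (z : tensor ra la) : V :=
  zlift (fun ab => beta ab.1 ab.2) (repr z).

(** The map [beta] kills the generators of the relations of the tensor product. *)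
Lemma tensor_induced_pi u :
  tensor_induced (\pi_(tensor ra la) u) = zlift (fun ab => beta ab.1 ab.2) u.
Proof.
pose f := zlift (fun ab : A * B => beta ab.1 ab.2).
have fB : zmod_morphism f := zlift_additive _.
apply/eqP; rewrite -subr_eq0 -[_ - _]fB; apply/eqP.
have : tensor_null ra la (repr (\pi_(tensor ra la) u) - u).
  by apply/tensor_eqP; rewrite reprK.
have fU a b : f << (a, b) >> = beta a b by rewrite /f zliftU.
move: (_ - u) => v; elim => {v}.
- by have [-> _ _ _ _] := zmod_morphism_laws fB.
- by move=> v w _ v0 _ w0; rewrite fB v0 w0 subrr.
- by move=> x y b; rewrite !fB !fU betaDl -addrA -opprD subrr.
- by move=> x b b'; rewrite !fB !fU betaDr -addrA -opprD subrr.
- by move=> x g b; rewrite fB !fU betaG subrr.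
Qed.

Lemma tensor_induced_additive : zmod_morphism tensor_induced.
Proof.
move=> x y; rewrite -[x]reprK -[y]reprK tensor_piB !tensor_induced_pi.
exact: zlift_additive.
Qed.

Lemma tensor_induced_tens a b : tensor_induced (tens ra la a b) = beta a b.
Proof. by rewrite /tens tensor_induced_pi zliftU. Qed.

End TensorInduced.

Section TensorAdditive.
Variables (G : Type) (A B : zmodType) (ra : A -> G -> A) (la : G -> B -> B).
Local Notation tens := (tens ra la).

Lemma tensor_pi0 : \pi_(tensor ra la) 0 = 0.
Proof.
have := @tensor_piB _ _ _ ra la 0 0; rewrite subr0 => /esym e.
by rewrite {1}e subrr.
Qed.

Lemma tensBl a a' b : tens (a - a') b = tens a b - tens a' b.
Proof.
apply/eqP; rewrite eq_sym subr_eq; apply/eqP.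
suff <- : tens (a - a' + a') b = tens (a - a') b + tens a' b by rewrite subrK.
apply/eqP; rewrite -subr_eq0 opprD addrA /tens !tensor_piB; apply/eqP.
rewrite -tensor_pi0.
by apply/tensor_eqP; rewrite subr0; exact: TensorNullDl.
Qed.

Lemma tensBr a b b' : tens a (b - b') = tens a b - tens a b'.
Proof.
apply/eqP; rewrite eq_sym subr_eq; apply/eqP.
suff <- : tens a (b - b' + b') = tens a (b - b') + tens a b' by rewrite subrK.
apply/eqP; rewrite -subr_eq0 opprD addrA /tens !tensor_piB; apply/eqP.
rewrite -tensor_pi0.
by apply/tensor_eqP; rewrite subr0; exact: TensorNullDr.
Qed.

Lemma tensG a g b : tens (ra a g) b = tens a (la g b).
Proof. by apply/tensor_eqP; exact: TensorNullG. Qed.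

End TensorAdditive.

Section Norm.
Variables (R : realType) (M E : topologicalType) (p : E -> M) (e0 : E).
Variables (d : measure_display) (X : measurableType d) (mu : probability X R).
Variable a : pmp_action (pi1 R (p e0)) mu.
Hypotheses (univp : universal_covering R p) (lM : locally_joined R M).
Local Notation Gamma := (pi1 R (p e0)).
Variable n : nat.
Local Notation L := (LinfZ mu).
Local Notation S := (sing R E n).
Local Notation act := (LinfZ_act a).
Implicit Types (s t : S) (f : L) (g : Gamma).

Lemma deck_chainU g s : deck_chain g (sing_chain s) = sing_chain (deck_sing g s).
Proof. by rewrite /deck_chain /sing_chain liftU scale1r. Qed.

(** The contribution of [f (x) t] to the coefficient at the orbit of [s]. *)
Definition orbit_coeff s f t : L :=
  match pselect (exists g : Gamma, t = deck_sing g s) with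
  | left h => act f (sval (cid h))
  | right _ => 0
  end.

Lemma orbit_coeff_in s f g : orbit_coeff s f (deck_sing g s) = act f g.
Proof.
rewrite /orbit_coeff; case: pselect => [h|[]]; last by exists g.
case: (cid h) => g' /= gg'; congr act.
have : deck_sing (g^-1 * g')%g s = s.
  rewrite (deck_singM univp lM) -gg' -(deck_singM univp lM) mulVg.
  exact: deck_sing1.
move=> /(deck_sing_free univp lM) /(congr1 (fun h => g * h)%g).
by rewrite mulVKg mulg1.
Qed.

Lemma orbit_coeff_out s f t : (forall g : Gamma, t <> deck_sing g s) ->
  orbit_coeff s f t = 0.
Proof. by move=> h; rewrite /orbit_coeff; case: pselect => [[g e]|//]; case: (h g e). Qed.

Lemma orbit_coeffD s f f' t :
  orbit_coeff s (f + f') t = orbit_coeff s f t + orbit_coeff s f' t.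
Proof.
have [[g ->]|h] := pselect (exists g : Gamma, t = deck_sing g s).
  by rewrite !orbit_coeff_in LinfZ_actD.
by rewrite !orbit_coeff_out ?addr0 // => g e; apply: h; exists g.
Qed.

Lemma orbit_coeff_act s f g t :
  orbit_coeff s (act f g) t = orbit_coeff s f (deck_sing g t).
Proof.
have [[h ->]|nh] := pselect (exists h : Gamma, t = deck_sing h s).
  by rewrite -(deck_singM univp lM) !orbit_coeff_in LinfZ_actM.
rewrite !orbit_coeff_out // => h e; apply: nh; last by exists h.
exists (g^-1 * h)%g; rewrite (deck_singM univp lM) -e -(deck_singM univp lM).
by rewrite mulVg (deck_sing1 e0 univp lM).
Qed.

Definition orbit_coeff_chain s f (c : chain R E n) : L := zlift (orbit_coeff s f) c.

Definition coeff_alpha s : chain_alpha a n -> L := tensor_induced (orbit_coeff_chain s).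

Lemma orbit_coeff_chainDl s f f' c : orbit_coeff_chain s (f + f') c
  = orbit_coeff_chain s f c + orbit_coeff_chain s f' c.
Proof.
rewrite /orbit_coeff_chain /zlift -big_split; apply: eq_bigr => t _ /=.
by rewrite orbit_coeffD mulrzDl.
Qed.

Lemma orbit_coeff_chainDr s f c c' : orbit_coeff_chain s f (c + c')
  = orbit_coeff_chain s f c + orbit_coeff_chain s f c'.
Proof.
have [_ _ zD _ _] := zmod_morphism_laws (zlift_additive (orbit_coeff s f)).
exact: zD.
Qed.

Lemma orbit_coeff_chainG s f g c :
  orbit_coeff_chain s (act f g) c = orbit_coeff_chain s f (deck_chain g c).
Proof.
apply: (freeg_additive_ext (f := orbit_coeff_chain s (act f g))
  (g := fun c => orbit_coeff_chain s f (deck_chain g c))).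
- exact: zlift_additive.
- by move=> x y; rewrite deck_chainB /orbit_coeff_chain zlift_additive.
- move=> t; rewrite -[<< t >>]/(sing_chain t) deck_chainU.
  by rewrite /orbit_coeff_chain !zliftU orbit_coeff_act.
Qed.

Lemma coeff_alpha_additive s : zmod_morphism (coeff_alpha s).
Proof.
apply: tensor_induced_additive.
- exact: orbit_coeff_chainDl.
- exact: orbit_coeff_chainDr.
- exact: orbit_coeff_chainG.
Qed.

Lemma coeff_alpha_tens s f t :
  coeff_alpha s (tens_alpha a f (sing_chain t)) = orbit_coeff s f t.
Proof.
rewrite /coeff_alpha /tens_alpha tensor_induced_tens.
- by rewrite /orbit_coeff_chain zliftU.
- exact: orbit_coeff_chainDl.
- exact: orbit_coeff_chainDr.
- exact: orbit_coeff_chainG.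
Qed.

Lemma same_orbit_sym s t : same_orbit p e0 s t -> same_orbit p e0 t s.
Proof.
move=> /asboolP[g ->]; apply/asboolP; exists g^-1%g.
by rewrite -(deck_singM univp lM) mulVg (deck_sing1 e0 univp lM).
Qed.

Lemma same_orbit_trans s t u :
  same_orbit p e0 s t -> same_orbit p e0 t u -> same_orbit p e0 s u.
Proof.
move=> /asboolP[g ->] /asboolP[h ->]; apply/asboolP; exists (h * g)%g.
by rewrite (deck_singM univp lM).
Qed.

Lemma orbit_coeff_eq0 s f t : ~~ same_orbit p e0 s t -> orbit_coeff s f t = 0.
Proof.
by move=> st; apply: orbit_coeff_out => g e; move/negP: st; apply; apply/asboolP; exists g.
Qed.

Lemma coeff_alpha_reduced (r : seq (L * S)) f s :
  pairwise (fun v w => ~~ same_orbit p e0 v.2 w.2) r -> (f, s) \in r ->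
  \sum_(v <- r) orbit_coeff s v.1 v.2 = f.
Proof.
elim: r => // -[f' t] r IH; rewrite pairwise_cons inE big_cons => /andP[/allP nt pr].
move=> /predU1P[[-> ->]|fr] /=.
  have -> : orbit_coeff t f' t = f'.
    by rewrite -{2}(deck_sing1 e0 univp lM t) orbit_coeff_in LinfZ_act1.
  by rewrite big_seq big1 ?addr0 // => u /nt; exact: orbit_coeff_eq0.
rewrite IH // orbit_coeff_eq0 ?add0r //.
by apply: contra (nt _ fr); exact: same_orbit_sym.
Qed.

Lemma sum_orbit_coeff_norm (r : seq (L * S)) f s :
  pairwise (fun v w => ~~ same_orbit p e0 v.2 w.2) r ->
  \sum_(v <- r) LinfZ_norm (orbit_coeff v.2 f s) <= LinfZ_norm f.
Proof.
elim: r => [|[f' t] r IH]; first by rewrite big_nil LinfZ_norm_ge0.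
rewrite pairwise_cons big_cons => /andP[/allP nt pr] /=.
have [ts|ts] := boolP (same_orbit p e0 t s); last first.
  by rewrite orbit_coeff_eq0 // LinfZ_norm0 add0r IH.
rewrite big_seq big1 => [|u ur]; last first.
  rewrite orbit_coeff_eq0 ?LinfZ_norm0 //; apply: contra (nt u ur) => /= us.
  exact: same_orbit_trans ts (same_orbit_sym us).
by move: ts => /asboolP[g ->]; rewrite addr0 orbit_coeff_in LinfZ_norm_act.
Qed.

(** Each coefficient of a reduced form is a sum of translates of the coefficients
    of any other representation, and translation preserves the norm. *)
Theorem norm_alpha_le (I : Type) (r : seq I) (f : I -> L) (s : I -> S) :
  norm_alpha (\sum_(i <- r) tens_alpha a (f i) (sing_chain (s i)))
    <= \sum_(i <- r) LinfZ_norm (f i).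
Proof.
set z := \sum_(i <- r) _; rewrite /norm_alpha; case: xgetP => [x _ [q [zq pq] ->]|_].
  apply: (@le_trans _ _ (\sum_(v <- q) \sum_(i <- r) LinfZ_norm (orbit_coeff v.2 (f i) (s i)))).
    rewrite big_seq [leRHS]big_seq; apply: ler_sum => -[f' t] tq /=.
    have -> : f' = \sum_(i <- r) orbit_coeff t (f i) (s i).
      rewrite -(coeff_alpha_reduced pq tq).
      have := congr1 (coeff_alpha t) zq.
      have [_ _ _ _ cS] := zmod_morphism_laws (coeff_alpha_additive t).
      rewrite /z !cS; under eq_bigr do rewrite coeff_alpha_tens.
      by under [in RHS]eq_bigr do rewrite coeff_alpha_tens; move=> ->.
    exact: LinfZ_norm_sum.
  rewrite exchange_big /=; apply: ler_sum => i _; exact: sum_orbit_coeff_norm.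
by apply: sumr_ge0 => i _; exact: LinfZ_norm_ge0.
Qed.

End Norm.
(** * Projection to the base and the filling *)

Lemma sum_fibres (V : nmodType) (I J : eqType) (r : seq I) (q : seq J) (f : I -> J)
    (F : I -> V) : uniq q -> {in r, forall i, f i \in q} ->
  \sum_(j <- q) \sum_(i <- r | f i == j) F i = \sum_(i <- r) F i.
Proof.
move=> uq fq; rewrite (exchange_big_dep predT) //= big_seq [RHS]big_seq.
apply: eq_bigr => i ir; rewrite big_mkcond (bigD1_seq (f i)) ?fq //= eqxx.
by rewrite big1 ?addr0 // => j /negPf; rewrite eq_sym => ->.
Qed.

Lemma freeg_expand (K : choiceType) (V : zmodType) (f : {freeg K / int} -> V) z :
  zmod_morphism f -> f z = \sum_(k <- dom z) f << k >> *~ coeff k z.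
Proof.
move=> fB; apply: (freeg_additive_ext (g := zlift (fun k => f << k >>))) => //.
  exact: zlift_additive.
by move=> k; rewrite zliftU.
Qed.

Section LinfSums.
Variables (R : realType) (d : measure_display) (X : measurableType d).
Variables (mu : probability X R) (G : groupType) (a : pmp_action G mu).

Lemma simple_intZ (c : int) (u : X -> int) : simple_int u ->
  simple_int (fun x => c * u x).
Proof. exact: simple_int_comp. Qed.

Lemma Linf_ofZ (c : int) (u : X -> int) : simple_int u ->
  Linf_of mu (fun x => c * u x) = Linf_of mu u *~ c.
Proof.
move=> su; elim: c => [|c IH|c IH].
- rewrite mulr0z -(Linf_of0 mu); congr Linf_of.
  by apply/funext => x; rewrite mul0r.
- have -> : (fun x => c.+1%:Z * u x) = (fun x => c%:Z * u x + u x).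
    by apply/funext => x; rewrite intS addrC mulrDl mul1r.
  by rewrite Linf_ofD //; [rewrite IH intS addrC mulrzDr mulr1z | exact: simple_intZ].
- have -> : (fun x => - c.+1%:Z * u x) = (fun x => - c%:Z * u x - u x).
    by apply/funext => x; rewrite intS opprD addrC mulrDl mulN1r.
  rewrite Linf_ofB //; last exact: simple_intZ.
  by rewrite IH intS opprD mulrzDr !mulrNz mulr1z addrC.
Qed.

Lemma Linf_of_sum (I : Type) (r : seq I) (u : I -> X -> int) :
  (forall i, simple_int (u i)) ->
  Linf_of mu (fun x => \sum_(i <- r) u i x) = \sum_(i <- r) Linf_of mu (u i).
Proof.
move=> su; elim: r => [|i r IH].
  rewrite big_nil -(Linf_of0 mu); congr Linf_of.
  by apply/funext => x; rewrite big_nil.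
rewrite big_cons -IH -Linf_ofD //.
  by congr Linf_of; apply/funext => x; rewrite big_cons.
exact: (simple_int_sum mu).
Qed.

Lemma LinfZ_act_additive g : zmod_morphism (fun f : LinfZ mu => LinfZ_act a f g).
Proof. by move=> x y; apply/eqP; rewrite eq_sym subr_eq -LinfZ_actD subrK. Qed.

End LinfSums.

Section Projection.
Variables (R : realType) (M E : topologicalType) (p : E -> M) (e0 : E).
Hypotheses (univp : universal_covering R p) (lM : locally_joined R M).
Hypothesis cM : path_connected R [set: M].
Local Notation Gamma := (pi1 R (p e0)).

Lemma proj_sing_continuous n (t : sing R E n) : continuous (fun x => p (t x)).
Proof.
by apply: continuous_comp_fun; [exact: cts_fun | exact: covering_continuous univp.1].
Qed.

Definition proj_sing n (t : sing R E n) : sing R M n :=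
  HB.pack (fun x : simplex R n => p (t x))
    (isContinuous.Build _ _ _ (@proj_sing_continuous n t)).

Definition proj_chain n (z : chain R E n) : chain R M n :=
  fglift (fun t => sing_chain (proj_sing t)) z.

Definition lift_chain n (c : chain R M n) : chain R E n :=
  fglift (fun s => sing_chain (lift_sing p e0 s)) c.

Lemma proj_chain_additive n : zmod_morphism (@proj_chain n).
Proof. exact: lift_is_additive. Qed.

Lemma lift_chain_additive n : zmod_morphism (@lift_chain n).
Proof. exact: lift_is_additive. Qed.

Lemma proj_chainU n (t : sing R E n) :
  proj_chain (sing_chain t) = sing_chain (proj_sing t).
Proof. by rewrite /proj_chain /sing_chain liftU scale1r. Qed.

Lemma lift_chainU n (s : sing R M n) :
  lift_chain (sing_chain s) = sing_chain (lift_sing p e0 s).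
Proof. by rewrite /lift_chain /sing_chain liftU scale1r. Qed.

Lemma proj_lift_sing n (s : sing R M n) : proj_sing (lift_sing p e0 s) = s.
Proof. by apply/continuousEP => x; exact: (lift_singP e0 univp cM s x). Qed.

Lemma proj_lift_chain n (c : chain R M n) : proj_chain (lift_chain c) = c.
Proof.
apply: (freeg_additive_ext (f := fun c => proj_chain (lift_chain c)) (g := id)) => //.
  by move=> x y; rewrite lift_chain_additive proj_chain_additive.
move=> s; rewrite -[<< s >>]/(sing_chain s) lift_chainU proj_chainU.
by rewrite proj_lift_sing.
Qed.

Lemma proj_boundary n (z : chain R E n.+1) :
  sing_boundary (proj_chain z) = proj_chain (sing_boundary z).
Proof.
apply: (freeg_additive_ext (f := fun z => sing_boundary (proj_chain z))
  (g := fun z => proj_chain (sing_boundary z))).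
- by move=> x y; rewrite proj_chain_additive sing_boundary_additive.
- by move=> x y; rewrite sing_boundary_additive proj_chain_additive.
move=> t; rewrite -[<< t >>]/(sing_chain t) proj_chainU !sing_boundaryU.
have [_ _ _ pM pS] := zmod_morphism_laws (@proj_chain_additive n).
rewrite pS; apply: eq_bigr => i _.
rewrite -[(-1) ^+ i]intz !scaler_int pM proj_chainU.
by congr (sing_chain _ *~ _); apply/continuousEP.
Qed.

Lemma sing_holonomy n : {hol : sing R E n -> Gamma &
  forall t, t = deck_sing (hol t) (lift_sing p e0 (proj_sing t))}.
Proof.
apply: (@choice _ _ (fun t g => t = deck_sing g (lift_sing p e0 (proj_sing t)))) => t.
apply: (deck_sing_trans e0 univp lM) => x.
exact: (lift_singP e0 univp cM (proj_sing t) x).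
Qed.

Lemma coeff_proj n (z : chain R E n) (s : sing R M n) :
  coeff s (proj_chain z) = \sum_(t <- dom z | proj_sing t == s) coeff t z.
Proof.
have cB : zmod_morphism (fun z : chain R E n => coeff s (proj_chain z)).
  by move=> x y; rewrite proj_chain_additive coeffB.
rewrite (freeg_expand z cB) [RHS]big_mkcond; apply: eq_bigr => t _ /=.
rewrite -[<< t >>]/(sing_chain t) proj_chainU coeffU mul1r.
by case: (_ == _); rewrite /= ?mul0rz // -mulrzr mul1r intz.
Qed.

End Projection.

Section TwistedComplex.
Variables (R : realType) (M E : topologicalType) (p : E -> M) (e0 : E).
Variables (d : measure_display) (X : measurableType d) (mu : probability X R).
Variable a : pmp_action (pi1 R (p e0)) mu.
Hypotheses (univp : universal_covering R p) (lM : locally_joined R M).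
Hypothesis cM : path_connected R [set: M].
Local Notation Gamma := (pi1 R (p e0)).
Local Notation act := (LinfZ_act a).
Local Notation ta := (tens_alpha a).

Lemma tens_alpha_additivel n (c : chain R E n) : zmod_morphism (fun f => ta f c).
Proof. by move=> x y; exact: tensBl. Qed.

Lemma tens_alpha_additiver n f : zmod_morphism (ta f : chain R E n -> _).
Proof. by move=> x y; exact: tensBr. Qed.

Lemma tens_alpha_deck n f g (c : chain R E n) : ta (act f g) c = ta f (deck_chain g c).
Proof. exact: tensG. Qed.

Lemma boundary_alpha_additive n : zmod_morphism (@boundary_alpha _ _ _ _ e0 _ _ _ a n).
Proof.
move=> x y; apply: tensor_mapB.
- by have [_ _ bD _ _] := zmod_morphism_laws (@sing_boundary_additive R E n).
- by move=> g b; exact: sing_boundary_deck.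
Qed.

(** The lift chosen for the projection of a simplex is a translate of it, and
    constant functions are invariant. *)
Lemma chain_incl_proj n (z : chain R E n) :
  chain_incl a (proj_chain univp z) = ta (LinfZ_cst mu 1) z.
Proof.
apply: (freeg_additive_ext (f := fun z => chain_incl a (proj_chain univp z))
  (g := ta (LinfZ_cst mu 1))).
- move=> x y; rewrite /chain_incl proj_chain_additive -!/(lift_chain p e0 _).
  by rewrite (@lift_chain_additive _ _ _ p e0) tens_alpha_additiver.
- exact: tens_alpha_additiver.
have [hol holE] := sing_holonomy e0 univp lM cM n.
move=> t; rewrite -[<< t >>]/(sing_chain t) proj_chainU /chain_incl.
rewrite -[fglift _ _]/(lift_chain p e0 _) lift_chainU.
rewrite [in RHS](holE t) -deck_chainU -tens_alpha_deck; congr (ta _ _).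
by rewrite Linf_of_cst LinfZ_act_of //; exact: simple_int_cst.
Qed.

End TwistedComplex.
Lemma intr_sum (R : pzRingType) (I : Type) (r : seq I) (F : I -> int) :
  (\sum_(i <- r) F i)%:~R = \sum_(i <- r) (F i)%:~R :> R.
Proof. by elim: r => [|i r IH]; rewrite ?big_nil // !big_cons intrD IH. Qed.

Section Filling.
Variables (R : realType) (M E : topologicalType) (p : E -> M) (e0 : E).
Variables (d : measure_display) (X : measurableType d) (mu : probability X R).
Variable a : pmp_action (pi1 R (p e0)) mu.
Hypotheses (univp : universal_covering R p) (lM : locally_joined R M).
Hypothesis cM : path_connected R [set: M].
Variables (c : E) (H : E * unitI R -> E).
Hypotheses (cH : continuous H) (H0 : forall x, H (x, zero) = x).
Hypothesis H1 : forall x, H (x, one) = c.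
Local Notation Gamma := (pi1 R (p e0)).
Local Notation act := (LinfZ_act a).
Local Notation ta := (tens_alpha a).
Local Notation cone := (cone cH H1).
Local Notation cone_chain := (cone_chain cH H1).
Local Notation proj := (proj_sing univp).

Variables (phi : X -> Gamma) (V : seq Gamma).
Hypotheses (uV : uniq V) (phiV : forall x, phi x \in V).
Hypothesis mphi : forall g, measurable (phi @^-1` [set g]).

Variable n : nat.
Variable hol : sing R E n -> Gamma.
Hypothesis holE : forall t, t = deck_sing (hol t) (lift_sing p e0 (proj t)).
Variable z : chain R E n.

Definition level (h g : Gamma) (x : X) : int := (phi (a h x) == g)%:R.

Lemma simple_int_level h g : simple_int (level h g).
Proof.
apply: (simple_int_indic (f := fun x => phi (a h x))).
exact: (measurable_pre a h (mphi g)).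
Qed.

Definition positions : seq Gamma :=
  undup [seq (g^-1 * hol t)%g | g <- V, t <- dom z].

Definition base_simplices : seq (sing R M n) := undup [seq proj t | t <- dom z].

Definition weight (k : Gamma * sing R M n) (x : X) : int :=
  \sum_(t <- [seq t <- dom z | proj t == k.2])
    coeff t z * level (hol t) (hol t * k.1^-1)%g x.

Lemma simple_int_weight k : simple_int (weight k).
Proof.
apply: (simple_int_sum mu) => t; apply: simple_intZ; exact: simple_int_level.
Qed.

(** The chain [sum_g (1_{phi = g} . g) (x) cone (g^-1 z)], written so that the
    simplices of [z] that are translated to the same position share a summand. *)
Definition filling : chain_alpha a n.+1 :=
  \sum_(k <- [seq (g, s) | g <- positions, s <- base_simplices])
    ta (act (Linf_of mu (weight k)) k.1^-1%g)
      (sing_chain (cone (deck_sing k.1 (lift_sing p e0 k.2)))).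

Definition cone_term (t : sing R E n) (g : Gamma) : chain_alpha a n.+1 :=
  ta (act (Linf_of mu (level 1%g g)) g) (sing_chain (cone (deck_sing g^-1%g t))).

(** Regrouping: [t] is [hol t] times the chosen lift of its projection, so the
    position [g^-1 hol t] of this lift corresponds to the value [g] of [phi]. *)
Lemma filling_expand :
  filling = \sum_(t <- dom z) (\sum_(g <- V) cone_term t g) *~ coeff t z.
Proof.
have termE t g : ta (act (Linf_of mu (level (hol t) (hol t * g^-1)%g)) g^-1%g)
    (sing_chain (cone (deck_sing g (lift_sing p e0 (proj t)))))
    = cone_term t (hol t * g^-1)%g.
  have -> : deck_sing g (lift_sing p e0 (proj t)) = deck_sing (hol t * g^-1)^-1%g t.
    by rewrite [X in _ = deck_sing _ X]holE -(deck_singM univp lM) invgM invgK mulgVK.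
  rewrite /cone_term; congr (ta _ _); rewrite -LinfZ_actM; congr (act _ _).
  rewrite LinfZ_act_of; last exact: simple_int_level.
  by congr Linf_of; apply/funext => x; rewrite /level pmp_act1.
have sumV t : t \in dom z ->
    \sum_(g <- positions) cone_term t (hol t * g^-1)%g = \sum_(g <- V) cone_term t g.
  move=> tz; transitivity (\sum_(g <- [seq hol t * g^-1 | g <- positions]%g) cone_term t g).
    by rewrite big_map.
  rewrite (bigID (mem V)) /= [X in _ + X]big1 ?addr0 => [|g gV]; last first.
    rewrite /cone_term; have -> : Linf_of mu (level 1%g g) = 0.
      rewrite -(Linf_of0 mu); congr Linf_of; apply/funext => x.
      by rewrite /level; case: eqP => // e; move: gV; rewrite -e phiV.
    have [-> _ _ _ _] := zmod_morphism_laws (LinfZ_act_additive a g).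
    by have [-> _ _ _ _] := zmod_morphism_laws (tens_alpha_additivel a
      (sing_chain (cone (deck_sing g^-1%g t)))).
  rewrite -big_filter; apply: perm_big; apply: uniq_perm => //.
    rewrite filter_uniq // map_inj_uniq ?undup_uniq // => g g'.
    by move=> /(congr1 (fun h => (hol t)^-1 * h)%g); rewrite !mulKg => /invg_inj.
  move=> g; rewrite mem_filter /=; have [gV|//] := boolP (g \in V).
  apply/mapP; exists (g^-1 * hol t)%g; last by rewrite invgM invgK mulVKg.
  by rewrite mem_undup; apply/allpairsP; exists (g, t).
have actS g := zmod_morphism_laws (LinfZ_act_additive a g).
have taS b := zmod_morphism_laws (tens_alpha_additivel a (b : chain R E n.+1)).
rewrite /filling big_allpairs_dep /=.
transitivity (\sum_(g <- positions) \sum_(s <- base_simplices)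
    \sum_(t <- dom z | proj t == s) cone_term t (hol t * g^-1)%g *~ coeff t z).
  apply: eq_bigr => g _; apply: eq_bigr => s _.
  rewrite (Linf_of_sum mu) => [|t]; last first.
    by apply: simple_intZ; exact: simple_int_level.
  have [_ _ _ actZ ->] := actS g^-1%g.
  have [_ _ _ taZ ->] := taS (sing_chain (cone (deck_sing g (lift_sing p e0 s)))).
  rewrite big_filter; apply: eq_bigr => t /eqP /= ts.
  rewrite Linf_ofZ; last exact: simple_int_level.
  by rewrite actZ taZ -ts termE.
transitivity (\sum_(g <- positions) \sum_(t <- dom z)
    cone_term t (hol t * g^-1)%g *~ coeff t z).
  apply: eq_bigr => g _.
  refine (sum_fibres (r := dom z) (q := base_simplices) (f := fun t => proj t)
    (fun t => cone_term t (hol t * g^-1)%g *~ coeff t z) _ _).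
    exact: undup_uniq.
  by move=> t tz; rewrite mem_undup map_f.
rewrite exchange_big /= big_seq [RHS]big_seq; apply: eq_bigr => t tz.
by rewrite -mulrz_suml -sumV.
Qed.

(** On each of the sets [phi = g], which partition [X], the cycle [z] is translated
    by [g^-1] and coned; the boundary of this cone is the translated cycle, and
    translating back gives [z] over the whole of [X]. *)
Lemma boundary_filling (D : chain R E n.+1) : z = sing_boundary D ->
  boundary_alpha filling = ta (LinfZ_cst mu 1) z.
Proof.
move=> zD; have [_ _ _ bM bS] := zmod_morphism_laws (boundary_alpha_additive (a := a) (n := n)).
have deckB (g : Gamma) := @deck_chainB R M E p e0 n g.
have termB g : boundary_alpha (\sum_(t <- dom z) cone_term t g *~ coeff t z)
    = ta (Linf_of mu (level 1%g g)) z.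
  have coneB : zmod_morphism (fun y : chain R E n =>
      ta (act (Linf_of mu (level 1%g g)) g) (cone_chain (deck_chain g^-1%g y))).
    by move=> x y; rewrite deckB cone_chain_additive tens_alpha_additiver.
  have -> : \sum_(t <- dom z) cone_term t g *~ coeff t z
      = ta (act (Linf_of mu (level 1%g g)) g) (cone_chain (deck_chain g^-1%g z)).
    rewrite [RHS](freeg_expand z coneB); apply: eq_bigr => t _; congr (_ *~ _).
    by rewrite /cone_term -[<< t >>]/(sing_chain t) deck_chainU cone_chainU.
  rewrite boundary_alpha_tens {1}zD -sing_boundary_deck boundary_cone_boundary //.
  rewrite sing_boundary_deck -zD -tens_alpha_deck LinfZ_actM mulgV.
  by rewrite LinfZ_act1.
rewrite filling_expand.
have -> : \sum_(t <- dom z) (\sum_(g <- V) cone_term t g) *~ coeff t z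
    = \sum_(g <- V) \sum_(t <- dom z) cone_term t g *~ coeff t z.
  by rewrite exchange_big; apply: eq_bigr => t _; rewrite mulrz_suml.
rewrite bS; under eq_bigr do rewrite termB.
have [_ _ _ _ taS] := zmod_morphism_laws (tens_alpha_additivel a z).
rewrite -taS -Linf_of_sum => [|g]; last exact: simple_int_level.
rewrite Linf_of_cst; congr (ta (Linf_of mu _) _); apply/funext => x.
rewrite (bigD1_seq (phi x)) //= /level pmp_act1 eqxx big1 ?addr0 // => g.
by rewrite eq_sym => /negPf ->.
Qed.

Lemma sum_normz_coeff (s : seq (sing R M n)) (w : chain R M n) : uniq s ->
  (\sum_(r <- s) `|coeff r w|)%:~R <= chain_norm w :> R.
Proof.
move=> us; rewrite /chain_norm -intr_sum ler_int.
rewrite (bigID (mem (dom w))) /= [X in _ + X]big1 ?addr0; last first.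
  by move=> r rw; rewrite coeff_outdom // normr0.
rewrite [leRHS](bigID (mem s)) /= -[leLHS]addr0; apply: lerD; last exact: sumr_ge0.
rewrite -[leLHS]big_filter -[leRHS]big_filter; rewrite le_eqVlt; apply/orP; left.
apply/eqP; apply: perm_big; apply: uniq_perm; rewrite ?filter_uniq ?uniq_dom // => r.
by rewrite !mem_filter andbC.
Qed.

Definition z_norm : int := \sum_(t <- dom z) `|coeff t z|.

(** At a point where [phi] is equivariant along the elements that occur in [z],
    all simplices of one orbit are translated to the same position, so that the
    cancellation between their coefficients takes place before coning. *)
Lemma sum_weight_good (x : X) :
  (forall t, t \in dom z -> phi (a (hol t) x) = (hol t * phi x)%g) ->
  \sum_(k <- [seq (g, s) | g <- positions, s <- base_simplices]) `|weight k x|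
  <= \sum_(s <- base_simplices) `|coeff s (proj_chain univp z)|.
Proof.
move=> good; rewrite big_allpairs_dep exchange_big /=; apply: ler_sum => s _.
have wE g : weight (g, s) x = coeff s (proj_chain univp z) * (g == (phi x)^-1%g)%:R.
  rewrite coeff_proj /weight big_filter mulr_suml big_seq_cond [RHS]big_seq_cond.
  apply: eq_bigr => t /andP[tz _]; rewrite /level good //=; congr (_ * (nat_of_bool _)%:R).
  apply/eqP/eqP => [/(congr1 (fun h => (hol t)^-1 * h)%g)|->]; last by rewrite invgK.
  by rewrite !mulKg => ->; rewrite invgK.
under eq_bigr do rewrite wE normrM.
rewrite -mulr_sumr ler_piMr //.
have [gp|gp] := boolP ((phi x)^-1%g \in positions).
  rewrite (bigD1_seq _ gp) ?undup_uniq //= eqxx normr1 big1 ?addr0 // => g /negPf ->.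
  by rewrite normr0.
rewrite big_seq big1 // => g gpos; have /negPf -> : g != (phi x)^-1%g.
  by apply: contra gp => /eqP <-.
by rewrite normr0.
Qed.

(** Without any equivariance each simplex of [z] still contributes at only one
    position. *)
Lemma sum_weight_le (x : X) :
  \sum_(k <- [seq (g, s) | g <- positions, s <- base_simplices]) `|weight k x|
  <= z_norm.
Proof.
rewrite big_allpairs_dep /=.
apply: (@le_trans _ _ (\sum_(g <- positions) \sum_(s <- base_simplices)
    \sum_(t <- dom z | proj t == s) `|coeff t z| * level (hol t) (hol t * g^-1)%g x)).
  apply: ler_sum => g _; apply: ler_sum => s _.
  rewrite /weight big_filter; apply: le_trans (ler_norm_sum _ _ _) _.
  by apply: ler_sum => t _; rewrite normrM /level normr_nat.
apply: (@le_trans _ _ (\sum_(g <- positions) \sum_(t <- dom z)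
    `|coeff t z| * level (hol t) (hol t * g^-1)%g x)).
  apply: ler_sum => g _; rewrite (sum_fibres (f := fun t : sing R E n => proj t)
      (fun t => `|coeff t z| * level (hol t) (hol t * g^-1)%g x)) ?undup_uniq //.
  by move=> t tz; rewrite mem_undup map_f.
rewrite exchange_big /=; apply: ler_sum => t _.
rewrite -mulr_sumr ler_piMr //.
pose g0 := ((phi (a (hol t) x))^-1 * hol t)%g.
have lE g : level (hol t) (hol t * g^-1)%g x = (g == g0)%:R.
  rewrite /level /g0; congr (nat_of_bool _)%:R; apply/eqP/eqP => [->|->].
    by rewrite invgM invgK mulgVK.
  by rewrite invgM invgK mulVKg.
under eq_bigr do rewrite lE.
have [gp|gp] := boolP (g0 \in positions).
  by rewrite (bigD1_seq _ gp) ?undup_uniq //= eqxx big1 ?addr0 // => g /negPf ->.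
rewrite big_seq big1 // => g gpos; have /negPf -> // : g != g0.
by apply: contra gp => /eqP <-.
Qed.

(** The trivial bound is needed only where [phi] fails to be equivariant along an
    element that occurs in [z], which is a set of small mass. *)
Lemma norm_filling (e : R) :
  (forall t, t \in dom z -> mass mu (noneq a phi (hol t)) <= e) ->
  norm_alpha filling <= chain_norm (proj_chain univp z)
    + z_norm%:~R * ((size (dom z))%:R * e).
Proof.
move=> noneqe.
pose Bad := [set x | exists2 t, t \in dom z & noneq a phi (hol t) x].
have fphi : finite_valued phi by split=> //; exists V.
have mne t : measurable (noneq a phi (hol t)) by exact: measurable_noneq.
have mBad : measurable Bad by exact: measurable_bigcup_seq.
have massBad : mass mu Bad <= (size (dom z))%:R * e.
  apply: le_trans (mass_bigcup_seq mu _ mne) _.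
  rewrite big_seq; apply: le_trans (ler_sum _ _) _ => [t tz|]; first exact: noneqe.
  by rewrite -big_seq big_const_seq count_predT iter_addr addr0 mulr_natl.
have zn0 : 0 <= (z_norm%:~R : R) by rewrite ler0z; exact: sumr_ge0.
rewrite /filling; apply: le_trans (norm_alpha_le a univp lM _
  (fun k => act (Linf_of mu (weight k)) k.1^-1%g)
  (fun k => cone (deck_sing k.1 (lift_sing p e0 k.2)))) _.
under eq_bigr do rewrite LinfZ_norm_act (LinfZ_norm_of mu (simple_int_weight _)).
rewrite -expect_sum => [|k]; last first.
  exact: (bounded_measurable_absz R (simple_int_weight _)).
pose C : R := (\sum_(s <- base_simplices) `|coeff s (proj_chain univp z)|)%:~R.
have bBad : bounded_measurable (\1_Bad : X -> R) by exact: bounded_measurable_indic.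
apply: (@le_trans _ _ (expect mu (fun x => C + z_norm%:~R * \1_Bad x))).
  apply: le_expect.
  - apply: bounded_measurable_sum => k.
    exact: (bounded_measurable_absz R (simple_int_weight _)).
  - by apply: bounded_measurableD; [exact: bounded_measurable_cst|exact: bounded_measurableZ].
  - move=> x; rewrite -intr_sum.
    have [Bx|nBx] := pselect (Bad x).
      rewrite indicE mem_set // mulr1; apply: (@le_trans _ _ z_norm%:~R).
        by rewrite ler_int; exact: sum_weight_le.
      by rewrite lerDr ler0z; exact: sumr_ge0.
    rewrite indicE memNset // mulr0 addr0 ler_int; apply: sum_weight_good => t tz.
    by apply: contrapT => ne; apply: nBx; exists t.
rewrite expectD; [|exact: bounded_measurable_cst|exact: bounded_measurableZ].
rewrite expect_cst expectZ // expect_indic //; apply: lerD.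
  by apply: sum_normz_coeff; exact: undup_uniq.
exact: ler_wpM2l.
Qed.

End Filling.

Theorem theorem1p4 (R : realType) (M : topologicalType) (n : nat)
    (E : topologicalType) (p : E -> M) (e0 : E)
    (d : measure_display) (X : measurableType d) (mu : probability X R)
    (alpha : pmp_action (pi1 R (p e0)) mu) :
  aspherical R M ->
  universal_covering R p ->
  amenable R (pi1 R (p e0)) ->
  countable [set: pi1 R (p e0)] ->
  standard_borel R X ->
  essentially_free alpha ->
  exists2 K : R, 0 < K &
    forall c : chain R M n, is_cycle c -> null_homologous c ->
      exists2 b : chain_alpha alpha n.+1,
        boundary_alpha b = chain_incl alpha c &
        norm_alpha b <= K * chain_norm c.
Proof.
move=> [cM lpM [E' [p' [univp' cE']]]] univp amG _ sX free.
have lM := locally_path_connected_joined lpM.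
have [x [H [cH H0 H1]]] :=
  contractible_universal_covering e0 cM lM univp univp' cE'.
(* A nonzero integral chain has norm at least one, which absorbs the error
   coming from the points where [phi] is not equivariant. *)
exists 2 => // c _ [D0 D0c].
pose D := lift_chain p e0 D0; pose z := sing_boundary D.
have zc : proj_chain univp z = c.
  by rewrite -proj_boundary (proj_lift_chain e0 univp cM) D0c.
have [hol holE] := sing_holonomy e0 univp lM cM n.
pose N : R := (z_norm z)%:~R * (size (dom z))%:R.
have N0 : 0 <= N by rewrite mulr_ge0 // ler0z; exact: sumr_ge0.
have [c0|c0] := eqVneq c 0.
  have [t0 _ _ _ _] := zmod_morphism_laws (tens_alpha_additiver alpha (n := n) (LinfZ_cst mu 1)).
  have [b0 _ _ _ _] := zmod_morphism_laws (boundary_alpha_additive (a := alpha) (n := n)).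
  exists 0.
    have [p0 _ _ _ _] := zmod_morphism_laws (proj_chain_additive univp (n := n)).
    by rewrite b0 c0 -p0 (chain_incl_proj alpha univp lM cM) t0.
  have := norm_alpha_le alpha univp lM (n := n.+1) [::] (fun _ : nat => 0) (fun=> cst e0).
  rewrite !big_nil => /le_trans; apply.
  by rewrite mulr_ge0 //; apply: sumr_ge0 => s _; rewrite ler0z.
have c1 : 1 <= chain_norm c.
  have : dom c != [::] by rewrite dom_eq0.
  case E0 : (dom c) => [//|s r] _.
  have : coeff s c != 0 by rewrite -mem_dom E0 mem_head.
  rewrite /chain_norm E0 big_cons -normr_gt0 => s0.
  apply: (@le_trans _ _ `|coeff s c|%:~R); first by rewrite -[1]/(1%:~R) ler_int; lia.
  by rewrite lerDl; apply: sumr_ge0 => t _; rewrite ler0z.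
have e1 : 0 < (N + 1)^-1 by rewrite invr_gt0 ltr_wpDl.
have [phi fphi phie] :=
  approx_equivariant [seq hol t | t <- dom z] amG sX free e1.
have [[V phiV] mphi] := fphi.
have phiV' y : phi y \in undup V by rewrite mem_undup.
exists (filling alpha univp cH H1 phi (undup V) hol z).
  rewrite (boundary_filling alpha lM cH H0 H1 (undup_uniq V) phiV' mphi holE (erefl z)).
  by rewrite -(chain_incl_proj alpha univp lM cM) zc.
have noneqe t : t \in dom z -> mass mu (noneq alpha phi (hol t)) <= (N + 1)^-1.
  by move=> tz; apply: phie; exact: map_f.
have := norm_filling univp lM cH H1 phiV' mphi noneqe.
move=> /le_trans; apply.
rewrite zc mulrA -/N; have : N / (N + 1) <= 1 by rewrite ler_pdivrMr; lra.
lra.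
Qed.
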